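(* Fix the parameter $\varepsilon>0$, and let $\alpha_1,\alpha_2>0$. There exists a constant $C=C(\alpha_1,\alpha_2)>0$ such that the following holds for every $\beta\ge 0$. If $f_0\in H^1(\mathbb{T})$ has zero mean and satisfies $$\|f_0\|_{H^1(\mathbb{T})}\le C(\alpha_1,\alpha_2),$$ then the solution $f=f(x,t)$, $x\in\mathbb{T}$, of $$\begin{aligned} 2\varepsilon f_t={}&\mathcal{N}\partial_1 f+(\alpha_1+\alpha_2)\mathcal{N}\partial_1^2 f+\mathcal{N}Hf-\beta\,\mathcal{N}H\partial_1^2 f+\alpha_1\alpha_2\,\mathcal{N}\partial_1^3 f\\ &-\varepsilon\,\mathcal{N}\Big\{2f\partial_1 f+\Lambda[H,\Lambda^{-1}f]f+\beta\Lambda[H,\Lambda^{-1}f]\Lambda^2 f-\alpha_2\Lambda[H,f]\partial_1 f\\ &\qquad\quad+\alpha_2\partial_1(f\partial_1 f)+\alpha_1\Lambda[\partial_1^2,\Lambda^{-1}f]f\Big\} \end{aligned}$$ with initial data $f(\cdot,0)=f_0$ is global in time, with $$f\in C([0,\infty),H^1(\mathbb{T}))\cap L^2([0,\infty);H^2(\mathbb{T})),$$ and, furthermore, it decays towards the equilibrium, i.e. $\|f(\cdot,t)\|_{H^1(\mathbb{T})}\to 0$ as $t\to\infty$.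
   Context: $\mathbb{T}$ is the one-dimensional torus, i.e. $[-\pi,\pi]$ with periodic boundary conditions; functions are real-valued. $\partial_1$ is the derivative in the space variable $x$ and $f_t=\partial f/\partial t$. On the Fourier side (frequencies $k\in\mathbb{Z}$), the Hilbert transform $H$ and the operator $\Lambda$ are the multipliers $$\widehat{Hf}(k)=-i\,\mathrm{sgn}(k)\hat f(k),\qquad \widehat{\Lambda f}(k)=|k|\hat f(k),$$ with $\mathrm{sgn}(0)=0$. For zero-mean $f$, $\Lambda^{-1}f$ is the zero-mean function with $\widehat{\Lambda^{-1}f}(k)=|k|^{-1}\hat f(k)$ for $k\ne0$. For an operator $\mathcal{T}$ and a function $f$, the commutator is $[\mathcal{T},f]g=\mathcal{T}(fg)-f\,\mathcal{T}(g)$; thus for instance $[H,\Lambda^{-1}f]g=H\big((\Lambda^{-1}f)\,g\big)-(\Lambda^{-1}f)\,Hg$. The operator $\mathcal{N}$ is $$\mathcal{N}=\Big(1-\Big(\tfrac{\alpha_1+\alpha_2}{2}\Big)^2\partial_1^2\Big)^{-1}\Big(1-\tfrac{\alpha_1+\alpha_2}{2}\,\partial_1\Big).$$ The constants $\varepsilon,\beta,\alpha_1,\alpha_2$ are dimensionless parameters measuring nonlinearity, surface tension and viscosity. *)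

(* Defs.v *)
From HB Require Import structures.
From mathcomp Require Export all_boot all_order all_algebra.
From mathcomp Require Export all_classical all_reals all_analysis.
From mathcomp.real_closed Require Export complex.

Set Implicit Arguments.
Unset Strict Implicit.
Unset Printing Implicit Defensive.

Export Order.TTheory GRing.Theory Num.Theory.
Export numFieldNormedType.Exports.

Local Open Scope classical_set_scope.
Local Open Scope ring_scope.

Local Notation Leb R := (@lebesgue_measure R).

(** ** Functions on the torus *)

(* Functions on the torus are 2pi-periodic functions on the line, identified
   when they agree almost everywhere. *)
Definition L2T (R : realType) (u : R -> R) : Prop :=
  [/\ periodic u (pi *+ 2), measurable_fun setT u
    & (Leb R).-integrable `[- pi, pi] (EFin \o (fun x => u x ^+ 2))].

Definition ae_eqT (R : realType) (u v : R -> R) : Prop :=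
  {ae Leb R, forall x, u x = v x}.

Definition zero_mean (R : realType) (u : R -> R) : Prop :=
  \int[Leb R]_(x in `[- pi, pi]) u x = 0.

Definition cintegrable (R : realType) (D : set R) (g : R -> R[i]) : Prop :=
  (Leb R).-integrable D (EFin \o (fun s => complex.Re (g s))) /\
  (Leb R).-integrable D (EFin \o (fun s => complex.Im (g s))).

Definition cintegral (R : realType) (D : set R) (g : R -> R[i]) : R[i] :=
  Complex (\int[Leb R]_(s in D) complex.Re (g s))
          (\int[Leb R]_(s in D) complex.Im (g s)).

(* A periodic distribution is identified with the family of its Fourier
   coefficients; a function u is the distribution [fourier u]. *)
Definition pdist (R : realType) := int -> R[i].

(* (2 pi)^-1 * \int_(-pi)^pi u(x) e^(-ikx) dx *)
Definition fourier (R : realType) (u : R -> R) : pdist R :=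
  fun k => ((pi *+ 2)^-1)%:C%C *
    cintegral `[- pi, pi]
      (fun x => (u x)%:C%C * Complex (cos (k%:~R * x)) (- sin (k%:~R * x))).

(** ** Sobolev spaces *)

Definition sobolev_norm2 (R : realType) (s : nat) (u : R -> R) : \bar R :=
  \esum_(k in [set: int])
    ((1 + (k%:~R : R) ^+ 2) ^+ s * ComplexField.Normc.normc (fourier u k) ^+ 2)%:E.

Definition sobolev_norm (R : realType) (s : nat) (u : R -> R) : \bar R :=
  (sobolev_norm2 s u `^ 2^-1)%E.

Definition sobolev (R : realType) (s : nat) (u : R -> R) : Prop :=
  L2T u /\ (sobolev_norm2 s u < +oo)%E.

(** ** Operators *)

Definition fmult (R : realType) (m : int -> R[i]) (g : pdist R) : pdist R :=
  fun k => m k * g k.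

Definition dx (R : realType) : pdist R -> pdist R :=
  fmult (fun k => 'i%C * k%:~R).

Definition hilbert (R : realType) : pdist R -> pdist R :=
  fmult (fun k => - 'i%C * (sgz k)%:~R).

Definition Lam (R : realType) : pdist R -> pdist R :=
  fmult (fun k => `|k|%:~R).

(* The multiplier vanishes at k = 0, because 0^-1 = 0. *)
Definition Laminv (R : realType) : pdist R -> pdist R :=
  fmult (fun k => (`|k|%:~R)^-1).

(* (1 - a^2 dx^2)^-1 (1 - a dx) with a = (alpha1 + alpha2) / 2 *)
Definition opN (R : realType) (alpha1 alpha2 : R) : pdist R -> pdist R :=
  let a : R[i] := ((alpha1 + alpha2) / 2)%:C%C in
  fmult (fun k => (1 - a ^+ 2 * ('i%C * k%:~R) ^+ 2)^-1
                  * (1 - a * ('i%C * k%:~R))).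

(* The square integrable function whose Fourier coefficients are g (unique up
   to a null set); the junk value 0 if there is none. *)
Definition fun_of (R : realType) (g : pdist R) : R -> R :=
  xget (cst 0) [set u : R -> R | L2T u /\ fourier u = g].

(* The pointwise product of two square integrable functions, which is an
   integrable function. *)
Definition dprod (R : realType) (g h : pdist R) : pdist R :=
  fourier (fun x => fun_of g x * fun_of h x).

(* [T, f] g = T (f g) - f (T g) *)
Definition commutator (R : realType) (T : pdist R -> pdist R)
    (f g : pdist R) : pdist R :=
  T (dprod f g) - dprod f (T g).

(** ** The evolution equation *)

(* For f in H^2 both factors of every product below are square integrable,
   while the terms as a whole may be distributions before N is applied. *)
Definition rhs (R : realType) (eps beta alpha1 alpha2 : R) (f : pdist R) :
    pdist R :=
  let N := opN alpha1 alpha2 in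
  N (dx f)
  + (alpha1 + alpha2)%:C%C *: N (dx (dx f))
  + N (hilbert f)
  - beta%:C%C *: N (hilbert (dx (dx f)))
  + (alpha1 * alpha2)%:C%C *: N (dx (dx (dx f)))
  - eps%:C%C *: N (
      2 *: dprod f (dx f)
      + Lam (commutator (@hilbert R) (Laminv f) f)
      + beta%:C%C *: Lam (commutator (@hilbert R) (Laminv f) (Lam (Lam f)))
      - alpha2%:C%C *: Lam (commutator (@hilbert R) f (dx f))
      + alpha2%:C%C *: dx (dprod f (dx f))
      + alpha1%:C%C *: Lam (commutator (@dx R \o @dx R) (Laminv f) f)).

Definition time_interval (R : realType) (T : \bar R) : set R :=
  [set t | 0 <= t /\ (t%:E < T)%E].

(* u belongs to C(I, H^s). *)
Definition continuous_in_sobolev (R : realType) (I : set R) (s : nat)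
    (u : R -> R -> R) : Prop :=
  (forall t, I t -> sobolev s (u t)) /\
  (forall t, I t ->
     (fun t' => sobolev_norm s (u t' \- u t)) @ within I (nbhs t) --> 0%E).

(* u belongs to L^2(I; H^s); finiteness of the integral forces u t to be in H^s
   for almost every t in I. *)
Definition square_integrable_in_sobolev (R : realType) (I : set R) (s : nat)
    (u : R -> R -> R) : Prop :=
  (\int[Leb R]_(t in I) sobolev_norm2 s (u t) < +oo)%E.

(* f t x solves the initial value problem on [0, T), where T may be +oo, in the
   class C([0,T), H^1) /\ L^2_loc([0,T); H^2). Since f t is in H^2 only for
   almost every t, the equation 2 eps f_t = rhs holds in the sense of
   distributions, i.e. integrated in time, frequency by frequency. The mean of
   f t has to vanish for Lambda^-1 f to make sense. *)
Definition is_solution (R : realType) (eps beta alpha1 alpha2 : R)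
    (f0 : R -> R) (T : \bar R) (f : R -> R -> R) : Prop :=
  [/\ continuous_in_sobolev (time_interval T) 1 f,
      forall t, time_interval T t ->
        zero_mean (f t) /\ square_integrable_in_sobolev `[0, t] 2 f,
      ae_eqT (f 0) f0
    & forall t (k : int), time_interval T t ->
        let g s := rhs eps beta alpha1 alpha2 (fourier (f s)) k in
        cintegrable `[0, t] g /\
        2 * eps%:C%C * (fourier (f t) k - fourier (f 0) k)
          = cintegral `[0, t] g].

(* Main.v *)
From HB Require Import structures.
Require Import Defs.
From mathcomp Require Import measurable_realfun ring lra zify.

(** In terms of Fourier coefficients the equation is a system of ordinary
    differential equations, one for each frequency k:

      u_k' = lam(k) u_k + B_k(u, u),

    where B_k(u, u) is the sum over j of bil(k, j) u_j u_(k-j) ([rhs_modes]).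
    The whole proof takes place on this system. It rests on three facts about
    the symbols. The linear part dissipates: Re lam(k) is at most
    - c (k^2 + beta |k|) ([lam_re_le]). The bilinear symbol is bounded by
    C0 (1 + beta / |k|) |j| |k - j|, so that by Cauchy-Schwarz B_k is
    controlled by the square of the H^1 norm, and its quotient by the
    dissipation rate is of size 1 / k^2 whatever beta is; this is why one
    smallness threshold serves all beta. Finally bil is also bounded by
    C1 (|j| + |k - j|), with C1 depending on beta ([bil_le]). The bounds on bil
    come from the smoothing of commutators: the commutator with H sees only
    those j that carry the largest frequency.

    Existence and decay: for small data a Picard iteration, each mode being
    solved by Duhamel's formula, contracts in the set of families bounded by
    e^(- c t / 2) (|u_k(0)| + eta / k^2) ([picard]). The bound that defines this
    set contains the exponential decay in H^1. The second bound on bil puts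
    B(u, u) in l^2, and two more derivatives are gained from the dissipation,
    so that the solution is square integrable in time with values in H^2, and
    in H^2 at each positive time ([parabolic_gain], [h2_integrable],
    [h2_positive_time]).

    Uniqueness: for two solutions on [0, t], both continuous in H^1 and hence
    bounded there, the difference w is estimated in the weaker norm
    sup |k| |w_k|, in which the second bound on bil makes the bilinear term
    lose no derivative; the dissipation then allows one to halve any
    exponential bound on w ([modes_unique]).

    Passing between functions and coefficients takes the injectivity of the
    Fourier transform on L^2 ([fourier_inj_ae]), the Riesz-Fischer theorem
    ([riesz_fischer]) and the convolution theorem for a product with an
    absolutely convergent Fourier series ([dprodE]). *)

Set Implicit Arguments.
Unset Strict Implicit.
Unset Printing Implicit Defensive.

Local Open Scope classical_set_scope.
Local Open Scope ring_scope.

Local Notation nc := ComplexField.Normc.normc.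
Local Notation Re := complex.Re.
Local Notation Im := complex.Im.
Local Notation Leb R := (@lebesgue_measure R).
Local Notation meas D := (@measurable _ (measurableTypeR _) D).
Local Notation mfun D f := (measurable_fun D (f : measurableTypeR _ -> _)).
Local Notation rint D f := ((Leb _).-integrable D (EFin \o f)).

(** * Complex numbers and sequences *)

Section ComplexNumbers.
Variable R : realType.
Implicit Types x y z : R[i].

Lemma ReD x y : Re (x + y) = Re x + Re y. Proof. by case: x; case: y. Qed.
Lemma ImD x y : Im (x + y) = Im x + Im y. Proof. by case: x; case: y. Qed.
Lemma ReN x : Re (- x) = - Re x. Proof. by case: x. Qed.
Lemma ImN x : Im (- x) = - Im x. Proof. by case: x. Qed.
Lemma ReB x y : Re (x - y) = Re x - Re y. Proof. by rewrite ReD ReN. Qed.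
Lemma ImB x y : Im (x - y) = Im x - Im y. Proof. by rewrite ImD ImN. Qed.
Lemma ReM x y : Re (x * y) = Re x * Re y - Im x * Im y.
Proof. by case: x; case: y. Qed.
Lemma ImM x y : Im (x * y) = Re x * Im y + Im x * Re y.
Proof. by case: x; case: y. Qed.
Lemma Re_sum I (r : seq I) (P : pred I) (F : I -> R[i]) :
  Re (\sum_(i <- r | P i) F i) = \sum_(i <- r | P i) Re (F i).
Proof. exact: (big_morph _ ReD). Qed.
Lemma complex_eq x y : Re x = Re y -> Im x = Im y -> x = y.
Proof. by case: x => a b; case: y => c d /= -> ->. Qed.

Lemma nc_ge0 z : 0 <= nc z. Proof. by case: z => a b /=; apply: sqrtr_ge0. Qed.
Lemma ncD x y : nc (x + y) <= nc x + nc y.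
Proof. exact: (@le_normcD R x y). Qed.
Lemma ncM x y : nc (x * y) = nc x * nc y. Proof. exact: ComplexField.Normc.normcM. Qed.
Lemma ncN x : nc (- x) = nc x. Proof. exact: (@normcN R x). Qed.
Lemma nc0 : nc (0 : R[i]) = 0. Proof. exact: ComplexField.Normc.normc0. Qed.
Lemma nc1 : nc (1 : R[i]) = 1. Proof. exact: ComplexField.Normc.normc1. Qed.
Lemma ncV x : nc x^-1 = (nc x)^-1. Proof. exact: ComplexField.Normc.normcV. Qed.
Lemma nc_eq0 x : nc x = 0 -> x = 0. Proof. exact: ComplexField.Normc.eq0_normc. Qed.
Lemma ncB x y : nc (x - y) <= nc x + nc y.
Proof. by rewrite -[nc y]ncN ncD. Qed.
Lemma ncC x y : nc (x - y) = nc (y - x).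
Proof. by rewrite -ncN opprB. Qed.
Lemma nc_sqr z : nc z ^+ 2 = Re z ^+ 2 + Im z ^+ 2.
Proof. by case: z => a b /=; rewrite sqr_sqrtr// addr_ge0// sqr_ge0. Qed.
Lemma Re_le_nc z : `|Re z| <= nc z.
Proof. by case: z => a b /=; rewrite -sqrtr_sqr ler_wsqrtr// lerDl sqr_ge0. Qed.
Lemma Im_le_nc z : `|Im z| <= nc z.
Proof. by case: z => a b /=; rewrite -sqrtr_sqr ler_wsqrtr// lerDr sqr_ge0. Qed.
Lemma nc_real (a : R) : nc (a%:C%C) = `|a|.
Proof. by rewrite /= expr0n addr0 sqrtr_sqr. Qed.
Lemma nc_le_ReIm z : nc z <= `|Re z| + `|Im z|.
Proof.
rewrite -(@ler_pXn2r _ 2)// ?nnegrE ?nc_ge0 ?addr_ge0// nc_sqr sqrrD.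
rewrite !real_normK ?num_real// addrAC lerDl.
by rewrite mulrn_wge0// mulr_ge0.
Qed.
Lemma nc_conj z : nc (z^*%C) = nc z.
Proof. by case: z => a b /=; rewrite sqrrN. Qed.
Lemma nc_sum I (r : seq I) (P : pred I) (F : I -> R[i]) :
  nc (\sum_(i <- r | P i) F i) <= \sum_(i <- r | P i) nc (F i).
Proof.
elim/big_rec2: _ => [|i b a _ ba]; first by rewrite nc0.
by rewrite (le_trans (ncD _ _))// lerD2l.
Qed.
Lemma conjM x y : ((x * y)^*)%C = (x^*)%C * (y^*)%C.
Proof. exact: (rmorphM (@conjc R)). Qed.
Lemma conjD x y : ((x + y)^*)%C = (x^*)%C + (y^*)%C.
Proof. exact: (rmorphD (@conjc R)). Qed.
Lemma conjN x : ((- x)^*)%C = - (x^*)%C.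
Proof. exact: (rmorphN (@conjc R)). Qed.
Lemma conjC_sum I (r : seq I) (P : pred I) (F : I -> R[i]) :
  ((\sum_(i <- r | P i) F i)^*)%C = \sum_(i <- r | P i) ((F i)^*)%C.
Proof. exact: raddf_sum. Qed.
End ComplexNumbers.

Section ComplexSequences.
Variable R : realType.

Lemma cvg_half_pow (a : R) : (fun n => a / 2 ^+ n) @ \oo --> (0 : R).
Proof.
rewrite -[X in _ --> X](mulr0 a); apply: cvgM; first exact: cvg_cst.
under eq_fun do rewrite -exprVn.
by apply: cvg_expr; rewrite ger0_norm ?invr_ge0// invf_lt1// ltr1n.
Qed.

(** The modulus is real, whereas the norm of R[i] takes values in R[i]
    itself; convergence is therefore that of a real sequence. *)
Definition ccvg (u : nat -> R[i]) (l : R[i]) := nc (u n - l) @[n --> \oo] --> (0 : R).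

Lemma squeeze0 (u v : nat -> R) : (forall n, 0 <= u n <= v n) ->
  v @ \oo --> (0 : R) -> u @ \oo --> (0 : R).
Proof.
move=> uv v0; apply: (@squeeze_cvgr _ _ _ _ (fun=> 0) v) => //; last exact: cvg_cst.
by apply: nearW => n; exact: uv.
Qed.

Lemma ccvg_le u l (v : nat -> R) : (forall n, nc (u n - l) <= v n) ->
  v @ \oo --> (0 : R) -> ccvg u l.
Proof. by move=> uv; apply: squeeze0 => n; rewrite nc_ge0 uv. Qed.

Lemma ccvg_unique u l l' : ccvg u l -> ccvg u l' -> l = l'.
Proof.
move=> ul ul'; apply/eqP; rewrite -subr_eq0; apply/eqP/nc_eq0.
have h : nc (u n - l) + nc (u n - l') @[n --> \oo] --> (0 + 0 : R) by exact: cvgD.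
rewrite addr0 in h.
have hs n : 0 <= nc (l - l') <= nc (u n - l) + nc (u n - l').
  rewrite nc_ge0/=.
  have -> : l - l' = (u n - l') - (u n - l) by ring.
  by rewrite [leRHS]addrC; exact: ncB.
have /cvg_lim := squeeze0 hs h; rewrite lim_cst => [<-//|]; exact: Rhausdorff.
Qed.

Lemma ccvgD u v l l' : ccvg u l -> ccvg v l' -> ccvg (fun n => u n + v n) (l + l').
Proof.
move=> ul vl.
have h : nc (u n - l) + nc (v n - l') @[n --> \oo] --> (0 + 0 : R) by exact: cvgD.
rewrite addr0 in h; apply: ccvg_le h => n.
have -> : u n + v n - (l + l') = (u n - l) + (v n - l') by ring.
exact: ncD.
Qed.

Lemma ccvgZ u l (c : R[i]) : ccvg u l -> ccvg (fun n => c * u n) (c * l).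
Proof.
move=> ul; have h : nc c * nc (u n - l) @[n --> \oo] --> (nc c * 0 : R).
  by apply: cvgM => //; exact: cvg_cst.
rewrite mulr0 in h; apply: ccvg_le h => n.
by rewrite -mulrBr ncM.
Qed.

Lemma ccvg_conj u l : ccvg u l -> ccvg (fun n => (u n)^*%C) (l^*%C).
Proof.
move=> ul; apply: ccvg_le ul => n.
by rewrite -[X in nc X]raddfB/= nc_conj.
Qed.

Lemma ccvg_cst l : ccvg (fun=> l) l.
Proof. by rewrite /ccvg subrr nc0; exact: cvg_cst. Qed.

Lemma ccvg_components u l : ccvg u l <->
  (Re (u n) @[n --> \oo] --> Re l) /\ (Im (u n) @[n --> \oo] --> Im l).
Proof.
split=> [ul|[rl il]].
  split; apply/cvgrPdist_le => e e0; move/cvgrPdist_le: ul => /(_ _ e0);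
    apply: filterS => n; rewrite sub0r normrN ger0_norm ?nc_ge0// => h.
    by rewrite distrC -ReB (le_trans (Re_le_nc _)).
  by rewrite distrC -ImB (le_trans (Im_le_nc _)).
have h : `|Re (u n) - Re l| + `|Im (u n) - Im l| @[n --> \oo] --> (`|Re l - Re l| + `|Im l - Im l| : R).
  by apply: cvgD; apply: cvg_norm; apply: cvgB => //; exact: cvg_cst.
rewrite !subrr normr0 addr0 in h; apply: ccvg_le h => n.
by rewrite (le_trans (nc_le_ReIm _))// ReB ImB.
Qed.

Lemma ccvg_nc_le u l K : ccvg u l -> (forall n, nc (u n) <= K) -> nc l <= K.
Proof.
move=> ul uK; apply/ler_addgt0Pr => e e0.
move/cvgrPdist_le: ul => /(_ _ e0)[n _ /(_ n (leqnn n))/=].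
rewrite sub0r normrN ger0_norm ?nc_ge0// => h.
have -> : l = u n - (u n - l) by ring.
by rewrite (le_trans (ncB _ _))// lerD.
Qed.

(** Completeness, in the quantitative form that a contracting iteration calls
    for. *)
Lemma ccvg_geometric (u : nat -> R[i]) (A : R) :
  (forall n, nc (u n.+1 - u n) <= A / 2 ^+ n) ->
  exists l, forall n, nc (u n - l) <= 2 * A / 2 ^+ n.
Proof.
move=> hu.
have hmn n p : nc (u (n + p)%N - u n) <= 2 * A / 2 ^+ n - 2 * A / 2 ^+ (n + p).
  elim: p => [|p IH]; first by rewrite addn0 !subrr nc0.
  rewrite addnS.
  have -> : u (n + p).+1 - u n = (u (n + p).+1 - u (n + p)%N) + (u (n + p)%N - u n) by ring.
  apply: (le_trans (ncD _ _)); apply: (le_trans (lerD (hu _) IH)).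
  rewrite exprS invfM; set x := (2 ^+ (n + p))^-1; set y := (2 ^+ n)^-1.
  lra.
have A0 : 0 <= A by have := hu 0%N; rewrite expr0 divr1; exact/le_trans/nc_ge0.
have hcv := cvg_half_pow (2 * A).
have cau (f : R[i] -> R) : (forall x y, `|f x - f y| <= nc (x - y)) ->
    cvgn (fun n => f (u n)).
  move=> ff; apply: cauchy_cvg; apply/cauchy_ballP => e e0.
  have e20 : 0 < e / 2 by rewrite divr_gt0.
  move/cvgrPdist_lt: hcv => /(_ _ e20)[N _ /= hN].
  have hB n : (N <= n)%N -> `|f (u n) - f (u N)| < e / 2.
    move=> Nn; apply: (le_lt_trans (ff _ _)).
    rewrite -(subnKC Nn); apply: (le_lt_trans (hmn _ _)).
    apply: (@le_lt_trans _ _ (2 * A / 2 ^+ N)).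
      by rewrite gerBl divr_ge0// mulr_ge0.
    have := hN N (leqnn N); rewrite sub0r normrN ger0_norm//.
    by rewrite divr_ge0// mulr_ge0.
  exists ((fun n => f (u n)) @` [set n | (N <= n)%N], (fun n => f (u n)) @` [set n | (N <= n)%N]).
    by split; exists N => // n /= Nn; exists n.
  move=> [a b] [/= [n Nn <-] [m Nm <-]]; rewrite /ball/=.
  have -> : f (u n) - f (u m) = (f (u n) - f (u N)) - (f (u m) - f (u N)) by ring.
  by rewrite (le_lt_trans (ler_normB _ _))// (splitr e) ltrD// hB.
have cR : cvgn (fun n => Re (u n)).
  by apply: cau => x y; rewrite -ReB; exact: Re_le_nc.
have cI : cvgn (fun n => Im (u n)).
  by apply: cau => x y; rewrite -ImB; exact: Im_le_nc.
pose l := Complex (limn (fun n => Re (u n))) (limn (fun n => Im (u n))).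
have ul : ccvg u l by apply/ccvg_components.
exists l => n.
rewrite ncC; apply: (@ccvg_nc_le (fun p => u (n + p)%N - u n)).
  have := ul; rewrite /ccvg -(cvg_shiftn n).
  rewrite (_ : (fun p => _) = (fun p => nc (u (p + n)%N - l)))//.
  by apply/funext => p; congr nc; rewrite addnC; ring.
move=> p; apply: (le_trans (hmn _ _)).
by rewrite gerBl divr_ge0// mulr_ge0.
Qed.
End ComplexSequences.

(** * Absolutely convergent sums over the integers *)

Section BoundedSums.
Variable R : realType.
Implicit Types (a b : int -> R) (K L : R).

(** Summability of a nonnegative family, through its finite partial sums:
    no order of summation has to be fixed. *)
Definition sum_le a K := forall s : seq int, uniq s -> \sum_(j <- s) a j <= K.

(** Symmetric ranges make partial sums invariant under the reflection of the
    frequencies, which exchanges the coefficients of a real function with their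
    conjugates. *)
Fixpoint zrange n : seq int :=
  if n is m.+1 then n%:Z :: - n%:Z :: zrange m else [:: 0].

Definition psum (V : nmodType) (F : int -> V) n := \sum_(j <- zrange n) F j.

Lemma mem_zrange n (j : int) : (j \in zrange n) = (`|j| <= n)%N.
Proof.
elim: n => [|n IH]; first by rewrite inE; lia.
by rewrite /= !inE IH; lia.
Qed.

Lemma uniq_zrange n : uniq (zrange n).
Proof.
elim: n => [//|n IH] /=; rewrite !inE !mem_zrange IH; lia.
Qed.

Lemma psumS (V : nmodType) (F : int -> V) n :
  psum F n.+1 = F n.+1%:Z + (F (- n.+1%:Z) + psum F n).
Proof. by rewrite /psum /= !big_cons. Qed.

Lemma perm_zrangeN n : perm_eq (map -%R (zrange n)) (zrange n).
Proof.
apply: uniq_perm; last first; rewrite ?uniq_zrange ?map_inj_uniq ?uniq_zrange//; try exact: oppr_inj.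
move=> j; rewrite -[j]opprK mem_map; last exact: oppr_inj.
by rewrite !mem_zrange; lia.
Qed.

Lemma sub_zrange (s : seq int) : exists n, {subset s <= zrange n}.
Proof.
elim: s => [|x s [n hn]]; first by exists 0%N.
exists (n + `|x|)%N => j; rewrite inE mem_zrange => /orP[/eqP ->|/hn]; first lia.
by rewrite mem_zrange; lia.
Qed.

Lemma sum_sub_le a (s t : seq int) : (forall j, 0 <= a j) -> uniq s -> uniq t ->
  {subset s <= t} -> \sum_(j <- s) a j <= \sum_(j <- t) a j.
Proof.
move=> a0 us ut st.
rewrite [leRHS](bigID (mem s))/= -[X in X + _]big_filter.
have -> : \sum_(j <- [seq j <- t | j \in s]) a j = \sum_(j <- s) a j.
  apply: perm_big; apply: uniq_perm; rewrite ?filter_uniq// => j.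
  by rewrite mem_filter; case: (boolP (j \in s)) => //= /st ->.
by rewrite lerDl sumr_ge0.
Qed.

Lemma sum_leP a K : (forall j, 0 <= a j) -> (forall n, psum a n <= K) -> sum_le a K.
Proof.
move=> a0 h s us; have [n sn] := sub_zrange s.
apply: le_trans (h n); exact: sum_sub_le (uniq_zrange n) sn.
Qed.

Lemma sum_le_ge0 a K : sum_le a K -> 0 <= K.
Proof. by move=> /(_ [::] isT); rewrite big_nil. Qed.

Lemma sum_le_term a K j : sum_le a K -> a j <= K.
Proof. by move=> /(_ [:: j] isT); rewrite big_seq1. Qed.

Lemma le_sum_le a b K : (forall j, a j <= b j) -> sum_le b K -> sum_le a K.
Proof. by move=> ab h s us; apply: le_trans (h s us); apply: ler_sum. Qed.

Lemma sum_leW a K L : K <= L -> sum_le a K -> sum_le a L.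
Proof. by move=> KL h s us; apply: le_trans (h s us) KL. Qed.

Lemma sum_leD a b K L : sum_le a K -> sum_le b L ->
  sum_le (fun j => a j + b j) (K + L).
Proof. by move=> ha hb s us; rewrite big_split lerD// ?ha ?hb. Qed.

Lemma sum_leZ a K (c : R) : 0 <= c -> sum_le a K -> sum_le (fun j => c * a j) (c * K).
Proof. by move=> c0 ha s us; rewrite -mulr_sumr ler_wpM2l// ha. Qed.

Lemma sum_le_inj a K (f : int -> int) : injective f -> sum_le a K ->
  sum_le (fun j => a (f j)) K.
Proof.
move=> fi ha s us; rewrite -(big_map f xpredT a); apply: ha.
by rewrite map_inj_uniq.
Qed.

Lemma sum_le_refl a K (k : int) : sum_le a K -> sum_le (fun j => a (k - j)) K.
Proof. by apply: sum_le_inj => x y; lia. Qed.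

Lemma sum_le_shift a K (k : int) : sum_le a K -> sum_le (fun j => a (j - k)) K.
Proof. by apply: sum_le_inj => x y; lia. Qed.

(** Young's inequality for P / A and Q / B. *)
Lemma sum_le_cauchy_schwarz (P Q : int -> R) (A B : R) : 0 <= A -> 0 <= B ->
  sum_le (fun j => P j ^+ 2) (A ^+ 2) -> sum_le (fun j => Q j ^+ 2) (B ^+ 2) ->
  sum_le (fun j => `|P j| * `|Q j|) (A * B).
Proof.
move=> A0 B0 hP hQ s us.
(* If one bound is zero, that family vanishes and cannot be normalized. *)
have vanish (S : int -> R) : sum_le (fun j => S j ^+ 2) (0 ^+ 2) -> forall j, S j = 0.
  move=> hS j; apply/eqP; rewrite -sqrf_eq0 eq_le sqr_ge0 andbT.
  by have := sum_le_term j hS; rewrite expr0n.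
move: A0; rewrite le_eqVlt => /predU1P[A0|A0].
  rewrite -A0 mul0r big1// => j _; rewrite (vanish P) ?normr0 ?mul0r//.
  by rewrite A0.
move: B0; rewrite le_eqVlt => /predU1P[B0|B0].
  rewrite -B0 mulr0 big1// => j _; rewrite (vanish Q) ?normr0 ?mulr0//.
  by rewrite B0.
have h j : `|P j| * `|Q j| <= A * B / 2 * ((A ^+ 2)^-1 * P j ^+ 2 + (B ^+ 2)^-1 * Q j ^+ 2).
  rewrite -[P j ^+ 2]real_normK ?num_real// -[Q j ^+ 2]real_normK ?num_real//.
  set p := `|P j|; set q := `|Q j|.
  rewrite -subr_ge0.
  have -> : A * B / 2 * ((A ^+ 2)^-1 * p ^+ 2 + (B ^+ 2)^-1 * q ^+ 2) - p * q
    = (B * p - A * q) ^+ 2 / (2 * A * B).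
    by field; rewrite !gt_eqF.
  by rewrite divr_ge0 ?sqr_ge0// !mulr_ge0// ltW.
apply: (le_trans (ler_sum _ (fun j _ => h j))).
rewrite -mulr_sumr big_split/= -!mulr_sumr.
have {2}-> : A * B = A * B / 2 * (1 + 1) by field.
apply: ler_wpM2l; first by rewrite divr_ge0 ?mulr_ge0 ?ltW.
apply: lerD.
  by rewrite ler_pdivrMl ?exprn_gt0// mulr1 hP.
by rewrite ler_pdivrMl ?exprn_gt0// mulr1 hQ.
Qed.

(** Telescoping: the partial sums stay below 4 - 2 / n. *)
Lemma sum_le_inv_sqr : sum_le (fun j => (j%:~R ^+ 2)^-1) 4.
Proof.
apply: sum_leP => [j|n]; first by rewrite invr_ge0 sqr_ge0.
have -> : psum (fun j : int => (j%:~R ^+ 2)^-1 : R) n =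
    \sum_(i < n) 2 * (i.+1%:R ^+ 2)^-1.
  elim: n => [|n IH]; first by rewrite /psum/= big_seq1 big_ord0 expr0n/= invr0.
  rewrite psumS IH big_ord_recr/= mulrNz sqrrN /=; ring.
case: n => [|n]; first by rewrite big_ord0.
suff : \sum_(i < n.+1) 2 * ((i.+1%:R : R) ^+ 2)^-1 <= 4 - 2 * n.+1%:R^-1.
  by move=> /le_trans; apply; rewrite gerBl mulr_ge0.
elim: n => [|n IH]; first by rewrite big_ord1/= expr1n invr1; lra.
rewrite big_ord_recr/=; apply: (le_trans (lerD IH (lexx _))).
have n0 : 0 < n.+1%:R :> R by rewrite ltr0n.
rewrite -(natr1 n.+1); set x : R := n.+1%:R in n0 *.
rewrite -subr_ge0.
have -> : 4 - 2 * (x + 1)^-1 - (4 - 2 * x^-1 + 2 * ((x + 1) ^+ 2)^-1) =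
   2 / (x * (x + 1) ^+ 2).
  by field; rewrite !gt_eqF//; lra.
by rewrite divr_ge0// mulr_ge0 ?sqr_ge0// ltW.
Qed.

Lemma esum_leP a K : (forall j, 0 <= a j) ->
  ((\esum_(k in [set: int]) (a k)%:E <= K%:E)%E <-> sum_le a K).
Proof.
move=> a0; split=> [h s us|h].
  rewrite -lee_fin -sumEFin; apply: le_trans h.
  apply: esum_ge; exists [set` s]; first by split => //; exact: finite_seq.
  by rewrite fsbig_seq.
apply: ge_ereal_sup => _ [A [fA _] <-].
rewrite fsbig_finite//= sumEFin lee_fin; apply: h.
exact: finmap.fset_uniq.
Qed.

Lemma sum_le_psum_cvg a K : (forall j, 0 <= a j) -> sum_le a K -> cvgn (psum a).
Proof.
move=> a0 h; apply: nondecreasing_is_cvgn.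
  by apply/nondecreasing_seqP => n; rewrite psumS addrA lerDr addr_ge0.
by exists K => _ [n _ <-]; apply: h; exact: uniq_zrange.
Qed.
End BoundedSums.

Section ComplexSums.
Variable R : realType.
Implicit Types (F G : int -> R[i]) (a : int -> R) (K : R).

Definition summ F := exists K, sum_le (fun j => nc (F j)) K.

(** The value 0 is junk, for divergent partial sums. *)
Definition zsum F : R[i] := xget 0 [set s | ccvg (psum F) s].

Lemma zsumE F l : ccvg (psum F) l -> zsum F = l.
Proof. by move=> h; rewrite /zsum; case: xgetP => [s _ /= /ccvg_unique|/(_ l)//]; exact. Qed.

Lemma psumD (V : nmodType) (F G : int -> V) n : psum (fun j => F j + G j) n = psum F n + psum G n.
Proof. by rewrite /psum big_split. Qed.

Lemma zsum_ccvg F : summ F -> ccvg (psum F) (zsum F).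
Proof.
move=> [K hK].
suff cau (f : R[i] -> R) : (forall x y, f (x + y) = f x + f y) -> f 0 = 0 ->
    (forall x, `|f x| <= nc x) -> cvgn (fun n => f (psum F n)).
  have cR := cau _ (@ReD R) erefl (@Re_le_nc R).
  have cI := cau _ (@ImD R) erefl (@Im_le_nc R).
  have h : ccvg (psum F) (Complex (limn (fun n => Re (psum F n)))
      (limn (fun n => Im (psum F n)))) by apply/ccvg_components.
  by rewrite (zsumE h).
move=> fD f0 ff.
have -> : (fun n => f (psum F n)) =
    (fun n => psum (fun j => f (F j) + nc (F j)) n - psum (fun j => nc (F j)) n).
  apply/funext => n; rewrite psumD addrK /psum.
  exact: (big_morph f fD f0).
apply: is_cvgB; last by apply: sum_le_psum_cvg hK => j; exact: nc_ge0.
apply: (@sum_le_psum_cvg _ _ (2 * K)) => [j|].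
  by have := ff (F j); rewrite ler_norml => /andP[+ _]; rewrite lerNl -subr_ge0 opprK addrC.
apply: (@le_sum_le _ _ (fun j => 2 * nc (F j))); last by apply: sum_leZ.
by move=> j; rewrite mulr2n mulrDl !mul1r lerD2r (le_trans (ler_norm _)).
Qed.

Lemma summ_le F a K : sum_le a K -> (forall j, nc (F j) <= a j) -> summ F.
Proof. by move=> ha h; exists K; apply: le_sum_le ha. Qed.

Lemma zsum_le F K : sum_le (fun j => nc (F j)) K -> nc (zsum F) <= K.
Proof.
move=> h; apply: (@ccvg_nc_le _ (psum F)); first by apply: zsum_ccvg; exists K.
by move=> n; apply: (le_trans (nc_sum _ _ _)); apply: h; exact: uniq_zrange.
Qed.

(** The truncation error is controlled by a sequence that depends on the
    majorant only; this uniformity is what lets limits, continuity and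
    integrals pass through the sum. *)
Lemma zsum_tail a K : (forall j, 0 <= a j) -> sum_le a K ->
  exists2 tau : nat -> R, tau @ \oo --> (0 : R) &
    forall F, (forall j, nc (F j) <= a j) ->
      forall n, nc (zsum F - psum F n) <= tau n.
Proof.
move=> a0 ha.
have ca := sum_le_psum_cvg a0 ha.
exists (fun n => limn (psum a) - psum a n).
  rewrite -[X in _ --> X](subrr (limn (psum a))); apply: cvgB => //; exact: cvg_cst.
move=> F Fa n.
have sF := summ_le ha Fa.
apply: (@ccvg_nc_le _ (fun p => psum F (p + n)%N - psum F n)).
  have := zsum_ccvg sF; rewrite /ccvg -(cvg_shiftn n).
  rewrite (_ : (fun p => nc (psum F (p + n)%N - psum F n - _)) = (fun p => nc (psum F (p + n)%N - zsum F)))//.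
  by apply/funext => p; congr nc; ring.
move=> p; apply: (@le_trans _ _ (psum a (p + n)%N - psum a n)); last first.
  rewrite lerD2r; apply: nondecreasing_cvgn_le => //.
  by apply/nondecreasing_seqP => m; rewrite psumS addrA lerDr addr_ge0.
elim: p => [|p IH]; first by rewrite add0n !subrr nc0.
rewrite addSn !psumS.
rewrite -[_ + _ - psum F n]addrA -[X in nc (_ + X)]addrA -[leRHS]addrA -[X in _ <= _ + X]addrA.
by rewrite (le_trans (ncD _ _))// lerD// (le_trans (ncD _ _))// lerD.
Qed.

Lemma summD F G : summ F -> summ G -> summ (fun j => F j + G j).
Proof.
move=> [K hK] [L hL]; exists (K + L); apply: le_sum_le (sum_leD hK hL) => j; exact: ncD.
Qed.

Lemma summZ (c : R[i]) F : summ F -> summ (fun j => c * F j).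
Proof.
move=> [K hK]; exists (nc c * K); apply: le_sum_le (sum_leZ (nc_ge0 c) hK) => j.
by rewrite ncM.
Qed.

Lemma zsumD F G : summ F -> summ G -> zsum (fun j => F j + G j) = zsum F + zsum G.
Proof.
move=> sF sG; apply: zsumE; have := ccvgD (zsum_ccvg sF) (zsum_ccvg sG).
by under eq_fun do rewrite -psumD.
Qed.

Lemma zsumZ (c : R[i]) F : summ F -> zsum (fun j => c * F j) = c * zsum F.
Proof.
move=> sF; apply: zsumE; have := ccvgZ c (zsum_ccvg sF).
by under eq_fun do rewrite mulr_sumr.
Qed.

Lemma zsumN F : summ F -> zsum (fun j => - F j) = - zsum F.
Proof.
move=> sF; rewrite -mulN1r -zsumZ//.
by under eq_fun do rewrite -mulN1r.
Qed.

Lemma zsumB F G : summ F -> summ G -> zsum (fun j => F j - G j) = zsum F - zsum G.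
Proof.
move=> sF sG; rewrite zsumD ?zsumN//.
by have := summZ (-1) sG; under eq_fun do rewrite mulN1r.
Qed.

Lemma zsum_opp F : zsum (fun j => F (- j)) = zsum F.
Proof.
rewrite /zsum (_ : psum (fun j => F (- j)) = psum F)//; apply/funext => n.
rewrite /psum -(big_map -%R xpredT F); apply: perm_big; exact: perm_zrangeN.
Qed.

Lemma zsum_conj F : summ F -> zsum (fun j => (F j)^*%C) = ((zsum F)^*)%C.
Proof.
move=> sF; apply: zsumE; have := ccvg_conj (zsum_ccvg sF).
by under eq_fun do rewrite conjC_sum.
Qed.

Lemma zsum0 : zsum (fun=> 0) = 0.
Proof.
apply: zsumE; rewrite (_ : psum _ = fun=> 0); first exact: ccvg_cst.
by apply/funext => n; rewrite /psum big1.
Qed.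
End ComplexSums.

Section ComplexContinuity.
Variable R : realType.
Implicit Types (w v : R -> R[i]).

(** Componentwise, so that the theory of real functions applies directly. *)
Definition ccont w := continuous (fun t => Re (w t)) /\ continuous (fun t => Im (w t)).

Lemma ccontP w : ccont w <->
  (forall t, forall e : R, 0 < e -> \forall s \near t, nc (w s - w t) <= e).
Proof.
split=> [[cr ci] t e e0|h].
  have e2 : 0 < e / 2 by rewrite divr_gt0.
  move/cvgrPdist_le: (cr t) => /(_ _ e2) hr; move/cvgrPdist_le: (ci t) => /(_ _ e2) hi.
  near=> s; rewrite (le_trans (nc_le_ReIm _))// ReB ImB (splitr e) lerD//.
    by rewrite distrC; near: s.
  by rewrite distrC; near: s.
split=> t; apply/cvgrPdist_le => e e0; have := h t _ e0; apply: filterS => s hs.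
  by rewrite distrC -ReB (le_trans (Re_le_nc _)).
by rewrite distrC -ImB (le_trans (Im_le_nc _)).
Unshelve. all: by end_near. Qed.

Lemma ccont_cst (c : R[i]) : ccont (fun=> c).
Proof. by split=> t; exact: cvg_cst. Qed.

Lemma ccontD w v : ccont w -> ccont v -> ccont (fun t => w t + v t).
Proof.
move=> [rw iw] [rv iv]; split=> t.
  by under eq_fun do rewrite ReD; apply: cvgD; [exact: rw|exact: rv].
by under eq_fun do rewrite ImD; apply: cvgD; [exact: iw|exact: iv].
Qed.

Lemma ccontM w v : ccont w -> ccont v -> ccont (fun t => w t * v t).
Proof.
move=> [rw iw] [rv iv]; split=> t.
  under eq_fun do rewrite ReM.
  by apply: cvgB; apply: cvgM; by [exact: rw|exact: rv|exact: iw|exact: iv].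
under eq_fun do rewrite ImM.
by apply: cvgD; apply: cvgM; by [exact: rw|exact: rv|exact: iw|exact: iv].
Qed.

Lemma ccontZ (c : R[i]) w : ccont w -> ccont (fun t => c * w t).
Proof. by move=> cw; apply: ccontM => //; exact: ccont_cst. Qed.

Lemma ccontB w v : ccont w -> ccont v -> ccont (fun t => w t - v t).
Proof.
move=> cw cv; have := ccontD cw (ccontZ (-1) cv).
by under [X in ccont X -> _]eq_fun do rewrite mulN1r.
Qed.

Lemma ccont_conj w : ccont w -> ccont (fun t => ((w t)^*)%C).
Proof.
move=> /ccontP h; apply/ccontP => t e /(h t); apply: filterS => s.
by rewrite -conjN -conjD nc_conj.
Qed.

Lemma ccont_nc_sqr w : ccont w -> continuous (fun t => nc (w t) ^+ 2).
Proof.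
move=> [cr ci]; under eq_fun do rewrite nc_sqr.
by move=> t; apply: cvgD; apply: cvgM; by [exact: cr|exact: ci].
Qed.

Lemma ccont_sum (I : Type) (s : seq I) (F : I -> R -> R[i]) :
  (forall i, ccont (F i)) -> ccont (fun t => \sum_(i <- s) F i t).
Proof.
move=> h; elim: s => [|i s IH].
  by under eq_fun do rewrite big_nil; exact: ccont_cst.
by under eq_fun do rewrite big_cons; exact: ccontD.
Qed.

Lemma ccont_uniform_limit (W : nat -> R -> R[i]) w (tau : nat -> R) :
  (forall n, ccont (W n)) -> (forall n t, nc (w t - W n t) <= tau n) ->
  tau @ \oo --> (0 : R) -> ccont w.
Proof.
move=> cW h t0; apply/ccontP => t e e0.
have e3 : 0 < e / 3 by rewrite divr_gt0.
move/cvgrPdist_le: t0 => /(_ _ e3)[n _ /(_ n (leqnn n))/=]; rewrite sub0r normrN => hn.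
have htau s : nc (w s - W n s) <= e / 3.
  by rewrite (le_trans (h _ _))// (le_trans (ler_norm _)).
have /ccontP/(_ t _ e3) := cW n; apply: filterS => s hs.
have -> : w s - w t = (w s - W n s) + (W n s - W n t) - (w t - W n t) by ring.
rewrite (le_trans (ncB _ _))//.
have -> : e = e / 3 + e / 3 + e / 3 by field.
by rewrite lerD// (le_trans (ncD _ _))// lerD.
Qed.

Lemma ccont_zsum (F : R -> int -> R[i]) (a : int -> R) (K : R) :
  (forall j, 0 <= a j) -> sum_le a K -> (forall t j, nc (F t j) <= a j) ->
  (forall j, ccont (fun t => F t j)) -> ccont (fun t => zsum (F t)).
Proof.
move=> a0 ha hF cF; have [tau t0 htau] := zsum_tail a0 ha.
apply: (@ccont_uniform_limit (fun n t => psum (F t) n) _ tau) => // [n|n t].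
  by apply: ccont_sum => j; exact: cF.
by apply: htau => j; exact: hF.
Qed.
End ComplexContinuity.

(** * Integrals of complex functions *)

Section RealIntegrals.
Variable R : realType.
Implicit Types (D : set R) (f g : R -> R).

Lemma rintD D f g : meas D -> rint D f -> rint D g -> rint D (fun x => f x + g x).
Proof. by move=> mD hf hg; have := integrableD mD hf hg. Qed.

Lemma rintZ D (c : R) f : meas D -> rint D f -> rint D (fun x => c * f x).
Proof. by move=> mD hf; have := integrableZl mD c hf. Qed.

Lemma rintN D f : meas D -> rint D f -> rint D (fun x => - f x).
Proof. by move=> mD hf; have := rintZ (-1) mD hf; under eq_fun do rewrite mulN1r. Qed.

Lemma rintB D f g : meas D -> rint D f -> rint D g -> rint D (fun x => f x - g x).
Proof. by move=> mD hf hg; apply: rintD => //; exact: rintN. Qed.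

Lemma rint_mul_bounded D f g (K : R) : meas D -> rint D f ->
  mfun D g -> (forall x, D x -> `|g x| <= K) -> rint D (fun x => f x * g x).
Proof.
move=> mD hf mg gK; have := integrableMl mD hf mg; apply.
exists K; split; first exact: num_real.
by move=> M KM x Dx /=; rewrite (le_trans (gK _ Dx))// ltW.
Qed.

Lemma rint_le D f g : meas D -> mfun D f -> rint D g ->
  (forall x, D x -> `|f x| <= g x) -> rint D f.
Proof.
move=> mD mf hg fg; apply: (le_integrable mD _ _ hg).
  exact/measurable_EFinP.
by move=> x Dx /=; rewrite lee_fin (le_trans (fg _ Dx))// ler_norm.
Qed.

Lemma rint_measurable D f : rint D f -> mfun D f.
Proof. by move=> /measurable_int /measurable_EFinP. Qed.

Lemma rint_continuous (a b : R) f : continuous f -> rint `[a, b] f.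
Proof.
move=> cf; apply: continuous_compact_integrable; first exact: segment_compact.
exact: continuous_subspaceT.
Qed.

End RealIntegrals.

Section ComplexIntegrals.
Variable R : realType.
Implicit Types (D : set R) (g h : R -> R[i]).

Lemma cintegrableD D g h : meas D -> cintegrable D g -> cintegrable D h ->
  cintegrable D (fun x => g x + h x).
Proof.
move=> mD [gr gi] [hr hi]; split.
  rewrite (_ : (fun s => _) = (fun s => Re (g s) + Re (h s))); first exact: rintD.
  by apply/funext => s; rewrite ReD.
rewrite (_ : (fun s => _) = (fun s => Im (g s) + Im (h s))); first exact: rintD.
by apply/funext => s; rewrite ImD.
Qed.

Lemma cintegralD D g h : meas D -> cintegrable D g -> cintegrable D h ->
  cintegral D (fun x => g x + h x) = cintegral D g + cintegral D h.
Proof.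
move=> mD [gr gi] [hr hi]; apply: complex_eq; rewrite ?ReD ?ImD /=.
  by under eq_Rintegral do rewrite ReD; rewrite RintegralD.
by under eq_Rintegral do rewrite ImD; rewrite RintegralD.
Qed.

Lemma cintegrableZ D (c : R[i]) g : meas D -> cintegrable D g ->
  cintegrable D (fun x => c * g x).
Proof.
move=> mD [gr gi]; split.
  rewrite (_ : (fun s => _) = (fun s => Re c * Re (g s) - Im c * Im (g s))).
    by apply: rintB => //; apply: rintZ.
  by apply/funext => s; rewrite ReM.
rewrite (_ : (fun s => _) = (fun s => Re c * Im (g s) + Im c * Re (g s))).
  by apply: rintD => //; apply: rintZ.
by apply/funext => s; rewrite ImM.
Qed.

Lemma cintegralZ D (c : R[i]) g : meas D -> cintegrable D g ->
  cintegral D (fun x => c * g x) = c * cintegral D g.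
Proof.
move=> mD [gr gi]; apply: complex_eq; rewrite ?ReM ?ImM /=.
  under eq_Rintegral do rewrite ReM.
  by rewrite RintegralB ?RintegralZl//; apply: rintZ.
under eq_Rintegral do rewrite ImM.
by rewrite RintegralD ?RintegralZl//; apply: rintZ.
Qed.

Lemma cintegralB D g h : meas D -> cintegrable D g -> cintegrable D h ->
  cintegral D (fun x => g x - h x) = cintegral D g - cintegral D h.
Proof.
move=> mD cg ch.
have E : (fun x => -1 * h x) = (fun x => - h x) by apply/funext => x; rewrite mulN1r.
have cN := cintegrableZ (-1) mD ch; have iN := cintegralZ (-1) mD ch.
by rewrite E in cN iN; rewrite cintegralD// iN mulN1r.
Qed.

Lemma cintegrable0 D : meas D -> cintegrable D (fun=> 0 : R[i]).
Proof. by move=> mD; split; exact: integrable0. Qed.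

Lemma cintegral0 D : cintegral D (fun=> 0 : R[i]) = 0.
Proof. by apply: complex_eq => /=; rewrite /Rintegral integral0. Qed.

Lemma cintegrable_sum D (I : Type) (s : seq I) (g : I -> R -> R[i]) : meas D ->
  (forall i, cintegrable D (g i)) -> cintegrable D (fun x => \sum_(i <- s) g i x).
Proof.
move=> mD h; elim: s => [|i s IH].
  by under eq_fun do rewrite big_nil; exact: cintegrable0.
by under eq_fun do rewrite big_cons; exact: cintegrableD.
Qed.

Lemma cintegral_sum D (I : Type) (s : seq I) (g : I -> R -> R[i]) : meas D ->
  (forall i, cintegrable D (g i)) ->
  cintegral D (fun x => \sum_(i <- s) g i x) = \sum_(i <- s) cintegral D (g i).
Proof.
move=> mD h; elim: s => [|i s IH].
  by under eq_fun do rewrite big_nil; rewrite cintegral0 big_nil.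
under eq_fun do rewrite big_cons.
by rewrite cintegralD ?IH ?big_cons//; exact: cintegrable_sum.
Qed.

(** The factor 2 comes from bounding the real and the imaginary part
    separately. *)
Lemma cintegral_le D g (h : R -> R) : meas D -> cintegrable D g -> rint D h ->
  (forall x, D x -> nc (g x) <= h x) ->
  nc (cintegral D g) <= 2 * \int[Leb R]_(x in D) h x.
Proof.
move=> mD [gr gi] hh gh.
have bound (f : R -> R) : rint D f -> (forall x, D x -> `|f x| <= h x) ->
    `|\int[Leb R]_(x in D) f x| <= \int[Leb R]_(x in D) h x.
  move=> hf fh; apply: (le_trans (le_normr_Rintegral mD hf)).
  apply: le_Rintegral => //.
  by apply: (rint_le mD _ hh) => [|x Dx]; rewrite ?normr_id ?fh//;
    apply: measurableT_comp => //; exact: rint_measurable.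
rewrite (le_trans (nc_le_ReIm _))// mulr2n mulrDl mul1r lerD//=; apply: bound => // x Dx.
  by rewrite (le_trans (Re_le_nc _))// gh.
by rewrite (le_trans (Im_le_nc _))// gh.
Qed.

Lemma eq_cintegral D g h : (forall x, D x -> g x = h x) ->
  cintegral D g = cintegral D h.
Proof.
move=> gh; apply: complex_eq => /=; apply: eq_Rintegral => x /set_mem Dx;
  by rewrite gh.
Qed.

Lemma ccont_cintegrable (a b : R) g : ccont g -> cintegrable `[a, b] g.
Proof. by move=> [cr ci]; split; exact: rint_continuous. Qed.

End ComplexIntegrals.

(** * Derivatives and characters *)

Section FTC2.
Variable R : realType.

Lemma Rintegral_derivative (f F : R -> R) (a b : R) : a <= b -> continuous f ->
  (forall x, a <= x <= b -> is_derive x 1 F (f x)) ->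
  \int[Leb R]_(x in `[a, b]) f x = F b - F a.
Proof.
move=> ab cf dF; move: (ab); rewrite le_eqVlt => /predU1P[<-|ltab].
  by rewrite set_itv1 Rintegral_set1 subrr.
have cF x : a <= x <= b -> F @ x --> F x.
  move=> /dF [dx _]; apply: differentiable_continuous; exact/derivable1_diffP.
rewrite /Rintegral (continuous_FTC2 ltab (F := F))//.
- exact: continuous_subspaceT.
- split=> [x /[!in_itv]/= /andP[ax xb]||].
  + by have [] := dF x; rewrite ?(ltW ax) ?(ltW xb).
  + by apply: cvg_at_right_filter; apply: cF; rewrite lexx.
  + by apply: cvg_at_left_filter; apply: cF; rewrite lexx andbT.
- move=> x /[!in_itv]/= /andP[ax xb].
  by rewrite derive1E; have [|_ ->] := dF x; rewrite ?(ltW ax) ?(ltW xb).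
Qed.
End FTC2.

Section PointwiseDerivatives.
Variable R : realType.
Implicit Types (f g : R -> R) (x a b : R).

(** The rules of differentiation on explicit abstractions, in which form they
    compose by unification. *)
Lemma dv_cst x a : is_derive x (1 : R) (fun _ : R => a) (0 : R).
Proof. exact: is_derive_cst. Qed.

Lemma dv_add f g x a b : is_derive x (1 : R) f a -> is_derive x (1 : R) g b ->
  is_derive x (1 : R) (fun t => f t + g t) (a + b).
Proof. exact: is_deriveD. Qed.

Lemma dv_scale f x a (k : R) : is_derive x (1 : R) f a ->
  is_derive x (1 : R) (fun t => k * f t) (k * a).
Proof. exact: is_deriveZ. Qed.

Lemma dv_opp f x a : is_derive x (1 : R) f a -> is_derive x (1 : R) (fun t => - f t) (- a).
Proof. exact: is_deriveN. Qed.

Lemma dv_mul f g x a b : is_derive x (1 : R) f a -> is_derive x (1 : R) g b ->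
  is_derive x (1 : R) (fun t => f t * g t) (f x * b + g x * a).
Proof. by move=> df dg; have := is_deriveM df dg. Qed.

Lemma dv_linear x (k : R) : is_derive x (1 : R) (fun t => k * t) k.
Proof.
have h := is_deriveZ k (is_derive_id x (1 : R)).
by rewrite /GRing.scale /= mulr1 in h; exact: h.
Qed.

Lemma dv_comp f g x a b : is_derive (g x) (1 : R) f a -> is_derive x (1 : R) g b ->
  is_derive x (1 : R) (fun t => f (g t)) (a * b).
Proof. by move=> df dg; have := is_derive1_comp df dg. Qed.

Lemma dv_eq f x a b : is_derive x (1 : R) f a -> a = b -> is_derive x (1 : R) f b.
Proof. by move=> h <-. Qed.
End PointwiseDerivatives.

Section Exponentials.
Variable R : realType.

Definition expi (k : int) (x : R) : R[i] := Complex (cos (k%:~R * x)) (sin (k%:~R * x)).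

Lemma expiD j k x : expi (j + k) x = expi j x * expi k x.
Proof.
apply: complex_eq; rewrite /expi /=.
  by rewrite intrD mulrDl cosD.
by rewrite intrD mulrDl sinD addrC.
Qed.

Lemma expi0 x : expi 0 x = 1.
Proof. by rewrite /expi mul0r cos0 sin0. Qed.

Lemma expiN k x : expi (- k) x = ((expi k x)^*)%C.
Proof. by rewrite /expi /= mulrNz mulNr cosN sinN. Qed.

Lemma nc_expi k x : nc (expi k x) = 1.
Proof. by rewrite /expi /= cos2Dsin2 sqrtr1. Qed.

Lemma ccont_expi k : ccont (expi k).
Proof.
have cm : continuous (fun x : R => k%:~R * x).
  by move=> x; apply: cvgM; [exact: cvg_cst|exact: cvg_id].
split=> x /=.
  exact: (continuous_comp (cm x) (@continuous_cos R _)).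
exact: (continuous_comp (cm x) (@continuous_sin R _)).
Qed.

Lemma sin_int_pi (k : int) : sin (k%:~R * pi) = 0 :> R.
Proof.
have h (n : nat) : sin (n%:R * pi) = 0 :> R.
  elim: n => [|n IH]; first by rewrite mul0r sin0.
  by rewrite -natr1 mulrDl mul1r sinDpi IH oppr0.
case: k => n; first by rewrite -pmulrn h.
by rewrite NegzE mulrNz mulNr sinN -pmulrn h oppr0.
Qed.

Lemma periodic_expi k x : expi k (x + pi *+ 2) = expi k x.
Proof.
have h (n : nat) (y : R) : cos (y + n%:R * (pi *+ 2)) = cos y /\ sin (y + n%:R * (pi *+ 2)) = sin y.
  elim: n y => [|n IH] y; first by rewrite mul0r addr0.
  by rewrite -natr1 mulrDl mul1r addrA cosD2pi sinD2pi.
suff : expi `|k|%:Z (x + pi *+ 2) = expi `|k|%:Z x.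
  by case: (intP k) => // n; rewrite abszN !absz_nat !expiN => ->.
have [c s] := h `|k|%N (`|k|%N%:R * x).
by apply: complex_eq; rewrite /expi /= -pmulrn mulrDr.
Qed.

Lemma cintegral_expi k :
  cintegral `[- pi, pi] (expi k) = if k == 0 then ((pi *+ 2)%:C)%C else 0.
Proof.
have pi0 : - pi <= pi :> R by rewrite (@le_trans _ _ 0) ?oppr_le0 ?pi_ge0.
case: eqP => [->|/eqP k0].
  have -> : expi 0 = fun=> 1 by apply/funext => x; exact: expi0.
  have lenpi : fine (Leb R `[- pi, pi]) = pi *+ 2.
    rewrite lebesgue_measure_itv/= lte_fin ifT/=; first by rewrite opprK mulr2n.
    by rewrite -subr_gt0 opprK addr_gt0 ?pi_gt0.
  apply: complex_eq => /=.
    by rewrite Rintegral_cst//= lenpi mul1r.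
  by rewrite Rintegral_cst//= mul0r.
have kR : k%:~R != 0 :> R by rewrite intr_eq0.
have [cc cs] := ccont_expi k.
have dS x : is_derive x (1 : R) (fun x => k%:~R^-1 * sin (k%:~R * x)) (cos (k%:~R * x)).
  apply: (@dv_eq _ _ _ (k%:~R^-1 * (cos (k%:~R * x) * k%:~R))); last by field.
  by apply: dv_scale; apply: (dv_comp (is_derive_sin _) (dv_linear _ _)).
have dC x : is_derive x (1 : R) (fun x => - k%:~R^-1 * cos (k%:~R * x)) (sin (k%:~R * x)).
  apply: (@dv_eq _ _ _ (- k%:~R^-1 * (- sin (k%:~R * x) * k%:~R))); last by field.
  by apply: dv_scale; apply: (dv_comp (is_derive_cos _) (dv_linear _ _)).
apply: complex_eq => /=.
  rewrite (Rintegral_derivative pi0 cc (fun x _ => dS x)).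
  by rewrite mulrN sinN sin_int_pi oppr0 subrr.
rewrite (Rintegral_derivative pi0 cs (fun x _ => dC x)).
by rewrite (mulrN k%:~R) cosN subrr.
Qed.
End Exponentials.

(** * Fourier coefficients and Fourier series *)

Section FourierCoefficients.
Variable R : realType.
Implicit Types (u v : R -> R) (c : int -> R[i]) (k : int).
Local Notation I := (`[- (pi : R), pi]%classic).

Lemma L2T_rint u : L2T u -> rint I u.
Proof.
move=> [_ mu iu].
have mI : meas I by exact: measurable_itv.
have h : rint I (fun x => 1 + u x ^+ 2).
  by apply: rintD => //; apply: rint_continuous; exact: cst_continuous.
apply: (rint_le mI _ h) => [|x _]; first exact: measurable_funS mu.
rewrite -real_normK ?num_real//; have := sqr_ge0 (`|u x| - 1); rewrite sqrrB1; set a := `|u x|.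
have : 0 <= a by exact: normr_ge0.
nra.
Qed.

Lemma rint_mul_L2T u v : L2T u -> L2T v -> rint I (fun x => u x * v x).
Proof.
move=> [_ mu iu] [_ mv iv].
have mI : meas I by exact: measurable_itv.
have h : rint I (fun x => u x ^+ 2 + v x ^+ 2) by apply: rintD.
apply: (rint_le mI _ h) => [|x _].
  by apply: measurable_funM; [exact: measurable_funS mu|exact: measurable_funS mv].
rewrite normrM -[u x ^+ 2]real_normK ?num_real// -[v x ^+ 2]real_normK ?num_real//.
have := sqr_ge0 (`|u x| - `|v x|); set a := `|u x|; set b := `|v x|.
have : 0 <= a by exact: normr_ge0.
have : 0 <= b by exact: normr_ge0.
nra.
Qed.

Lemma cintegrable_mul u (w : R -> R[i]) (K : R) : rint I u -> ccont w ->
  (forall x, nc (w x) <= K) -> cintegrable I (fun x => (u x)%:C%C * w x).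
Proof.
move=> iu [cr ci] wK; have mI : meas I by exact: measurable_itv.
split.
  rewrite (_ : (fun s => _) = (fun s => u s * Re (w s))); last first.
    by apply/funext => s; rewrite ReM/= mul0r subr0.
  apply: (@rint_mul_bounded _ _ _ _ K) => // [|x _]; last by rewrite (le_trans (Re_le_nc _)).
  by apply: measurable_funTS; exact: continuous_measurable_fun.
rewrite (_ : (fun s => _) = (fun s => u s * Im (w s))); last first.
  by apply/funext => s; rewrite ImM/= mul0r addr0.
apply: (@rint_mul_bounded _ _ _ _ K) => // [|x _]; last by rewrite (le_trans (Im_le_nc _)).
by apply: measurable_funTS; exact: continuous_measurable_fun.
Qed.

Lemma cintegrable_mul_expi u k : rint I u -> cintegrable I (fun x => (u x)%:C%C * expi k x).
Proof.
move=> iu; apply: (@cintegrable_mul _ _ 1 iu (ccont_expi R k)) => x.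
by rewrite nc_expi.
Qed.

Lemma fourierE u k : fourier u k =
  (((pi *+ 2)^-1)%:C)%C * cintegral I (fun x => (u x)%:C%C * expi (- k) x).
Proof.
congr (_ * _); apply: eq_cintegral => x _; congr (_ * _).
by rewrite expiN.
Qed.

Lemma fourierB u v k : rint I u -> rint I v ->
  fourier (u \- v) k = fourier u k - fourier v k.
Proof.
move=> iu iv; rewrite !fourierE -mulrBr -cintegralB//; try exact: cintegrable_mul_expi.
by congr (_ * _); apply: eq_cintegral => x _; rewrite -mulrBl -rmorphB.
Qed.

Lemma fourier_sym u k : rint I u -> fourier u (- k) = ((fourier u k)^*)%C.
Proof.
move=> iu; have mI : meas I by exact: measurable_itv.
have [ir ii] := cintegrable_mul_expi k iu.
rewrite !fourierE rmorphM/= opprK oppr0; congr (_ * _).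
apply: complex_eq => /=.
  by apply: eq_Rintegral => x _; rewrite mulrNz mulNr cosN !mul0r.
rewrite -mulN1r -RintegralZl//.
  by apply: eq_Rintegral => x _; rewrite mulN1r mulrNz mulNr sinN !mul0r !addr0 mulrN opprK.
have [_] := cintegrable_mul_expi (- k) iu.
by [].
Qed.

Lemma fourier_le u k (h : R -> R) : rint I u -> rint I h -> (forall x, I x -> `|u x| <= h x) ->
  nc (fourier u k) <= pi^-1 * \int[Leb R]_(x in I) h x.
Proof.
move=> iu ih uh; have mI : meas I by exact: measurable_itv.
have p0 : 0 <= (pi *+ 2)^-1 :> R by rewrite invr_ge0 mulrn_wge0 ?pi_ge0.
rewrite fourierE ncM nc_real (ger0_norm p0).
apply: (@le_trans _ _ ((pi *+ 2)^-1 * (2 * \int[Leb R]_(x in I) h x))).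
  apply: ler_wpM2l => //; apply: cintegral_le => //; first exact: cintegrable_mul_expi.
  by move=> x Ix; rewrite ncM nc_real nc_expi mulr1 uh.
by rewrite mulrA -[pi *+ 2]mulr_natr invfM mulfVK// pnatr_eq0.
Qed.

(** The symmetry of the Fourier coefficients of real functions. *)
Definition conj_sym c := forall k, c (- k) = ((c k)^*)%C.

Definition tpoly c n (x : R) := psum (fun k => c k * expi k x) n.
Definition trig c n (x : R) := Re (tpoly c n x).
(** For a conjugate symmetric family the series is real, and taking the real
    part only changes the codomain. *)
Definition fser c (x : R) := Re (zsum (fun k => c k * expi k x)).

Lemma real_of_conj (z : R[i]) : (z^*)%C = z -> (Re z)%:C%C = z.
Proof.
case: z => a b [] /eqP; rewrite eq_sym -subr_eq0 opprK -mulr2n mulrn_eq0/= => /eqP ->.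
by [].
Qed.

Lemma trigE c n x : conj_sym c -> (trig c n x)%:C%C = tpoly c n x.
Proof.
move=> sc; apply: real_of_conj; rewrite /tpoly /psum conjC_sum.
rewrite -(perm_big _ (perm_zrangeN n))/= big_map.
by apply: eq_bigr => k _; rewrite sc expiN -conjM conjcK.
Qed.

Lemma ccont_fser c : summ c -> ccont (fun x => zsum (fun k => c k * expi k x)).
Proof.
move=> [K h]; apply: (ccont_zsum (fun j => nc_ge0 (c j)) h) => [t j|j].
  by rewrite ncM nc_expi mulr1.
by apply: ccontZ; exact: ccont_expi.
Qed.

Lemma continuous_fser c : summ c -> continuous (fser c).
Proof. by move=> /ccont_fser[]. Qed.

Lemma continuous_trig c n : continuous (trig c n).
Proof.
have [] : ccont (tpoly c n); last by [].
by apply: ccont_sum => j; apply: ccontZ; exact: ccont_expi.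
Qed.

Lemma fser_bounded c : summ c -> exists K : R, forall x, `|fser c x| <= K.
Proof.
move=> [K h]; exists K => x; rewrite (le_trans (Re_le_nc _))//; apply: zsum_le.
by apply: le_sum_le h => k; rewrite ncM nc_expi mulr1.
Qed.

Lemma periodic_fser c : periodic (fser c) (pi *+ 2).
Proof.
by move=> x; rewrite /fser; congr (Re (zsum _)); apply/funext => k; rewrite periodic_expi.
Qed.

Lemma periodic_trig c n : periodic (trig c n) (pi *+ 2).
Proof.
by move=> x; rewrite /trig /tpoly /psum; congr Re; apply: eq_bigr => k _; rewrite periodic_expi.
Qed.

Lemma L2T_continuous u : periodic u (pi *+ 2) -> continuous u -> L2T u.
Proof.
move=> pu cu; split => //; first exact: continuous_measurable_fun.
apply: rint_continuous => x; apply: (@continuous_comp _ _ _ u (fun y => y ^+ 2)); first exact: cu.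
exact: exprn_continuous.
Qed.

Lemma L2T_fser c : summ c -> L2T (fser c).
Proof. by move=> sc; apply: L2T_continuous; [exact: periodic_fser|exact: continuous_fser]. Qed.

Lemma L2T_trig c n : L2T (trig c n).
Proof. by apply: L2T_continuous; [exact: periodic_trig|exact: continuous_trig]. Qed.

Lemma fourier_trig_mul c n v k : conj_sym c -> rint I v ->
  fourier (fun x => trig c n x * v x) k = psum (fun j => c j * fourier v (k - j)) n.
Proof.
move=> sc iv; have mI : meas I by exact: measurable_itv.
rewrite fourierE.
have -> : cintegral I (fun x => (trig c n x * v x)%:C%C * expi (- k) x) =
   cintegral I (fun x => \sum_(j <- zrange n) c j * ((v x)%:C%C * expi (- (k - j)) x)).
  apply: eq_cintegral => x _; rewrite rmorphM/= trigE// /tpoly /psum !mulr_suml.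
  apply: eq_bigr => j _.
  have -> : - (k - j) = j + (- k) by ring.
  by rewrite expiD; ring.
rewrite cintegral_sum//; last first.
  by move=> j; apply: cintegrableZ => //; exact: cintegrable_mul_expi.
rewrite mulr_sumr; apply: eq_bigr => j _.
rewrite cintegralZ//; last exact: cintegrable_mul_expi.
by rewrite fourierE; ring.
Qed.

Lemma fser_trig_dist c (tau : nat -> R) : 
  (forall F, (forall j, nc (F j) <= nc (c j)) -> forall n, nc (zsum F - psum F n) <= tau n) ->
  forall n x, `|fser c x - trig c n x| <= tau n.
Proof.
move=> h n x; rewrite /fser /trig -ReB (le_trans (Re_le_nc _))//; apply: h => j.
by rewrite ncM nc_expi mulr1.
Qed.

Lemma fourier_bounded v : rint I v -> exists2 K : R, 0 <= K & forall k, nc (fourier v k) <= K.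
Proof.
move=> iv; have mI : meas I by exact: measurable_itv.
have iv' : rint I (fun x => `|v x|) by have := integrable_abse iv.
exists (pi^-1 * \int[Leb R]_(x in I) `|v x|).
  by rewrite mulr_ge0 ?invr_ge0 ?pi_ge0//; apply: Rintegral_ge0.
by move=> k; apply: fourier_le.
Qed.

Lemma summ_conv c v k : summ c -> rint I v -> summ (fun j => c j * fourier v (k - j)).
Proof.
move=> [K hK] /fourier_bounded[L L0 hL].
apply: (summ_le (sum_leZ L0 hK)) => j; rewrite ncM mulrC.
by rewrite ler_wpM2r ?nc_ge0.
Qed.

(** The convolution theorem when one factor has absolutely summable
    coefficients: the partial sums converge uniformly, so that the integral
    goes through the sum. *)
Lemma fourier_fser_mul c v k : conj_sym c -> summ c -> rint I v ->
  fourier (fun x => fser c x * v x) k = zsum (fun j => c j * fourier v (k - j)).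
Proof.
move=> sc hc iv; have mI : meas I by exact: measurable_itv.
have [K hK] := hc; have [tau t0 htau] := zsum_tail (fun j => nc_ge0 (c j)) hK.
have iv' : rint I (fun x => `|v x|) by have := integrable_abse iv.
apply: (@ccvg_unique _ (fun n => fourier (fun x => trig c n x * v x) k)); last first.
  have := zsum_ccvg (summ_conv k hc iv).
  by under [X in _ -> ccvg X _]eq_fun do rewrite fourier_trig_mul//.
have imul (f : R -> R) : continuous f -> (exists K, forall x, `|f x| <= K) -> rint I (fun x => f x * v x).
  move=> cf [L fL].
  rewrite (_ : (fun x => f x * v x) = (fun x => v x * f x)); last by apply/funext => x; rewrite mulrC.
  apply: (@rint_mul_bounded _ _ _ _ L) => //.
  by apply: measurable_funTS; exact: continuous_measurable_fun.
have ifs := imul _ (continuous_fser hc) (fser_bounded hc).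
have itr n : rint I (fun x => trig c n x * v x).
  apply: imul; first exact: continuous_trig.
  have [L fL] := fser_bounded hc; exists (L + tau n) => x.
  have := fser_trig_dist htau n x; rewrite distrC => h.
  have -> : trig c n x = fser c x + (trig c n x - fser c x) by ring.
  by rewrite (le_trans (ler_normD _ _))// lerD.
apply: (@ccvg_le _ _ _ (fun n => pi^-1 * (tau n * \int[Leb R]_(x in I) `|v x|))); last first.
  rewrite -[X in _ --> X](mulr0 (pi^-1 : R)); apply: cvgM; first exact: cvg_cst.
  rewrite -[X in _ --> X](mul0r (\int[Leb R]_(x in I) `|v x|)); apply: cvgM => //.
  exact: cvg_cst.
move=> n; rewrite -RintegralZl// -fourierB//.
apply: fourier_le => [||x _]; first exact: rintB.
  exact: rintZ.
by rewrite /= -mulrBl normrM ler_wpM2r// distrC; exact: fser_trig_dist.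
Qed.

Lemma rint1 : rint I (fun=> 1 : R).
Proof. by apply: rint_continuous; exact: cst_continuous. Qed.

Lemma fourier1 k : fourier (fun=> 1 : R) k = (k == 0)%:R.
Proof.
rewrite fourierE.
have -> : cintegral I (fun x => (1 : R)%:C%C * expi (- k) x) = cintegral I (expi (- k)).
  by apply: eq_cintegral => x _; rewrite mul1r.
rewrite cintegral_expi oppr_eq0; case: eqP => _; last by rewrite mulr0.
by rewrite -rmorphM/= mulVf// mulrn_eq0/= gt_eqF// pi_gt0.
Qed.

Lemma psum_delta (F : int -> R[i]) k n : (`|k| <= n)%N ->
  psum (fun j => F j * (k - j == 0)%:R) n = F k.
Proof.
move=> kn; rewrite /psum (bigD1_seq k) ?uniq_zrange ?mem_zrange//= subrr eqxx mulr1.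
rewrite big1 ?addr0// => j jk; case: eqP => [/eqP|]; last by rewrite mulr0.
by rewrite subr_eq0 eq_sym (negbTE jk).
Qed.

Lemma fourier_trig c n k : conj_sym c ->
  fourier (trig c n) k = if (`|k| <= n)%N then c k else 0.
Proof.
move=> sc.
rewrite (_ : trig c n = fun x => trig c n x * 1); last by apply/funext => x; rewrite mulr1.
rewrite fourier_trig_mul//; last exact: rint1.
have -> : psum (fun j => c j * fourier (fun=> 1) (k - j)) n = psum (fun j => c j * (k - j == 0)%:R) n.
  by apply: eq_bigr => j _; rewrite fourier1.
case: ifP => [/psum_delta -> //|kn]; rewrite /psum.
rewrite big_seq big1// => j; rewrite mem_zrange => jn; case: eqP => [|]; rewrite ?mulr0//.
by move=> /eqP; rewrite subr_eq0 => /eqP kj; rewrite kj jn in kn.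
Qed.

Lemma fourier_fser c k : conj_sym c -> summ c -> fourier (fser c) k = c k.
Proof.
move=> sc hc.
rewrite (_ : fser c = fun x => fser c x * 1); last by apply/funext => x; rewrite mulr1.
rewrite fourier_fser_mul//; last exact: rint1.
apply: zsumE; rewrite /ccvg -(cvg_shiftn `|k|%N).
rewrite (_ : (fun n => _) = fun=> 0); first exact: cvg_cst.
apply/funext => n.
have -> : psum (fun j => c j * fourier (fun=> 1) (k - j)) (n + `|k|)%N = psum (fun j => c j * (k - j == 0)%:R) (n + `|k|)%N.
  by apply: eq_bigr => j _; rewrite fourier1.
by rewrite psum_delta ?subrr ?nc0// leq_addl.
Qed.
End FourierCoefficients.

(** * Uniqueness of Fourier coefficients *)

Definition shiftR (R : realType) (c : R) (x : measurableTypeR R) : measurableTypeR R := x + c.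

Lemma measurable_shiftR (R : realType) (c : R) : measurable_fun setT (shiftR c).
Proof. exact: measurable_funD. Qed.

HB.instance Definition _ (R : realType) (c : R) :=
  isMeasurableFun.Build _ _ (measurableTypeR R) (measurableTypeR R) (shiftR c) (measurable_shiftR c).

Section Translation.
Variable R : realType.

Lemma lebesgue_measure_shift (c : R) (A : set R) : meas A ->
  pushforward (Leb R) (shiftR c) A = Leb R A.
Proof.
move=> mA.
apply/esym/lebesgue_measure_unique => //= _ [[a b]] _ <-.
rewrite /pushforward /shiftR /=.
have -> : (fun x : R => x + c) @^-1` `]a, b] = `]a - c, b - c]%classic.
  by apply/seteqP; split => x /=; rewrite !in_itv/= ltrBlDr lerBrDr.
rewrite !lebesgue_measure_itv/= !lte_fin ltrD2r.
by case: ifP => // _; rewrite -!EFinD; congr EFin; ring.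
Qed.

Lemma negligible_shift (c : R) (N : set R) : (Leb R).-negligible N ->
  (Leb R).-negligible [set x | N (x + c)].
Proof.
move=> [A [mA A0 NA]]; exists [set x | A (x + c)]; split; last by move=> x /NA.
  rewrite -[X in measurable X]setTI.
  exact: measurable_shiftR.
by have := lebesgue_measure_shift c mA; rewrite A0.
Qed.

(** The translates of one period cover the line up to countably many
    endpoints. *)
Lemma periodic_ae (u : R -> R) (P : set R) : periodic u (pi *+ 2) ->
  {ae Leb R, forall x, - pi < x < pi -> P (u x)} -> {ae Leb R, forall x, P (u x)}.
Proof.
move=> pu hN.
have pu' (n : nat) y : u (y + n%:R * (pi *+ 2)) = u y.
  elim: n y => [|n IH] y; first by rewrite mul0r addr0.
  by rewrite -natr1 mulrDl mul1r addrA pu.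
have puz (k : int) y : u (y - k%:~R * (pi *+ 2)) = u y.
  case: (intP k) => [|n|n]; first by rewrite mul0r subr0.
    by rewrite -[in RHS](subrK (n.+1%:~R * (pi *+ 2)) y) -[in RHS]pmulrn pu'.
  by rewrite mulrNz mulNr opprK -pmulrn pu'.
pose N := [set x : R | ~ (- pi < x < pi -> P (u x))].
have p2 : 0 < pi *+ 2 :> R by rewrite mulrn_wgt0 ?pi_gt0.
pose M (k : int) := [set x : R | N (x - k%:~R * (pi *+ 2))] `|` [set k%:~R * (pi *+ 2) - pi].
have Mk k : (Leb R).-negligible (M k).
  apply: negligibleU; first exact: negligible_shift.
  exists [set k%:~R * (pi *+ 2) - pi]; split => //; exact: lebesgue_measure_set1.
have key (x : R) : ~ P (u x) -> exists k, M k x.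
  move=> Pux; pose k := Num.floor ((x + pi) / (pi *+ 2)).
  have := floor_itv ((x + pi) / (pi *+ 2)); rewrite -/k => /andP[].
  rewrite ler_pdivlMr// ltr_pdivrMr// intrD mulrDl mul1r => h1 h2.
  exists k; move: h1; rewrite le_eqVlt => /predU1P[h1|h1]; [right|left].
    by rewrite /= h1 addrK.
  rewrite /N /= puz => h; apply: Pux; apply: h; apply/andP; split; first by lra.
  by move: h2; rewrite mulr2n; lra.
have : (Leb R).-negligible (\bigcup_n (M n%:Z `|` M (- n%:Z))).
  by apply: negligible_bigcup => n; apply: negligibleU.
apply: negligibleS => x /= /key[k Mkx]; exists `|k|%N => //=.
by case: (intP k) Mkx => [|n|n] h; [left|left|right].
Qed.
End Translation.

Section Annihilator.
Variables (R : realType) (D : R -> R).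
Local Notation I := (`[- (pi : R), pi]%classic).
Hypothesis iD : rint I D.

(** Bounded continuous functions p such that D p has no Fourier mode. *)
Definition ann (p : R -> R) := [/\ continuous p, exists K, forall x, `|p x| <= K &
  forall k, cintegral I (fun x => (D x * p x)%:C%C * expi k x) = 0].

Let mI : meas I. Proof. exact: measurable_itv. Qed.

Lemma rint_ann p : ann p -> rint I (fun x => D x * p x).
Proof.
move=> [cp [K pK] _]; apply: (@rint_mul_bounded _ _ _ _ K) => //.
by apply: measurable_funTS; exact: continuous_measurable_fun.
Qed.

Lemma annB p q : ann p -> ann q -> ann (fun x => p x - q x).
Proof.
move=> ap aq; have [cp [K pK] Hp] := ap; have [cq [L qL] Hq] := aq; split.
- by move=> x; apply: cvgB; [exact: cp|exact: cq].
- by exists (K + L) => x; rewrite (le_trans (ler_normB _ _))// lerD.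
- move=> k; rewrite -[RHS](subr0 0) -{1}(Hp k) -(Hq k) -cintegralB//; last 2 first.
    exact: (cintegrable_mul_expi _ (rint_ann ap)).
    exact: (cintegrable_mul_expi _ (rint_ann aq)).
  by apply: eq_cintegral => x _; rewrite mulrBr rmorphB mulrBl.
Qed.

Variables (q : R -> R) (c0 c1 c2 : R[i]).
Hypothesis cq : continuous q.
Hypothesis q01 : forall x, 0 <= q x <= 1.
Hypothesis qE : forall x, (q x)%:C%C = c0 + c1 * expi 1 x + c2 * expi (-1) x.

(** Multiplication by q moves frequencies by at most one, so that the modes of
    D p q are combinations of modes of D p. *)
Lemma ann_mul p : ann p -> ann (fun x => p x * q x).
Proof.
move=> ap; have [cp [K pK] Hp] := ap; split.
- by move=> x; apply: cvgM; [exact: cp|exact: cq].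
- exists K => x; rewrite normrM; have /andP[q0 q1] := q01 x.
  by rewrite (ger0_norm q0) (le_trans _ (pK x))// ler_piMr.
- move=> k; have ie := fun j => cintegrable_mul_expi j (rint_ann ap).
  rewrite (_ : cintegral _ _ = cintegral I (fun x =>
      c0 * ((D x * p x)%:C%C * expi k x) + (c1 * ((D x * p x)%:C%C * expi (k + 1) x)
      + c2 * ((D x * p x)%:C%C * expi (k - 1) x)))); last first.
    by apply: eq_cintegral => x _; rewrite mulrA rmorphM/= qE !expiD; ring.
  rewrite !cintegralD ?cintegralZ ?Hp ?mulr0 ?addr0//;
    do ?[apply: cintegrableD => //]; exact: cintegrableZ.
Qed.

Lemma ann_mulX p n : ann p -> ann (fun x => p x * q x ^+ n).
Proof.
move=> ap; elim: n => [|n IH].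
  by under eq_fun do rewrite expr0 mulr1.
by under eq_fun do rewrite exprSr mulrA; exact: ann_mul.
Qed.

Lemma ann_bump n N : ann (fun=> 1) -> ann (fun x => (1 - q x ^+ n) ^+ N).
Proof.
move=> a1; elim: N => [|N IH]; first by under eq_fun do rewrite expr0.
under eq_fun do rewrite exprSr mulrBr mulr1.
by apply: annB => //; exact: ann_mulX.
Qed.
End Annihilator.

Section Bump.
Variable R : realType.

Lemma bernoulli_ge (x : R) n : -1 <= x -> 1 + n%:R * x <= (1 + x) ^+ n.
Proof.
move=> x1; elim: n => [|n IH]; first by rewrite mul0r addr0 expr0.
rewrite exprS; apply: (@le_trans _ _ ((1 + x) * (1 + n%:R * x))); last first.
  by rewrite ler_wpM2l//; lra.
rewrite -natr1; have := sqr_ge0 x; have : 0 <= n%:R :> R by [].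
by set m := n%:R; nra.
Qed.

(** A polynomial approximation of the indicator function of y < 1/2: the
    exponent 2 ^ n puts the threshold where 2 ^ n * y ^ n goes from 0 to
    infinity. *)
Definition bump n (y : R) := (1 - y ^+ n) ^+ (2 ^ n).

Lemma bump_itv n y : 0 <= y <= 1 -> 0 <= bump n y <= 1.
Proof.
move=> /andP[y0 y1].
have h : 0 <= y ^+ n <= 1 by rewrite exprn_ge0//= exprn_ile1.
have h' : 0 <= 1 - y ^+ n <= 1 by lra.
by move/andP: h' => [a b]; rewrite exprn_ge0//= exprn_ile1.
Qed.

Lemma bump_cvg1 y : 0 <= y < 2^-1 -> bump n y @[n --> \oo] --> (1 : R).
Proof.
move=> /andP[y0 y2].
apply: (@squeeze_cvgr _ _ _ _ (fun n => 1 - (2 * y) ^+ n) (fun=> 1)); last exact: cvg_cst.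
  apply: nearW => n; apply/andP; split; last first.
    by have /andP[] := @bump_itv n y ltac:(lra).
  have hb : -1 <= - y ^+ n by rewrite lerN2 exprn_ile1//; lra.
  have := bernoulli_ge (2 ^ n) hb; apply: le_trans.
  by rewrite natrX exprMn mulrN.
rewrite -[X in _ --> X]subr0; apply: cvgB; first exact: cvg_cst.
by apply: cvg_expr; rewrite ger0_norm; lra.
Qed.

Lemma bump_cvg0 y : 2^-1 < y <= 1 -> bump n y @[n --> \oo] --> (0 : R).
Proof.
move=> /andP[y2 y1].
apply: (@squeeze0 _ _ (fun n => ((2 * y)^-1) ^+ n)); last first.
  by apply: cvg_expr; rewrite ger0_norm ?invr_ge0 ?invf_lt1; lra.
move=> n; have /andP[-> _]/= := @bump_itv n y ltac:(lra).
have yn : 0 <= y ^+ n by rewrite exprn_ge0//; lra.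
have yn1 : y ^+ n <= 1 by rewrite exprn_ile1//; lra.
have pos : 0 < (2 * y) ^+ n by rewrite exprn_gt0//; lra.
rewrite exprVn -[leRHS]mul1r ler_pdivlMr//.
apply: (@le_trans _ _ (bump n y * (1 + y ^+ n) ^+ (2 ^ n))).
  apply: ler_wpM2l; first by have /andP[] := @bump_itv n y ltac:(lra).
  have := @bernoulli_ge (y ^+ n) (2 ^ n) ltac:(lra); apply: le_trans.
  by rewrite natrX exprMn lerDr.
rewrite /bump -exprMn exprn_ile1//.
  by apply: mulr_ge0; lra.
by rewrite -subr_sqr expr1n; have := sqr_ge0 (y ^+ n); lra.
Qed.
End Bump.

Section FourierUniqueness.
Variable R : realType.
Implicit Types (D u v : R -> R).
Local Notation I := (`[- (pi : R), pi]%classic).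

Let mI : meas I. Proof. exact: measurable_itv. Qed.

(** Here t is the distance to the centre of an interval of half-width h, which
    can exceed pi inside one period. *)
Lemma cos_lt_iff (h t : R) : 0 < h < pi -> 0 <= t < pi *+ 2 - h ->
  (t < h -> cos h < cos t) /\ (h < t -> cos t < cos h).
Proof.
move=> /andP[h0 hpi] /andP[t0 t2].
have hI : h \in `[0, pi] by rewrite in_itv/= !ltW.
split=> th.
  by rewrite ltr_cos// in_itv/= t0/= (le_trans (ltW th))// ltW.
have [tpi|tpi] := leP t pi; first by rewrite ltr_cos// in_itv/= t0.
have -> : cos t = cos (pi *+ 2 - t).
  by rewrite -(cosN t) -(cosD2pi (- t)) addrC.
rewrite ltr_cos// ?in_itv/=; rewrite !mulr2n in t2 *; first by lra.
by apply/andP; split; lra.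
Qed.

(** The characteristic function of an interval is a bounded pointwise limit of
    trigonometric polynomials: polynomials in an affine function q of a
    translated cosine that tend to 1 where q < 1/2 and to 0 where q > 1/2. *)
Lemma integral_eq0_fourier D b : rint I D -> (forall k, fourier D k = 0) ->
  - pi < b < pi -> \int[Leb R]_(x in `[- pi, b]) D x = 0.
Proof.
move=> iD D0 /andP[pib bpi].
(* m is the centre and h the half-width of the interval. *)
pose m := (b - pi) / 2; pose h := (b + pi) / 2.
have hpi : 0 < h < pi by rewrite /h; apply/andP; split; lra.
(* q < 1/2 inside the interval; the divisor 8 keeps q between 0 and 1. *)
pose q (x : R) := 2^-1 - (cos (x - m) - cos h) / 8.
have q01 x : 0 <= q x <= 1.
  have := cos_le1 (x - m); have := cos_geN1 (x - m).
  by have := cos_le1 h; have := cos_geN1 h; rewrite /q; lra.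
have cq : continuous q.
  have cs : continuous (fun x : R => x - m) by move=> x; apply: cvgB; [exact: cvg_id|exact: cvg_cst].
  move=> x; apply: cvgB; first exact: cvg_cst.
  apply: cvgM; last exact: cvg_cst; apply: cvgB; last exact: cvg_cst.
  exact: (continuous_comp (cs x) (@continuous_cos R _)).
pose c0 : R[i] := (2^-1 + cos h / 8)%:C%C.
pose c1 : R[i] := Complex (- cos m / 16) (sin m / 16).
pose c2 : R[i] := Complex (- cos m / 16) (- sin m / 16).
have qE x : (q x)%:C%C = c0 + c1 * expi 1 x + c2 * expi (-1) x.
  apply: complex_eq; rewrite !(ReD, ImD, ReM, ImM)/= mulrN1z mulr1z mulN1r mul1r cosN sinN.
    by rewrite /q cosB; field.
  by field.
have a1 : ann D (fun=> 1).
  split; first exact: cst_continuous.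
    by exists 1 => x; rewrite normr1.
  move=> k; have /eqP := D0 (- k); rewrite fourierE mulf_eq0 => /orP[|/eqP].
    by rewrite eq_complex/= invr_eq0 mulrn_eq0/= gt_eqF ?pi_gt0.
  by rewrite opprK => <-; apply: eq_cintegral => x _; rewrite mulr1.
have an n : ann D (fun x => bump n (q x)) := ann_bump iD cq q01 qE n (2 ^ n) a1.
have int0 n : (\int[Leb R]_(x in I) (D x * bump n (q x))%:E = 0)%E.
  have [_ _ /(_ 0)] := an n => /(congr1 (@complex.Re R))/= H.
  have ir := rint_ann iD (an n).
  rewrite -[LHS]fineK; last exact: integrable_fin_num ir.
  congr EFin; rewrite -[RHS]H; apply: eq_Rintegral => x _.
  by rewrite !mul0r cos0 mulr1 subr0.
pose F := fun x => (D \_ `[- pi, b]) x.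
have mD : mfun I D := rint_measurable iD.
have sub : `[- pi, b] `<=` I by apply: subset_itvl; rewrite bnd_simp ltW.
have mF : mfun I F.
  apply/(measurable_restrict _ _ _) => //; rewrite setIidr//.
  exact: measurable_funS mD.
have mfn n : measurable_fun (I : set (measurableTypeR R)) (fun x => (D x * bump n (q x))%:E).
  exact: measurable_int (rint_ann iD (an n)).
have mFE : measurable_fun (I : set (measurableTypeR R)) (EFin \o F) by exact/measurable_EFinP.
have neg1 (c : R) : (Leb R).-negligible [set c].
  exists [set c]; split => //; exact: lebesgue_measure_set1.
have ae1 : {ae Leb R, forall x, I x -> (D x * bump n (q x))%:E @[n --> \oo] --> (EFin \o F) x}.
  have := negligibleU (negligibleU (neg1 (- pi)) (neg1 b)) (neg1 pi).
  apply: negligibleS => x /= hx; apply: contrapT => /not_orP[/not_orP[xN xb] xp].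
  apply: hx; rewrite in_itv/= => /andP[Nx px].
  suff H : D x * bump n (q x) @[n --> \oo] --> F x by apply: cvg_EFin => //; exact: nearW.
  have {Nx xN}Nx : - pi < x by rewrite lt_neqAle Nx andbT eq_sym; apply/eqP.
  have {px xp}px : x < pi by rewrite lt_neqAle px andbT; apply/eqP.
  have tI : 0 <= `|x - m| < pi *+ 2 - h.
    rewrite normr_ge0/= ltr_norml mulr2n /m /h; apply/andP; split; lra.
  have [c1h c2h] := cos_lt_iff hpi tI; rewrite cos_norm in c1h c2h.
  have q01x := q01 x; move: xb => /eqP; rewrite neq_lt => /orP[xb|bx].
    have lth : `|x - m| < h by rewrite ltr_norml /m /h; apply/andP; split; lra.
    rewrite (_ : F x = D x * 1).
      apply: cvgM; first exact: cvg_cst; apply: bump_cvg1.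
      by have := c1h lth; rewrite /q in q01x *; lra.
    by rewrite mulr1 /F patchE mem_set//= in_itv/= (ltW Nx) ltW.
  have lth : h < `|x - m| by rewrite lter_normr /m /h; apply/orP; left; lra.
  rewrite (_ : F x = D x * 0).
    apply: cvgM; first exact: cvg_cst; apply: bump_cvg0.
    by have := c2h lth; rewrite /q in q01x *; lra.
  by rewrite mulr0 /F patchE memNset//= in_itv/= => /andP[_]; rewrite leNgt bx.
have ae2 : {ae Leb R, forall x, forall n, I x -> (`|(D x * bump n (q x))%:E| <= `|D x|%:E)%E}.
  apply: aeW => x n _; rewrite lee_fin normrM ler_piMr//.
  by have /andP[b0 b1] := bump_itv n (q01 x); rewrite ger0_norm.
have [_ _] := dominated_convergence mI mfn mFE ae1 (integrable_abse iD) ae2.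
rewrite (_ : [sequence _]_n = cst 0%E); last by apply/funext => n; exact: int0.
move=> /cvg_lim; rewrite lim_cst// => /(_ (@ereal_hausdorff R)) H.
rewrite (_ : \int[Leb R]_(x in `[- pi, b]) D x = \int[Leb R]_(x in I) F x).
  by rewrite /Rintegral -[X in fine X]H.
by rewrite -Rintegral_mkcondr setIidr.
Qed.

(** The integral over [- pi, b] vanishes for all b; Lebesgue's differentiation
    theorem recovers the integrand. *)
Lemma fourier_eq0_ae D : rint I D -> (forall k, fourier D k = 0) ->
  {ae Leb R, forall x, - pi < x < pi -> D x = 0}.
Proof.
move=> iD D0.
have := lebesgue_differentiation (integrable_locally mI iD).
apply: filterS; first exact: (ae_filter_ringOfSetsType (Leb R)).
move=> x lx /andP[Nx px].
have iF : rint [set` Interval (BLeft (- pi)) (BRight (pi : R))] (D \_ I).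
  by apply: eq_integrable (iD) => // y yI; rewrite /= patchE yI.
have aB : ((- pi)%:E < x%:E)%E by rewrite lte_fin.
have [_ h] := FTC1_lebesgue_pt px iF aB lx.
have xI : x \in I by rewrite inE/= in_itv/= !ltW.
transitivity ((D \_ I) x); first by rewrite patchE xI.
rewrite -h derive1E.
rewrite (@near_eq_derive _ _ _ _ (cst 0)) ?derive_cst//.
have [ny yp] : (\near x, - pi < x) /\ (\near x, x < pi) by split; [exact: lt_nbhsr|exact: lt_nbhsl].
near=> y; have Ny : - pi < y by near: y.
have yp' : y < pi by near: y.
rewrite /= -[RHS](@integral_eq0_fourier D y)// ?Ny//.
apply: eq_Rintegral => z; rewrite inE/= in_itv/= => /andP[z1 z2].
by rewrite patchE mem_set//= in_itv/= z1 ltW// (le_lt_trans z2 yp').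
Unshelve. all: by end_near. Qed.

Lemma fourier_inj_ae u v : L2T u -> L2T v -> (forall k, fourier u k = fourier v k) ->
  ae_eqT u v.
Proof.
move=> Lu Lv uv; have iu := L2T_rint Lu; have iv := L2T_rint Lv.
have pD : periodic (u \- v) (pi *+ 2).
  by move=> x /=; have [-> _ _] := Lu; have [-> _ _] := Lv.
have h : {ae Leb R, forall x, [set 0] ((u \- v) x)}.
  apply: (periodic_ae pD); apply: fourier_eq0_ae; first exact: rintB.
  by move=> k; rewrite fourierB// uv subrr.
move: h; apply: filterS; first exact: (ae_filter_ringOfSetsType (Leb R)).
by move=> x /= /eqP; rewrite subr_eq0 => /eqP.
Qed.
End FourierUniqueness.

(** * Square summable sequences are Fourier coefficients *)

Lemma ae_imp (R : realType) (P Q : R -> Prop) : (forall x, P x -> Q x) ->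
  {ae Leb R, forall x, P x} -> {ae Leb R, forall x, Q x}.
Proof. by move=> PQ; apply: negligibleS => x /=; apply: contra_not; exact: PQ. Qed.

Section FastCauchySequences.
Variables (R : realType) (D : set R) (S : nat -> R -> R) (A : R).
Hypothesis mD : meas D.
Hypothesis mS : forall i, mfun setT (S i).
Hypothesis iS : forall i, rint D (S i).
Hypothesis dS : forall i, \int[Leb R]_(x in D) `|S i.+1 x - S i x| <= A / 2 ^+ i.

(** The superior limit makes the limit function measurable everywhere, and
    periodic when the sequence is. *)
Definition L1lim (x : R) := fine (limn_esup (fun i => (S i x)%:E)).

Lemma measurable_L1lim : mfun setT L1lim.
Proof.
apply: (measurableT_comp (f := fine)).
  exact: fine_measurable.
by apply: measurable_fun_limn_esup => i; exact/measurable_EFinP.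
Qed.

Lemma geometric_nneseries_lty : (\sum_(0 <= i <oo) (A / 2 ^+ i)%:E < +oo)%E.
Proof.
have A0 : 0 <= A.
  have := dS 0; rewrite expr0 divr1; apply: le_trans.
  by apply: Rintegral_ge0.
apply: (@le_lt_trans _ _ (2 * A)%:E); last exact: ltry.
apply: lime_le.
  by apply: is_cvg_nneseries => i _ _; rewrite lee_fin divr_ge0.
apply: nearW => n; rewrite sumEFin lee_fin big_mkord.
apply: (@le_trans _ _ (2 * A - 2 * A / 2 ^+ n)); last first.
  by rewrite gerBl divr_ge0// mulr_ge0.
elim: n => [|n IH]; first by rewrite big_ord0 expr0 divr1 subrr.
rewrite big_ord_recr/=; apply: (le_trans (lerD IH (lexx _))).
by rewrite exprS invfM; set y := (2 ^+ n)^-1; lra.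
Qed.

Let inc x := (\sum_(0 <= i <oo) `|S i.+1 x - S i x|%:E)%E.

Let inc_ge0 x : (0 <= inc x)%E.
Proof. by apply: nneseries_ge0 => i _ _; rewrite lee_fin. Qed.

Let mdiff i : mfun D (fun x => `|S i.+1 x - S i x|).
Proof.
apply: measurableT_comp => //; apply: measurable_funB; exact: measurable_funS (mS _).
Qed.

Let minc : measurable_fun (D : set (measurableTypeR R)) inc.
Proof.
have := @ge0_emeasurable_sum _ (measurableTypeR R) R D (fun i x => `|S i.+1 x - S i x|%:E) xpredT.
apply=> [k x _ _|k _]; first by rewrite lee_fin.
by apply/measurable_EFinP; exact: mdiff.
Qed.

Let iinc : (Leb R).-integrable D inc.
Proof.
apply/integrableP; split => //.
have -> : (\int[Leb R]_(x in D) `|inc x| = \int[Leb R]_(x in D) \sum_(0 <= i <oo) `|S i.+1 x - S i x|%:E)%E.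
  by apply: eq_integral => x _; rewrite gee0_abs.
rewrite integral_nneseries//; last first.
  by move=> i; apply/measurable_EFinP; exact: mdiff.
apply: le_lt_trans geometric_nneseries_lty.
apply: lee_nneseries => i _; first by move=> _; exact: integral_ge0.
have iB : rint D (fun x => S i.+1 x - S i x) by exact: rintB.
have := dS i; rewrite -lee_fin /Rintegral fineK//.
by apply: (integrable_fin_num mD); have := integrable_abse iB.
Qed.

(** The increments have summable integrals, hence are almost everywhere
    absolutely summable. *)
Lemma L1lim_ae : {ae Leb R, forall x, D x -> S i x @[i --> \oo] --> L1lim x}.
Proof.
apply: ae_imp (integrable_ae mD iinc) => x /= h Dx; have fx := h Dx.
have cS : cvgn (fun i => S i x).
  have c1 : cvgn (series (fun i => S i.+1 x - S i x)).
    apply: normed_cvg; apply: nondecreasing_is_cvgn.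
      by apply/nondecreasing_seqP => n; rewrite /normed_series_of /series /= big_nat_recr//= lerDl.
    exists (fine (inc x)) => _ [n _ <-]; rewrite -lee_fin fineK//.
    rewrite /normed_series_of /series /= -sumEFin; apply: nneseries_lim_ge => i _ _.
    by rewrite lee_fin.
  have c2 : cvgn (fun i => S 0 x + series (fun i => S i.+1 x - S i x) i).
    by apply: is_cvgD => //; exact: is_cvg_cst.
  rewrite (_ : (fun i => S i x) = (fun i => S 0 x + series (fun i => S i.+1 x - S i x) i))//.
  by apply/funext => n; rewrite /series/= (telescope_sumr (fun i => S i x))// subrKC.
rewrite /L1lim.
have /cvg_limn_einf_sup[_ ->] : (S i x)%:E @[i --> \oo] --> (limn (fun i => S i x))%:E.
  by apply: cvg_EFin; [exact: nearW|exact: cS].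
exact: cS.
Qed.

(** Dominated convergence, with the absolute values of S 0 and of all
    increments added up as the dominating function. *)
Lemma L1lim_cvg : rint D L1lim /\
  \int[Leb R]_(x in D) `|S i x - L1lim x| @[i --> \oo] --> (0 : R).
Proof.
have iG : (Leb R).-integrable D (fun x => `|S 0 x|%:E + inc x)%E.
  by apply: integrableD => //; have := integrable_abse (iS 0).
have ae2 : {ae Leb R, forall x, forall i, D x -> (`|(S i x)%:E| <= `|S 0 x|%:E + inc x)%E}.
  apply: aeW => x i _ /=.
  apply: (@le_trans _ _ (`|S 0 x|%:E + \sum_(0 <= j < i) `|S j.+1 x - S j x|%:E)%E); last first.
    by apply: leeD2l; apply: nneseries_lim_ge => j _ _; rewrite lee_fin.
  rewrite sumEFin -EFinD lee_fin.
  have -> : S i x = S 0 x + \sum_(0 <= j < i) (S j.+1 x - S j x).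
    by rewrite (telescope_sumr (fun i => S i x))// subrKC.
  rewrite (le_trans (ler_normD _ _))// lerD2l; exact: ler_norm_sum.
have ae1 : {ae Leb R, forall x, D x -> (S i x)%:E @[i --> \oo] --> (L1lim x)%:E}.
  apply: ae_imp L1lim_ae => x h /h hx.
  by apply: cvg_EFin => //; exact: nearW.
have mfn i : measurable_fun (D : set (measurableTypeR R)) (fun x => (S i x)%:E).
  by apply/measurable_EFinP; exact: measurable_funS (mS _).
have mf : measurable_fun (D : set (measurableTypeR R)) (EFin \o L1lim).
  by apply/measurable_EFinP; exact: measurable_funS measurable_L1lim.
have [iL h _] := dominated_convergence mD mfn mf ae1 iG ae2.
split=> //; move/fine_cvg : h; apply: cvg_trans.
by apply: near_eq_cvg; apply: nearW => i.
Qed.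
End FastCauchySequences.

Section RieszFischer.
Variable R : realType.
Implicit Types (u v : R -> R) (c : int -> R[i]).
Local Notation I := (`[- (pi : R), pi]%classic).

Let mI : meas I. Proof. exact: measurable_itv. Qed.

Lemma Re_fourier0 v : rint I v -> complex.Re (fourier v 0) = (pi *+ 2)^-1 * \int[Leb R]_(x in I) v x.
Proof.
move=> iv; rewrite fourierE ReM/= mul0r subr0; congr (_ * _).
by apply: eq_Rintegral => x _; rewrite oppr0 !mul0r subr0 cos0 mulr1.
Qed.

(** Parseval's identity, read off the zeroth coefficient of the square. *)
Lemma trig_norm2 c n : conj_sym c ->
  \int[Leb R]_(x in I) (trig c n x ^+ 2) = pi *+ 2 * psum (fun j => nc (c j) ^+ 2) n.
Proof.
move=> sc; have Lt := L2T_trig c n; have itr := L2T_rint Lt.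
have p0 : pi *+ 2 != 0 :> R by rewrite mulrn_eq0/= gt_eqF ?pi_gt0.
have := Re_fourier0 (rint_mul_L2T Lt Lt); rewrite fourier_trig_mul//.
move=> /(congr1 (fun z => pi *+ 2 * z)); rewrite mulrA mulfV// mul1r.
under eq_Rintegral do rewrite -expr2.
move=> <-; congr (_ * _); rewrite /psum Re_sum !big_seq; apply: eq_bigr => j.
rewrite mem_zrange => jn; rewrite sub0r fourier_trig// abszN jn sc ReM nc_sqr.
by case: (c j) => a b /=; ring.
Qed.

(** A difference of partial sums is again a partial sum, of the family
    without its low frequencies. *)
Definition cut c m (j : int) : R[i] := if (`|j| <= m)%N then 0 else c j.

Lemma trig_cut c m p x : trig c (m + p) x - trig c m x = trig (cut c m) (m + p) x.
Proof.
rewrite /trig -ReB; congr Re; rewrite /tpoly.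
elim: p => [|p IH].
  rewrite addn0 subrr /psum big_seq big1// => j; rewrite mem_zrange /cut => ->.
  by rewrite mul0r.
rewrite addnS !psumS -IH /cut abszN !absz_nat ltnNge leq_addr/=; ring.
Qed.

Lemma psum_cut c m p : psum (fun j => nc (cut c m j) ^+ 2) (m + p) =
  psum (fun j => nc (c j) ^+ 2) (m + p) - psum (fun j => nc (c j) ^+ 2) m.
Proof.
elim: p => [|p IH].
  rewrite addn0 subrr /psum big_seq big1// => j; rewrite mem_zrange /cut => ->.
  by rewrite nc0 expr0n.
rewrite addnS !psumS IH /cut abszN !absz_nat ltnNge leq_addr/=; ring.
Qed.

Lemma cut_sym c m : conj_sym c -> conj_sym (cut c m).
Proof.
move=> sc k; rewrite /cut abszN sc; case: ifP => // _.
by rewrite [RHS]rmorph0.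
Qed.

(** Partial sums are Cauchy in mean square, a subsequence with summable
    increments converges almost everywhere, and Fatou's lemma bounds the mean
    square of the limit. *)
Theorem riesz_fischer c K : conj_sym c -> sum_le (fun j => nc (c j) ^+ 2) K ->
  exists2 u, L2T u & forall k, fourier u k = c k.
Proof.
move=> sc hK; pose a (j : int) := nc (c j) ^+ 2.
have a0 j : 0 <= a j by exact: sqr_ge0.
have ca := sum_le_psum_cvg a0 hK.
have nda : nondecreasing_seq (psum a).
  by apply/nondecreasing_seqP => n; rewrite psumS addrA lerDr addr_ge0.
pose tau n := limn (psum a) - psum a n.
have tau0 : tau @ \oo --> (0 : R).
  rewrite -[X in _ --> X](subrr (limn (psum a))); apply: cvgB => //; exact: cvg_cst.
have hN i : exists n, tau n <= ((2 ^+ i)^-1) ^+ 2.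
  have e0 : 0 < ((2 ^+ i)^-1) ^+ 2 :> R by rewrite exprn_gt0// invr_gt0 exprn_gt0.
  move/cvgrPdist_le: tau0 => /(_ _ e0)[n _ /(_ n (leqnn n))/=]; rewrite sub0r normrN => h.
  by exists n; rewrite (le_trans (ler_norm _)).
pose n0 i := sval (cid (hN i)).
(* Adding up the thresholds makes N increasing. *)
pose N i := (i + \sum_(j < i.+1) n0 j)%N.
have Ntau i : tau (N i) <= ((2 ^+ i)^-1) ^+ 2.
  apply: le_trans (svalP (cid (hN i))); rewrite -/(n0 i) lerB// nda// /N big_ord_recr/=.
  by rewrite addnA leq_addl.
pose S i := trig c (N i).
have Lt n : L2T (trig c n) := L2T_trig c n.
have p0 : 0 < pi *+ 2 :> R by rewrite mulrn_wgt0 ?pi_gt0.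
have LB i : L2T (fun x => S i.+1 x - S i x).
  apply: L2T_continuous => [x|x]; first by rewrite /S !periodic_trig.
  by apply: cvgB; exact: continuous_trig.
have dS2 i : \int[Leb R]_(x in I) ((S i.+1 x - S i x) ^+ 2) <= pi *+ 2 * ((2 ^+ i)^-1) ^+ 2.
  have [p ->] : exists p, S i.+1 = trig c (N i + p).
    exists (n0 i.+1).+1; rewrite /S /N [in LHS]big_ord_recr/=; congr trig; lia.
  under eq_Rintegral do rewrite trig_cut.
  rewrite trig_norm2; last exact: cut_sym.
  apply: ler_wpM2l; first exact: ltW.
  rewrite psum_cut; apply: le_trans (Ntau i).
  by rewrite lerD2r; apply: nondecreasing_cvgn_le.
(* Young's inequality |z| <= y / 2 + z ^ 2 / (2 y) bounds the mean of |z|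
   by its mean square. *)
have dS i : \int[Leb R]_(x in I) `|S i.+1 x - S i x| <= (pi *+ 2) / 2 ^+ i.
  set y := (2 ^+ i)^-1; have y0 : 0 < y by rewrite invr_gt0 exprn_gt0.
  have iB := L2T_rint (LB i); have [_ _ iB2] := LB i.
  have iR : rint I (fun x => 2^-1 * y * 1 + 2^-1 / y * (S i.+1 x - S i x) ^+ 2).
    by apply: rintD => //; apply: rintZ => //; exact: rint1.
  apply: (@le_trans _ _ (\int[Leb R]_(x in I) (2^-1 * y * 1 + 2^-1 / y * (S i.+1 x - S i x) ^+ 2))).
    apply: le_Rintegral => //; first by have := integrable_abse iB.
    move=> x _; rewrite mulr1 -[(_ - _) ^+ 2]real_normK ?num_real//; set z := `|_|.
    rewrite -subr_ge0.
    have -> : 2^-1 * y + 2^-1 / y * z ^+ 2 - z = 2^-1 / y * (z - y) ^+ 2.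
      by field; rewrite gt_eqF.
    by rewrite mulr_ge0 ?sqr_ge0// divr_ge0// ltW.
  rewrite RintegralD//; last 2 first.
    by apply: rintZ => //; exact: rint1.
    by apply: rintZ.
  rewrite !RintegralZl//; last exact: rint1.
  have -> : \int[Leb R]_(x in I) (1 : R) = pi *+ 2.
    have := Re_fourier0 (rint1 R); rewrite fourier1/= => /(congr1 (fun z => pi *+ 2 * z)).
    by rewrite mulrA mulfV ?gt_eqF// mul1r mulr1 => ->.
  apply: (@le_trans _ _ (2^-1 * y * (pi *+ 2) + 2^-1 / y * (pi *+ 2 * y ^+ 2))).
    by rewrite lerD2l ler_wpM2l// divr_ge0// ltW.
  have -> : 2^-1 * y * (pi *+ 2) + 2^-1 / y * (pi *+ 2 * y ^+ 2) = pi *+ 2 * y.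
    by field; rewrite gt_eqF.
  by [].
have mS i : mfun setT (S i) by have [_ h _] := Lt (N i); exact: h.
have iS i : rint I (S i) := L2T_rint (Lt (N i)).
have mu := measurable_L1lim mS.
have [iu cu] := L1lim_cvg mI mS iS dS.
exists (L1lim S).
  split.
  - by move=> x; rewrite /L1lim; congr (fine (limn_esup _)); apply/funext => i; rewrite /S periodic_trig.
  - exact: mu.
  - apply/integrableP; split.
      by apply/measurable_EFinP; apply: measurable_funX; exact: measurable_funS mu.
    rewrite (_ : (\int[Leb R]_(x in I) _)%E =
       (\int[Leb R]_(x in I) limn_einf (fun i => ((S i x) ^+ 2)%:E))%E); last first.
      apply: ae_eq_integral => //.
      - by apply/measurable_EFinP; apply: measurableT_comp => //; apply: measurable_funX; exact: measurable_funS mu.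
      - apply: (measurableT_comp (f := -%E)) => //.
        apply: measurable_fun_limn_esup => i; apply: (measurableT_comp (f := -%E)) => //.
        apply/measurable_EFinP; apply: measurable_funX.
        exact: measurable_funS (mS i).
      - apply: ae_imp (L1lim_ae mI mS iS dS) => x h /h hx /=.
        rewrite ger0_norm ?sqr_ge0//.
        have /cvg_limn_einf_sup[-> _] : ((S i x) ^+ 2)%:E @[i --> \oo] --> ((L1lim S x) ^+ 2)%:E.
          by apply: cvg_EFin; [exact: nearW|apply: cvgM].
        by [].
    apply: (@le_lt_trans _ _ (limn_einf (fun i => \int[Leb R]_(x in I) ((S i x) ^+ 2)%:E)%E)).
      apply: fatou => // i; first by apply/measurable_EFinP; apply: measurable_funX; exact: measurable_funS (mS i).
      by move=> x _; rewrite lee_fin sqr_ge0.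
    rewrite limn_einf_lim; apply: (@le_lt_trans _ _ (pi *+ 2 * K)%:E); last exact: ltry.
    apply: lime_le; first exact: is_cvg_einfs.
    apply: nearW => n; apply: (@le_trans _ _ (\int[Leb R]_(x in I) ((S n x) ^+ 2)%:E)%E).
      by apply: ereal_inf_lbound; exists n => /=.
    have [_ _ iS2] := Lt (N n).
    rewrite -[leLHS]fineK; last exact: integrable_fin_num iS2.
    rewrite lee_fin; have := trig_norm2 (N n) sc; rewrite /Rintegral => ->.
    by apply: ler_wpM2l; [exact: ltW|apply: hK; exact: uniq_zrange].
move=> k; apply: (@ccvg_unique _ (fun i => fourier (S i) k)).
  apply: (@ccvg_le _ _ _ (fun i => pi^-1 * \int[Leb R]_(x in I) `|S i x - L1lim S x|)).
    move=> i; rewrite -fourierB//; apply: fourier_le => //; first exact: rintB.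
    by have iB : rint I (fun x => S i x - L1lim S x) by [exact: rintB]; have := integrable_abse iB.
  rewrite -[X in _ --> X](mulr0 (pi^-1 : R)); apply: cvgM => //; exact: cvg_cst.
rewrite /ccvg -(cvg_shiftn `|k|%N).
rewrite (_ : (fun i => _) = fun=> 0); first exact: cvg_cst.
apply/funext => i; rewrite fourier_trig// ifT ?subrr ?nc0// /N.
by apply: leq_trans (leq_addr _ _); exact: leq_addl.
Qed.
End RieszFischer.

(** * Products of periodic distributions *)

Section Products.
Variable R : realType.
Implicit Types (u v : R -> R) (g h : pdist R).
Local Notation I := (`[- (pi : R), pi]%classic).

Let mI : meas I. Proof. exact: measurable_itv. Qed.

Lemma fourier_ae u v k : rint I u -> rint I v -> ae_eqT u v -> fourier u k = fourier v k.
Proof.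
move=> iu iv uv; apply/eqP; rewrite -subr_eq0 -fourierB//; apply/eqP/nc_eq0/le_anti.
rewrite nc_ge0 andbT.
have iB : rint I (u \- v) by exact: rintB.
have iB' : rint I (fun x => `|(u \- v) x|) by have := integrable_abse iB.
apply: (le_trans (fourier_le k iB iB' (fun x _ => lexx _))).
rewrite /Rintegral (_ : (\int[Leb R]_(x in I) _)%E = (\int[Leb R]_(x in I) (cst 0 x))%E).
  by rewrite integral0 mulr0.
apply: ae_eq_integral => //; first exact: measurable_int iB'.
by apply: ae_imp uv => x /= -> _; rewrite subrr normr0.
Qed.

Lemma fun_of_spec g u : L2T u -> fourier u = g -> L2T (fun_of g) /\ fourier (fun_of g) = g.
Proof. by move=> Lu ug; rewrite /fun_of; case: xgetP => [//|/(_ u)/= []]. Qed.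

Lemma fun_of_l2 g K : conj_sym g -> sum_le (fun j => nc (g j) ^+ 2) K ->
  L2T (fun_of g) /\ fourier (fun_of g) = g.
Proof.
move=> sg hg; have [u Lu ug] := riesz_fischer sg hg.
by apply: (fun_of_spec Lu); apply/funext => k.
Qed.

Lemma fun_of_l1 g : conj_sym g -> summ g ->
  [/\ L2T (fun_of g), fourier (fun_of g) = g & ae_eqT (fun_of g) (fser g)].
Proof.
move=> sg hg; have Lg := L2T_fser hg.
have Fg : fourier (fser g) = g by apply/funext => k; exact: fourier_fser.
have [L1 F1] := fun_of_spec Lg Fg; split => //.
by apply: fourier_inj_ae => // k; rewrite F1 Fg.
Qed.

(** The first factor agrees almost everywhere with an absolutely convergent
    Fourier series, so that the convolution theorem applies whatever
    representatives were chosen. *)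
Lemma dprodE g h K k : conj_sym g -> summ g -> conj_sym h ->
  sum_le (fun j => nc (h j) ^+ 2) K ->
  dprod g h k = zsum (fun j => g j * h (k - j)).
Proof.
move=> sg hg sh hh; have [Lh Fh] := fun_of_l2 sh hh.
have [Lg Fg ag] := fun_of_l1 sg hg.
rewrite /dprod (@fourier_ae _ (fun x => fser g x * fun_of h x)).
- by rewrite fourier_fser_mul ?Fh//; exact: L2T_rint.
- exact: rint_mul_L2T.
- by apply: rint_mul_L2T => //; exact: L2T_fser.
- by apply: ae_imp ag => x /= ->.
Qed.
End Products.

(** * The symbols of the equation *)

Section IntegerFrequencies.

(** Opposite signs of k and k - j force j to carry the larger frequency: this
    is the smoothing effect of the commutator with the Hilbert transform. *)
Lemma sgz_neq_le (k j : int) : sgz k != sgz (k - j) ->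
  (`|k| <= `|j|)%R /\ (`|k - j| <= `|j|)%R.
Proof.
case: (sgzP k); case: (sgzP (k - j)) => //; lia.
Qed.

Lemma norm_int_ge1 (R : realType) (k : int) : k != 0 -> 1 <= `|k%:~R : R|.
Proof. by move=> k0; rewrite -intr_norm ler1z; lia. Qed.
End IntegerFrequencies.

Section Symbols.
Variables (R : realType) (eps beta a1 a2 : R).
Hypotheses (eps0 : 0 < eps) (beta0 : 0 <= beta) (a1_gt0 : 0 < a1) (a2_gt0 : 0 < a2).

Let a := (a1 + a2) / 2.
Let a0 : 0 < a. Proof. by rewrite divr_gt0// addr_gt0. Qed.

Definition ik (k : int) : R[i] := 'i%C * k%:~R.

(** Here begin the symbols: of N, of H, of the linear terms, and of the
    nonlinear terms before N is applied. In the last one k is the frequency of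
    the product and j the frequency of its first factor. *)
Definition nsym (k : int) : R[i] :=
  (1 - (a%:C)%C ^+ 2 * ik k ^+ 2)^-1 * (1 - (a%:C)%C * ik k).

Definition hsym (k : int) : R[i] := - 'i%C * (sgz k)%:~R.

Definition lsym (k : int) : R[i] :=
  nsym k * (ik k + ((a1 + a2)%:C)%C * ik k ^+ 2 + hsym k
    - (beta%:C)%C * (hsym k * ik k ^+ 2) + ((a1 * a2)%:C)%C * ik k ^+ 3).

Definition msym (k j : int) : R[i] :=
  2 * ik (k - j) + `|k|%:~R * ((hsym k - hsym (k - j)) * (`|j|%:~R)^-1)
  + (beta%:C)%C * (`|k|%:~R * ((hsym k - hsym (k - j)) * (`|j|%:~R)^-1 * (`|k - j|%:~R * `|k - j|%:~R)))
  - (a2%:C)%C * (`|k|%:~R * ((hsym k - hsym (k - j)) * ik (k - j)))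
  + (a2%:C)%C * (ik k * ik (k - j))
  + (a1%:C)%C * (`|k|%:~R * ((ik k ^+ 2 - ik (k - j) ^+ 2) * (`|j|%:~R)^-1)).

(** The equation solved for the time derivative has the linear symbol lam and
    the bilinear symbol bil. *)
Definition lam (k : int) : R[i] := ((2 * eps)^-1%:C)%C * lsym k.
Definition bil (k j : int) : R[i] := - (2^-1%:C)%C * (nsym k * msym k j).

Lemma nc_int (k : int) : nc (k%:~R : R[i]) = `|k%:~R|.
Proof. by rewrite -(rmorph_int (real_complex R)) nc_real. Qed.

Lemma nc_i : nc ('i%C : R[i]) = 1.
Proof. by rewrite /= expr0n expr1n add0r sqrtr1. Qed.

Lemma nc_ik k : nc (ik k) = `|k%:~R|.
Proof. by rewrite ncM nc_i mul1r nc_int. Qed.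

Lemma ReIm_ik k : Re (ik k) = 0 /\ Im (ik k) = k%:~R.
Proof.
by split; rewrite /ik -(rmorph_int (real_complex R)) /=; ring.
Qed.

(** The denominator 1 - (a ik) ^ 2 contains the numerator 1 - a ik as a
    factor. *)
Lemma nsymE k : nsym k = (1 + (a%:C)%C * ik k)^-1.
Proof.
have h : 1 - (a%:C)%C ^+ 2 * ik k ^+ 2 = (1 - (a%:C)%C * ik k) * (1 + (a%:C)%C * ik k).
  by ring.
rewrite /nsym h invfM mulrAC mulVf ?mul1r//.
have [r i] := ReIm_ik k.
by rewrite eq_complex/= !(ReD, ReN, ReM, r, i)/= !mul0r !mulr0 subrr oppr0 addr0 oner_eq0.
Qed.

Lemma nsym_nc_le1 k : nc (nsym k) <= 1.
Proof.
have [r i] := ReIm_ik k.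
have h : 1 <= nc (1 + (a%:C)%C * ik k).
  apply: le_trans (Re_le_nc _); rewrite ReD ReM r i/= mulr0 mul0r subrr addr0 normr1.
  by [].
by rewrite nsymE ncV invf_le1// (lt_le_trans ltr01).
Qed.

Lemma nsym_nc_le k : nc (nsym k) * (a * `|k%:~R|) <= 1.
Proof.
have [r i] := ReIm_ik k.
have h : a * `|k%:~R| <= nc (1 + (a%:C)%C * ik k).
  apply: le_trans (Im_le_nc _); rewrite ImD ImM r i/= mul0r addr0 add0r normrM.
  by rewrite gtr0_norm.
rewrite nsymE ncV -ler_pdivlMl ?mulr1//; last first.
  rewrite invr_gt0 lt_neqAle nc_ge0 andbT eq_sym; apply/eqP => /nc_eq0/eqP.
  by rewrite eq_complex/= !(ReD, ReM, r, i)/= mulr0 mul0r subrr addr0 oner_eq0.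
by rewrite invrK.
Qed.

Lemma hsym_diff k j : nc (hsym k - hsym (k - j)) <= 2 /\
  (hsym k - hsym (k - j) != 0 -> (`|k%:~R| <= `|j%:~R| :> R) /\ (`|(k - j)%:~R| <= `|j%:~R| :> R)).
Proof.
have h1 m : nc (hsym m) <= 1.
  rewrite /hsym ncM ncN nc_i mul1r nc_int.
  by case: (sgzP m); rewrite ?normr0 ?mulrN1z ?normrN ?normr1.
split; first by rewrite (le_trans (ncB _ _))// (le_trans (lerD (h1 _) (h1 _))).
move=> h; have /sgz_neq_le[] : sgz k != sgz (k - j).
  by apply: contraNneq h => e; rewrite /hsym e subrr.
by rewrite -!intr_norm !ler_int.
Qed.

Lemma ik0 : ik 0 = 0. Proof. by rewrite /ik mulr0. Qed.

Lemma lam0 : lam 0 = 0.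
Proof. by rewrite /lam /lsym /hsym ik0 sgz0; ring. Qed.

Lemma conj_int (m : int) : ((m%:~R : R[i])^*)%C = m%:~R.
Proof. exact: (rmorph_int (@conjc R)). Qed.

Lemma conj_i : (('i%C : R[i])^*)%C = - 'i%C.
Proof. by apply: complex_eq => /=; rewrite ?oppr0. Qed.

Lemma conj_real (x : R) : (((x%:C)%C)^*)%C = (x%:C)%C.
Proof. exact: conjc_real. Qed.

Lemma conj_1 : ((1 : R[i])^*)%C = 1.
Proof. exact: conjc1. Qed.

Lemma conjV (x : R[i]) : ((x^-1)^*)%C = ((x^*)%C)^-1.
Proof. exact: conjc_inv. Qed.

Lemma ikN k : ik (- k) = ((ik k)^*)%C.
Proof. by rewrite /ik conjM conj_int conj_i mulrNz mulrN mulNr. Qed.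

Lemma hsymN k : hsym (- k) = ((hsym k)^*)%C.
Proof. by rewrite /hsym sgzN conjM conj_int conjN conj_i mulrNz; ring. Qed.

Lemma nsymN k : nsym (- k) = ((nsym k)^*)%C.
Proof. by rewrite !nsymE ikN; move: (ik k) => X; rewrite conjV conjD conj_1 conjM conj_real. Qed.

Lemma lamN k : lam (- k) = ((lam k)^*)%C.
Proof.
rewrite /lam /lsym nsymN !hsymN !ikN; move: (ik k) (hsym k) (nsym k) => X h n.
by rewrite !exprS !expr0 !mulr1 !(conjM, conjD, conjN, conj_real).
Qed.

Lemma bilN k j : bil (- k) (- j) = ((bil k j)^*)%C.
Proof.
have e : - k - - j = - (k - j) by ring.
rewrite /bil /msym e nsymN !hsymN !ikN !normrN !expr2.
move: (ik k) (hsym k) (nsym k) (ik (k - j)) (hsym (k - j)) => X h n Y h'.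
by rewrite !(conjM, conjD, conjN, conj_real, conjV, conj_int).
Qed.

(** Since lsym k * (1 + a ik) is a polynomial in k, its real part plus a k
    times its imaginary part isolates the real part of lsym k. Since
    a1 + a2 = 2 a, the viscous term of order two outweighs what the transport
    term contributes to this combination. *)
Lemma lsym_re k : let K : R := k%:~R in
  (1 + a ^+ 2 * K ^+ 2) * Re (lsym k) =
  - (a * (K ^+ 2 + `|K| + beta * (`|K| * K ^+ 2) + a1 * a2 * K ^+ 4)).
Proof.
move=> K.
have hz : lsym k * (1 + (a%:C)%C * ik k) = ik k + ((a1 + a2)%:C)%C * ik k ^+ 2 + hsym k
    - (beta%:C)%C * (hsym k * ik k ^+ 2) + ((a1 * a2)%:C)%C * ik k ^+ 3.
  rewrite /lsym nsymE mulrAC mulVf ?mul1r//.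
  have [r i] := ReIm_ik k.
  by rewrite eq_complex/= !(ReD, ReM, r, i)/= mulr0 mul0r subrr addr0 oner_eq0.
have [r i] := ReIm_ik k.
pose s : R := (sgz k)%:~R.
have [hr hi] : Re (hsym k) = 0 /\ Im (hsym k) = - s.
  by rewrite /hsym /s -(rmorph_int (real_complex R)) /=; split; ring.
have sK : s * K = `|K|.
  rewrite /s /K; case: (sgzP k) => [->|hk|hk]; first by rewrite mul0r normr0.
    by rewrite mul1r gtr0_norm// ltr0z.
  by rewrite mulN1r ltr0_norm// ltrz0.
have ha : a1 + a2 = 2 * a by rewrite /a; field.
rewrite ha in hz; rewrite -sK; move: (lsym k) hz => z.
move: (ik k) (hsym k) r i hr hi => X h r i hr hi.
move=> /[dup] /(congr1 (@complex.Re R)) + /(congr1 (@complex.Im R)).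
rewrite !exprS expr0 !mulr1 !(ReD, ImD, ReN, ImN, ReM, ImM, r, i, hr, hi) /= -/K.
set x := Re z; set y := Im z => h1 h2.
have h3 := congr1 (fun t => a * K * t) h2; rewrite /= in h3.
lra.
Qed.
End Symbols.

Section SymbolBounds.
Variables (R : realType) (eps beta a1 a2 : R).
Hypotheses (eps0 : 0 < eps) (beta0 : 0 <= beta) (a1_gt0 : 0 < a1) (a2_gt0 : 0 < a2).

Let a := (a1 + a2) / 2.
Let a0 : 0 < a. Proof. by rewrite divr_gt0// addr_gt0. Qed.

Local Notation A k := (`|(k%:~R : R)|).

Lemma ik_sqrB k l : ik R k ^+ 2 - ik R l ^+ 2 = - ((k + l) * (k - l))%:~R.
Proof.
rewrite intrM intrB intrD /ik !exprMn (@sqr_i R).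
move: (k%:~R : R[i]) (l%:~R : R[i]) => x y; ring.
Qed.

Definition diss : R := a * Num.min 1 (a1 * a2) / (2 * eps * (1 + a ^+ 2)).

Lemma diss_gt0 : 0 < diss.
Proof.
have d1 : 0 < 1 + a ^+ 2 by rewrite ltr_wpDr ?sqr_ge0.
have m0 : 0 < Num.min 1 (a1 * a2) by rewrite lt_min ltr01 mulr_gt0.
by apply: divr_gt0; do ?[apply: mulr_gt0 => //].
Qed.

(** In lsym_re the terms of order three and four beat the denominator, which
    is at most (1 + a ^ 2) k ^ 2. The part beta |k| is kept because it has to
    absorb the growth in beta of the bilinear symbol. *)
Lemma lam_re_le k : k != 0 -> Re (lam eps beta a1 a2 k) <= - (diss * (A k ^+ 2 + beta * A k)).
Proof.
move=> k0; have := lsym_re beta a1 a2 k; rewrite /= -/a.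
have := norm_int_ge1 R k0; rewrite -[k%:~R ^+ 2]real_normK ?num_real//.
have -> : k%:~R ^+ 4 = (A k ^+ 2) ^+ 2 :> R.
  by rewrite real_normK ?num_real// -exprM.
set K := `|k%:~R|; set x := Re (lsym beta a1 a2 k) => K1 hx.
have -> : Re (lam eps beta a1 a2 k) = (2 * eps)^-1 * x.
  by rewrite /lam ReM/= mul0r subr0.
rewrite /diss; set m := Num.min 1 (a1 * a2).
have m1 : m <= 1 by rewrite /m ge_min lexx.
have ma : m <= a1 * a2 by rewrite /m ge_min lexx orbT.
have m0 : 0 < m by rewrite lt_min ltr01 mulr_gt0.
have K0 : 0 < K by lra.
have d0 : 0 < 1 + a ^+ 2 * K ^+ 2 by rewrite ltr_wpDr// mulr_ge0// sqr_ge0.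
have d1 : 0 < 1 + a ^+ 2 by rewrite ltr_wpDr// sqr_ge0.
suff : x <= - (a * m * (K ^+ 2 + beta * K) / (1 + a ^+ 2)).
  move=> hx'; rewrite (_ : - _ = (2 * eps)^-1 * - (a * m * (K ^+ 2 + beta * K) / (1 + a ^+ 2))).
    by rewrite ler_wpM2l// invr_ge0 mulr_ge0// ltW.
  by field; rewrite !gt_eqF.
have -> : x = - (a * (K ^+ 2 + K + beta * (K * K ^+ 2) + a1 * a2 * (K ^+ 2) ^+ 2)) / (1 + a ^+ 2 * K ^+ 2).
  by rewrite -hx mulrAC mulfV ?mul1r// gt_eqF.
rewrite mulNr lerN2 ler_pdivrMr// [leRHS]mulrAC ler_pdivlMr//.
have h1 : m * (K ^+ 2 + beta * K) * K ^+ 2 <=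
    K ^+ 2 + K + beta * (K * K ^+ 2) + a1 * a2 * (K ^+ 2) ^+ 2.
  have t1 : m * (K ^+ 2) ^+ 2 <= a1 * a2 * (K ^+ 2) ^+ 2 by rewrite ler_wpM2r// sqr_ge0.
  have t2 : m * (beta * (K * K ^+ 2)) <= beta * (K * K ^+ 2).
    by rewrite ler_piMl// !mulr_ge0// ?sqr_ge0// ltW.
  by have := sqr_ge0 K; lra.
have h2 : 1 + a ^+ 2 * K ^+ 2 <= (1 + a ^+ 2) * K ^+ 2.
  by rewrite mulrDl mul1r lerD2r expr_ge1// ltW.
apply: (@le_trans _ _ (a * (m * (K ^+ 2 + beta * K)) * ((1 + a ^+ 2) * K ^+ 2))).
  rewrite -(mulrA a); apply: ler_wpM2l => //.
  apply: mulr_ge0; first exact: ltW.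
  apply: mulr_ge0; first exact: ltW.
  by rewrite addr_ge0 ?sqr_ge0// mulr_ge0// ltW.
rewrite (_ : a * (m * (K ^+ 2 + beta * K)) * ((1 + a ^+ 2) * K ^+ 2) =
   a * (m * (K ^+ 2 + beta * K) * K ^+ 2) * (1 + a ^+ 2)); last by ring.
apply: ler_wpM2r; first exact: ltW.
by apply: ler_wpM2l; [exact: ltW|].
Qed.

(** The factor nsym k is at most 1 and at most 1 / (a |k|), which absorbs an
    outer derivative; the commutators with the Hilbert transform vanish unless
    j carries the largest frequency. *)
Lemma msym_bound k j : k != 0 -> j != 0 -> k - j != 0 ->
  nc (nsym a1 a2 k * msym beta a1 a2 k j) <=
    2 * A (k - j) + 2 + 2 * beta / a * (Num.min (A (k - j)) (A (k - j) * A j / A k))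
    + 3 * a2 / a * A (k - j) + a1 / a * (A j + 2 * A (k - j)).
Proof.
move=> k0 j0 l0; set l := k - j in l0 *.
have K1 := norm_int_ge1 R k0; have J1 := norm_int_ge1 R j0; have L1 := norm_int_ge1 R l0.
have [h2 hs] := hsym_diff R k j; rewrite -/l in h2 hs.
have n1 := nsym_nc_le1 a1 a2 k; have n2 := nsym_nc_le a1_gt0 a2_gt0 k; rewrite -/a in n2.
have na : nc (nsym a1 a2 k) * A k <= a^-1.
  by rewrite -(ler_pM2l a0) mulfV ?gt_eqF// mulrCA.
set K := A k in K1 n2 na hs *; set J := A j in J1 hs *; set L := A l in L1 hs *.
set n := nc (nsym a1 a2 k) in n1 n2 na.
have n0 : 0 <= n := nc_ge0 _.
set s := hsym R k - hsym R l in h2 hs.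
have s0 : 0 <= nc s := nc_ge0 _.
have J0 : 0 < J by lra.
have K0 : 0 < K by lra.
have L0 : 0 < L by lra.
have ncn (m : int) : nc (`|m|%:~R : R[i]) = A m by rewrite nc_int intr_norm normr_id.
have ncj : nc ((`|j|%:~R : R[i])^-1) = J^-1 by rewrite ncV ncn.
have a20 := ltW a2_gt0; have a10 := ltW a1_gt0; have ai : 0 <= a^-1 by rewrite invr_ge0 ltW.
have nK0 : 0 <= n * K by rewrite mulr_ge0// ltW.
have t1 : n * nc (2 * ik R l) <= 2 * L.
  rewrite ncM nc_ik (_ : nc 2 = 2); last by have := nc_real (2 : R); rewrite rmorph_nat ger0_norm.
  by rewrite ler_piMl// mulr_ge0// ltW.
have t2 : n * nc (`|k|%:~R * (s * (`|j|%:~R)^-1)) <= 2.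
  rewrite !ncM ncn ncj -/K.
  have [->|sn] := eqVneq s 0; first by rewrite nc0 !(mul0r, mulr0).
  have [kj _] := hs sn.
  have e : K * (nc s * J^-1) <= 2.
    by rewrite mulrA ler_pdivrMr// mulrC ler_pM// ltW.
  apply: le_trans e; rewrite ler_piMl// !mulr_ge0// ?invr_ge0; exact: ltW.
have t3 : n * nc ((beta%:C)%C * (`|k|%:~R * (s * (`|j|%:~R)^-1 * (`|l|%:~R * `|l|%:~R)))) <=
    2 * beta / a * (Num.min L (L * J / K)).
  rewrite !ncM nc_real ger0_norm// !ncn ncj -/K -/L.
  have [->|sn] := eqVneq s 0.
    rewrite nc0 !(mul0r, mulr0) mulr_ge0// ?le_min; first by rewrite !mulr_ge0.
    by rewrite ltW//= divr_ge0// ?mulr_ge0// ltW.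
  have [kj lj] := hs sn.
  have e1 : J^-1 * (L * L) <= L.
    by rewrite ler_pdivrMl// ler_wpM2r// ltW.
  have e2 : L <= L * J / K by rewrite ler_pdivlMr// ler_wpM2l// ltW.
  rewrite (min_idPl e2).
  have -> : n * (beta * (K * (nc s * J^-1 * (L * L)))) = beta * (n * K) * (nc s * (J^-1 * (L * L))) by ring.
  have -> : 2 * beta / a * L = beta * a^-1 * (2 * L) by ring.
  have q0 : 0 <= J^-1 * (L * L) by rewrite !mulr_ge0 ?invr_ge0// ltW.
  apply: ler_pM; [by rewrite mulr_ge0|by rewrite mulr_ge0|by apply: ler_wpM2l|].
  exact: ler_pM.
have t4 : n * nc ((a2%:C)%C * (`|k|%:~R * (s * ik R l))) <= 2 * a2 / a * L.
  rewrite 3!ncM nc_real (gtr0_norm a2_gt0) ncn nc_ik -/K -/L.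
  have -> : n * (a2 * (K * (nc s * L))) = a2 * (n * K) * (nc s * L) by ring.
  have -> : 2 * a2 / a * L = a2 * a^-1 * (2 * L) by ring.
  have L0' := ltW L0.
  apply: ler_pM; [by rewrite mulr_ge0|by rewrite mulr_ge0|by apply: ler_wpM2l|].
  by apply: ler_wpM2r.
have t5 : n * nc ((a2%:C)%C * (ik R k * ik R l)) <= a2 / a * L.
  rewrite 2!ncM nc_real (gtr0_norm a2_gt0) !nc_ik -/K -/L.
  have -> : n * (a2 * (K * L)) = a2 * (n * K) * L by ring.
  by apply: ler_wpM2r; [exact: ltW|apply: ler_wpM2l].
have t6 : n * nc ((a1%:C)%C * (`|k|%:~R * ((ik R k ^+ 2 - ik R l ^+ 2) * (`|j|%:~R)^-1))) <=
    a1 / a * (J + 2 * L).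
  have -> : ik R k ^+ 2 - ik R l ^+ 2 = - (((j + 2 * l) * j)%:~R).
    have -> : j + 2 * l = k + l by rewrite /l; ring.
    have -> : j = k - l by rewrite /l; ring.
    exact: ik_sqrB.
  rewrite !ncM nc_real (gtr0_norm a1_gt0) ncn ncj ncN nc_int -/K intrM normrM -/J.
  have -> : n * (a1 * (K * (`|(j + 2 * l)%:~R| * J / J))) = a1 * (n * K) * `|(j + 2 * l)%:~R|.
    by field; rewrite gt_eqF.
  apply: ler_pM; [by rewrite mulr_ge0|by []|by apply: ler_wpM2l|].
  rewrite intrD intrM (le_trans (ler_normD _ _))// normrM lerD2l.
  by rewrite (_ : `|2%:~R| = 2)// ger0_norm.
rewrite ncM -/n /msym -/l.
set T1 := 2 * ik R l in t1 *; set T2 := _ * (s * _) in t2 *; set T3 := (beta%:C)%C * _ in t3 *.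
set T4 := (a2%:C)%C * (_ * (_ * _)) in t4 *; set T5 := (a2%:C)%C * (ik R k * _) in t5 *; set T6 := (a1%:C)%C * _ in t6 *.
have tri : nc (T1 + T2 + T3 - T4 + T5 + T6) <= nc T1 + nc T2 + nc T3 + nc T4 + nc T5 + nc T6.
  apply: (le_trans (ncD _ _)); rewrite lerD2r; apply: (le_trans (ncD _ _)); rewrite lerD2r.
  apply: (le_trans (ncB _ _)); rewrite lerD2r; apply: (le_trans (ncD _ _)); rewrite lerD2r.
  exact: ncD.
apply: (le_trans (ler_wpM2l n0 tri)); rewrite !mulrDr.
have -> : 3 * a2 / a * L = 2 * a2 / a * L + a2 / a * L by field; rewrite gt_eqF.
lra.
Qed.

Definition bilC : R := 4 + 3 * a2 / a + 3 * a1 / a + 2 / a.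

Lemma bilC_gt0 : 0 < bilC.
Proof.
have h1 : 0 < 3 * a2 / a by apply: divr_gt0 => //; apply: mulr_gt0.
have h2 : 0 < 3 * a1 / a by apply: divr_gt0 => //; apply: mulr_gt0.
have h3 : 0 < 2 / a by apply: divr_gt0.
by rewrite /bilC; lra.
Qed.

(** The first bound is balanced by the dissipation uniformly in beta. The
    second puts a single derivative on one of the two factors, with a constant
    that depends on beta. *)
Lemma bil_le k j : k != 0 -> j != 0 -> k - j != 0 ->
  nc (bil beta a1 a2 k j) <= bilC * (1 + beta / A k) * (A j * A (k - j)) /\
  nc (bil beta a1 a2 k j) <= bilC * (1 + beta) * (A j + A (k - j)).
Proof.
move=> k0 j0 l0.
have hz := msym_bound k0 j0 l0.
have K1 := norm_int_ge1 R k0; have J1 := norm_int_ge1 R j0; have L1 := norm_int_ge1 R l0.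
rewrite /bil ncM ncN nc_real; set z := nc _ in hz *.
have zn : 0 <= z := nc_ge0 _.
have -> : `|2^-1| = 2^-1 :> R by rewrite ger0_norm// invr_ge0.
set K := A k in K1 hz *; set J := A j in J1 hz *; set L := A (k - j) in L1 hz *.
have [K0 J0 L0] : [/\ 0 < K, 0 < J & 0 < L] by split; lra.
have [K0' J0' L0'] : [/\ 0 <= K, 0 <= J & 0 <= L] by split; lra.
set m := Num.min _ _ in hz.
have m1 : m <= L by rewrite /m ge_min lexx.
have m2 : m <= L * J / K by rewrite /m ge_min lexx orbT.
have a0' := ltW a0; have a10 := ltW a1_gt0; have a20 := ltW a2_gt0.
have b0 : 0 <= 2 * beta / a by apply: divr_ge0 => //; apply: mulr_ge0.
have p1 : 0 <= 3 * a2 / a by apply: divr_ge0 => //; apply: mulr_ge0.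
have p2 : 0 <= a1 / a by apply: divr_ge0.
have p3 : 0 <= 2 / a by apply: divr_ge0.
have JL : J <= J * L /\ L <= J * L by split; [rewrite ler_pMr|rewrite ler_pMl].
have [JL1 JL2] := JL.
have bC : 4 + 3 * a2 / a + a1 / a * 3 + 2 / a = bilC by rewrite /bilC; ring.
split.
  have e1 : 2 * beta / a * m <= 2 * beta / a * (L * J / K) by rewrite ler_wpM2l.
  have e2 : 3 * a2 / a * L <= 3 * a2 / a * (J * L) by rewrite ler_wpM2l.
  have e3 : a1 / a * (J + 2 * L) <= a1 / a * (3 * (J * L)) by rewrite ler_wpM2l//; lra.
  have bK : 0 <= beta / K * (J * L) by apply: mulr_ge0; [exact: divr_ge0|exact: mulr_ge0].
  have e4 : bilC * (1 + beta / K) * (J * L) = bilC * (J * L) + bilC * (beta / K * (J * L)) by ring.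
  have e5 : 2 / a * (beta / K * (J * L)) <= bilC * (beta / K * (J * L)).
    by apply: ler_wpM2r => //; rewrite -bC; lra.
  have e6 : 2 * beta / a * (L * J / K) = 2 / a * (beta / K * (J * L)) by ring.
  have e7 : bilC * (J * L) = 4 * (J * L) + 3 * a2 / a * (J * L) + a1 / a * (3 * (J * L)) + 2 / a * (J * L).
    by rewrite -bC; ring.
  have e8 : 0 <= 2 / a * (J * L) by apply: mulr_ge0 => //; exact: mulr_ge0.
  rewrite e4 e7; lra.
have e1 : 2 * beta / a * m <= 2 * beta / a * (J + L) by rewrite ler_wpM2l//; lra.
have e2 : 3 * a2 / a * L <= 3 * a2 / a * (J + L) by rewrite ler_wpM2l//; lra.
have e3 : a1 / a * (J + 2 * L) <= a1 / a * (3 * (J + L)) by rewrite ler_wpM2l//; lra.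
have bJ : 0 <= beta * (J + L) by rewrite mulr_ge0//; lra.
have e4 : bilC * (1 + beta) * (J + L) = bilC * (J + L) + bilC * (beta * (J + L)) by ring.
have e5 : 2 / a * (beta * (J + L)) <= bilC * (beta * (J + L)).
  by apply: ler_wpM2r => //; rewrite -bC; lra.
have e6 : 2 * beta / a * (J + L) = 2 / a * (beta * (J + L)) by ring.
have e7 : bilC * (J + L) = 4 * (J + L) + 3 * a2 / a * (J + L) + a1 / a * (3 * (J + L)) + 2 / a * (J + L).
  by rewrite -bC; ring.
have e8 : 0 <= 2 / a * (J + L) by rewrite mulr_ge0//; lra.
rewrite e4 e7; lra.
Qed.
End SymbolBounds.

(** * Linear differential equations for a single Fourier mode *)

Section Antiderivatives.
Variable R : realType.

Lemma is_derive_derive1 (F : R -> R) (t d : R) : derivable F t (1 : R) ->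
  (F^`())%classic t = d -> is_derive t (1 : R) F d.
Proof. by move=> h <-; rewrite derive1E; exact: DeriveDef. Qed.

(** Starting the integral at -1 makes the antiderivative differentiable at
    time 0. *)
Lemma antiderivative (f : R -> R) : continuous f ->
  exists J : R -> R, forall t : R, -1 < t -> is_derive t (1 : R) J (f t).
Proof.
move=> cf; exists (fun x => \int[Leb R]_(t in `[-1, x]) f t) => t t1.
have tt1 : t < t + 1 by rewrite ltrDl.
have [d e] := continuous_FTC1_closed tt1 (rint_continuous _ _ cf) t1 (cf t).
exact: is_derive_derive1 d e.
Qed.

Lemma derivative_of_integral (f F : R -> R) (T : R) : continuous f ->
  (forall t, 0 <= t <= T -> F t = F 0 + \int[Leb R]_(s in `[0, t]) f s) ->
  forall t : R, 0 < t < T -> is_derive t (1 : R) F (f t).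
Proof.
move=> cf hF t /andP[t0 tT].
have tt1 : t < t + 1 by rewrite ltrDl.
have [d e] := continuous_FTC1_closed tt1 (rint_continuous _ _ cf) t0 (cf t).
have hd : is_derive t (1 : R) (fun x => F 0 + \int[Leb R]_(s in `[0, x]) f s) (f t).
  apply: (@dv_eq _ _ _ (0 + f t)); last by rewrite add0r.
  exact: (dv_add (dv_cst t (F 0)) (is_derive_derive1 d e)).
have hn : \near t, F 0 + \int[Leb R]_(s in `[0, t]) f s = F t.
  have [n1 n2] : (\near t, 0 < t) /\ (\near t, t < T) by split; [exact: lt_nbhsr|exact: lt_nbhsl].
  near=> x; have x0 : 0 < x by near: x.
  have xT : x < T by near: x.
  by rewrite -hF// !ltW.
by apply: near_eq_is_derive hd; exact: hn.
Unshelve. all: by end_near. Qed.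

Lemma nonincreasing_of_derivative (f df : R -> R) (T : R) : 0 <= T ->
  {within `[0, T], continuous f} ->
  (forall t : R, 0 < t < T -> is_derive t (1 : R) f (df t)) ->
  (forall t, 0 <= t <= T -> df t <= 0) -> f T <= f 0.
Proof.
move=> T0 cf hf hd.
have hf' (x : R) : x \in `]0, T[ -> is_derive x (1 : R) f (df x).
  by rewrite in_itv/=; exact: hf.
have [c cI e] := MVT_segment T0 hf' cf.
have : df c <= 0 by apply: hd; rewrite in_itv/= in cI.
by move=> dc; rewrite -subr_le0 e subr0 mulr_le0_ge0.
Qed.
End Antiderivatives.

Section ModeEquation.
Variable R : realType.
Implicit Types (l : R[i]) (F w : R -> R[i]).

(** The equation w' = l w + F on [0, T], in integrated form. *)
Definition mode_eq l F w (T : R) := forall t, 0 <= t <= T ->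
  w t - w 0 = cintegral `[0, t] (fun s => l * w s + F s).

Lemma mode_eq_derive l F w T : ccont w -> ccont F -> mode_eq l F w T ->
  forall t : R, 0 < t < T ->
    is_derive t (1 : R) (fun s => Re (w s)) (Re (l * w t + F t)) /\
    is_derive t (1 : R) (fun s => Im (w s)) (Im (l * w t + F t)).
Proof.
move=> cw cF h t tT; have [cr ci] := ccontD (ccontZ l cw) cF.
split.
  apply: (derivative_of_integral cr _ tT) => s /h /(congr1 (@complex.Re R)).
  by rewrite ReB /= => <-; rewrite subrKC.
apply: (derivative_of_integral ci _ tT) => s /h /(congr1 (@complex.Im R)).
by rewrite ImB /= => <-; rewrite subrKC.
Qed.

(** Duhamel's formula as an estimate: after rotating the phase so that w t is
    real and nonnegative, the real part of exp(- l s) w s grows no faster than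
    the integrated forcing. *)
Lemma mode_eq_bound l F w T G g : ccont w -> ccont F -> mode_eq l F w T ->
  (forall s, 0 <= s <= T -> nc (F s) <= G * expR (g * s)) -> 0 < g - Re l ->
  forall t, 0 <= t <= T ->
  nc (w t) <= expR (Re l * t) * nc (w 0) + G * expR (g * t) / (g - Re l).
Proof.
move=> cw cF hw hF gl t /andP[t0 tT].
set a := Re l in gl *; set b := Im l.
have G0 : 0 <= G.
  have := hF 0; rewrite lexx (le_trans t0 tT) mulr0 expR0 mulr1 => /(_ isT).
  exact/le_trans/nc_ge0.
pose x s := Re (w s); pose y s := Im (w s).
(* p and q are the cosine and sine of the phase that makes w t real and
   nonnegative at the final time t. *)
have [p [q [pq pqt]]] : exists p q : R, p ^+ 2 + q ^+ 2 = 1 /\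
  (p * cos (b * t) + q * sin (b * t)) * x t - (q * cos (b * t) - p * sin (b * t)) * y t = nc (w t).
  have [w0|w0] := eqVneq (nc (w t)) 0.
    exists 1, 0; split; first by ring.
    by move/nc_eq0: (w0); rewrite w0 /x /y => ->/=; ring.
  have n2 := nc_sqr (w t); rewrite -/(x t) -/(y t) in n2.
  set n := nc (w t) in w0 n2 *.
  pose P := x t / n; pose Q := - y t / n.
  have PQ : P ^+ 2 + Q ^+ 2 = 1.
    rewrite /P /Q !exprMn sqrrN -mulrDl -n2 exprVn mulfV// expf_neq0//.
  have cs := cos2Dsin2 (b * t).
  exists (P * cos (b * t) - Q * sin (b * t)), (P * sin (b * t) + Q * cos (b * t)); split.
    have -> : (P * cos (b * t) - Q * sin (b * t)) ^+ 2 + (P * sin (b * t) + Q * cos (b * t)) ^+ 2 =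
      (P ^+ 2 + Q ^+ 2) * (cos (b * t) ^+ 2 + sin (b * t) ^+ 2) by ring.
    by rewrite PQ cs mul1r.
  rewrite (_ : _ - _ = (P * x t - Q * y t) * (cos (b * t) ^+ 2 + sin (b * t) ^+ 2)); last by ring.
  rewrite cs mulr1 /P /Q.
  have -> : x t / n * x t - - y t / n * y t = (x t ^+ 2 + y t ^+ 2) / n by field.
  by rewrite -n2 expr2 mulfK.
pose P s := p * cos (b * s) + q * sin (b * s).
pose Q s := q * cos (b * s) - p * sin (b * s).
have PQ1 s : P s ^+ 2 + Q s ^+ 2 = 1.
  have -> : P s ^+ 2 + Q s ^+ 2 = (p ^+ 2 + q ^+ 2) * (cos (b * s) ^+ 2 + sin (b * s) ^+ 2).
    by rewrite /P /Q; ring.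
  by rewrite pq cos2Dsin2 mul1r.
have dcos s : is_derive s (1 : R) (fun s => cos (b * s)) (- b * sin (b * s)).
  apply: (@dv_eq _ _ _ (- sin (b * s) * b)); last by ring.
  by apply: (dv_comp (is_derive_cos _) (dv_linear _ _)).
have dsin s : is_derive s (1 : R) (fun s => sin (b * s)) (b * cos (b * s)).
  apply: (@dv_eq _ _ _ (cos (b * s) * b)); last by ring.
  by apply: (dv_comp (is_derive_sin _) (dv_linear _ _)).
have dP s : is_derive s (1 : R) P (b * Q s).
  apply: (@dv_eq _ _ _ (p * (- b * sin (b * s)) + q * (b * cos (b * s)))); last by rewrite /Q; ring.
have dQ s : is_derive s (1 : R) Q (- b * P s).
  apply: (@dv_eq _ _ _ (q * (- b * sin (b * s)) + - (p * (b * cos (b * s))))); last by rewrite /P; ring.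
have dexp k s : is_derive s (1 : R) (fun s => expR (k * s)) (k * expR (k * s)).
  apply: (@dv_eq _ _ _ (expR (k * s) * k)); last by ring.
  by apply: (dv_comp (is_derive_expR _) (dv_linear _ _)).
pose f s := expR (- a * s) * (P s * x s - Q s * y s) - G / (g - a) * expR ((g - a) * s).
pose df s := expR (- a * s) * (P s * Re (F s) - Q s * Im (F s)) - G * expR ((g - a) * s).
have hT s : 0 < s < t -> 0 < s < T by move=> /andP[-> st]; rewrite (lt_le_trans st).
have der s : 0 < s < t -> is_derive s (1 : R) f (df s).
  move=> /hT sT; have [dx dy] := mode_eq_derive cw cF hw sT.
  apply: (@dv_eq _ _ _ (expR (- a * s) *
     ((P s * Re (l * w s + F s) + x s * (b * Q s)) + - (Q s * Im (l * w s + F s) + y s * (- b * P s)))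
     + (P s * x s - Q s * y s) * (- a * expR (- a * s)) + - (G / (g - a) * ((g - a) * expR ((g - a) * s))))).
    have d1 := dv_add (dv_mul (dP s) dx) (dv_opp (dv_mul (dQ s) dy)).
    exact: (dv_add (dv_mul (dexp (- a) s) d1) (dv_opp (dv_scale (G / (g - a)) (dexp (g - a) s)))).
  rewrite /df !(ReD, ImD, ReM, ImM) -/a -/b -/(x s) -/(y s).
  have -> : G / (g - a) * ((g - a) * expR ((g - a) * s)) = G * expR ((g - a) * s).
    by rewrite mulrA divfK// gt_eqF.
  ring.
have ccos (h : R -> R) : (forall s, exists d, is_derive s (1 : R) h d) -> continuous h.
  move=> hh s; have [d [ds _]] := hh s.
  by apply: differentiable_continuous; exact/derivable1_diffP.
have [cx cy] := cw.
have cf : continuous f.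
  have ce k : continuous (fun s : R => expR (k * s)) by apply: ccos => s; exists (k * expR (k * s)).
  have cP : continuous P by apply: ccos => s; exists (b * Q s).
  have cQ : continuous Q by apply: ccos => s; exists (- b * P s).
  move=> s; apply: cvgB; last by apply: cvgM; [exact: cvg_cst|exact: ce].
  apply: cvgM; first exact: ce.
  by apply: cvgB; apply: cvgM; by [exact: cP|exact: cQ|exact: cx|exact: cy].
have dfle s : 0 <= s <= t -> df s <= 0.
  move=> /andP[s0 st]; rewrite /df subr_le0.
  have -> : (g - a) * s = - a * s + g * s by ring.
  rewrite expRD mulrCA; apply: ler_wpM2l; first exact: expR_ge0.
  apply: le_trans (hF s _); last by rewrite s0 (le_trans st tT).
  rewrite -[leRHS]ger0_norm ?nc_ge0// -[leRHS]sqrtr_sqr nc_sqr.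
  apply: le_trans (ler_norm _) _; rewrite -sqrtr_sqr ler_wsqrtr//.
  have := PQ1 s; set u := Re (F s); set v := Im (F s) => h1.
  rewrite -subr_ge0 (_ : _ - _ = (P s * v + Q s * u) ^+ 2 + (1 - (P s ^+ 2 + Q s ^+ 2)) * (u ^+ 2 + v ^+ 2)); last by ring.
  by rewrite h1 subrr mul0r addr0 sqr_ge0.
have := nonincreasing_of_derivative t0 (continuous_subspaceT cf) der dfle.
have ft : f t = expR (- a * t) * nc (w t) - G / (g - a) * expR ((g - a) * t).
  by rewrite /f -/(x t) -/(y t) pqt.
have f0 : f 0 <= nc (w 0).
  rewrite /f !mulr0 expR0 mul1r mulr1 lerBlDr.
  apply: (@le_trans _ _ (nc (w 0))); last by rewrite lerDl divr_ge0// ltW.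
  rewrite -[leRHS]ger0_norm ?nc_ge0// -[leRHS]sqrtr_sqr nc_sqr.
  apply: le_trans (ler_norm _) _; rewrite -sqrtr_sqr ler_wsqrtr//.
  have := PQ1 0; rewrite -/(x 0) -/(y 0); set u := x 0; set v := y 0 => h1.
  rewrite -subr_ge0 (_ : _ - _ = (P 0 * v + Q 0 * u) ^+ 2 + (1 - (P 0 ^+ 2 + Q 0 ^+ 2)) * (u ^+ 2 + v ^+ 2)); last by ring.
  by rewrite h1 subrr mul0r addr0 sqr_ge0.
rewrite ft => /le_trans /(_ f0); rewrite lerBlDr => H.
have e1 : expR (a * t) * expR (- a * t) = 1 by rewrite -expRD mulNr subrr expR0.
have e2 : expR (a * t) * expR ((g - a) * t) = expR (g * t) by rewrite -expRD; congr expR; ring.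
have := ler_wpM2l (expR_ge0 (a * t)) H.
rewrite mulrA e1 mul1r mulrDr => /le_trans; apply; rewrite lerD2l.
by rewrite mulrCA e2 mulrAC.
Qed.

(** Variation of constants, written out in real and imaginary parts; the
    solution is extended by its initial value to negative times, so that it is
    continuous on the whole line. *)
Lemma mode_eq_exists l F (w0 : R[i]) : ccont F -> exists w,
  [/\ ccont w, forall t, t <= 0 -> w t = w0 & forall T, mode_eq l F w T].
Proof.
move=> cF; set a := Re l; set b := Im l.
pose u s := Re (F s); pose v s := Im (F s).
have [cu cv] : continuous u /\ continuous v := cF.
have dcos s : is_derive s (1 : R) (fun s => cos (b * s)) (- b * sin (b * s)).
  apply: (@dv_eq _ _ _ (- sin (b * s) * b)); last by ring.
  by apply: (dv_comp (is_derive_cos _) (dv_linear _ _)).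
have dsin s : is_derive s (1 : R) (fun s => sin (b * s)) (b * cos (b * s)).
  apply: (@dv_eq _ _ _ (cos (b * s) * b)); last by ring.
  by apply: (dv_comp (is_derive_sin _) (dv_linear _ _)).
have dexp k s : is_derive s (1 : R) (fun s => expR (k * s)) (k * expR (k * s)).
  apply: (@dv_eq _ _ _ (expR (k * s) * k)); last by ring.
  by apply: (dv_comp (is_derive_expR _) (dv_linear _ _)).
have dcont (h : R -> R) (s d : R) : is_derive s (1 : R) h d -> h @ s --> h s.
  by move=> [ds _]; apply: differentiable_continuous; exact/derivable1_diffP.
pose E s := expR (- a * s).
have cE : continuous E by move=> s; exact: (dcont _ _ _ (dexp (- a) s)).
have cC : continuous (fun s => cos (b * s)) by move=> s; exact: (dcont _ _ _ (dcos s)).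
have cS : continuous (fun s => sin (b * s)) by move=> s; exact: (dcont _ _ _ (dsin s)).
pose G1 s := E s * (cos (b * s) * u s + sin (b * s) * v s).
pose G2 s := E s * (cos (b * s) * v s - sin (b * s) * u s).
have cG1 : continuous G1.
  move=> s; apply: cvgM; first exact: cE.
  by apply: cvgD; apply: cvgM; by [exact: cC|exact: cS|exact: cu|exact: cv].
have cG2 : continuous G2.
  move=> s; apply: cvgM; first exact: cE.
  by apply: cvgB; apply: cvgM; by [exact: cC|exact: cS|exact: cu|exact: cv].
have [J1 dJ1] := antiderivative cG1; have [J2 dJ2] := antiderivative cG2.
pose X t := expR (a * t) * (cos (b * t) * (J1 t + (Re w0 - J1 0)) - sin (b * t) * (J2 t + (Im w0 - J2 0))).
pose Y t := expR (a * t) * (sin (b * t) * (J1 t + (Re w0 - J1 0)) + cos (b * t) * (J2 t + (Im w0 - J2 0))).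
have EE t : expR (a * t) * E t = 1 by rewrite /E -expRD mulNr subrr expR0.
have dI1 (t : R) : -1 < t -> is_derive t (1 : R) (fun t => J1 t + (Re w0 - J1 0)) (G1 t).
  move=> t1; apply: (@dv_eq _ _ _ (G1 t + 0)); last by rewrite addr0.
  exact: (dv_add (dJ1 t t1) (dv_cst t _)).
have dI2 (t : R) : -1 < t -> is_derive t (1 : R) (fun t => J2 t + (Im w0 - J2 0)) (G2 t).
  move=> t1; apply: (@dv_eq _ _ _ (G2 t + 0)); last by rewrite addr0.
  exact: (dv_add (dJ2 t t1) (dv_cst t _)).
have dX (t : R) : -1 < t -> is_derive t (1 : R) X (a * X t - b * Y t + u t).
  move=> t1; have d1 := dI1 t t1; have d2 := dI2 t t1.
  have h := dv_mul (dexp a t) (dv_add (dv_mul (dcos t) d1) (dv_opp (dv_mul (dsin t) d2))).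
  apply: (dv_eq h); rewrite /X /Y /G1 /G2 [in X in _ = X](_ : u t =
     (expR (a * t) * E t) * (cos (b * t) ^+ 2 + sin (b * t) ^+ 2) * u t); last first.
    by rewrite EE cos2Dsin2 !mul1r.
  ring.
have dY (t : R) : -1 < t -> is_derive t (1 : R) Y (b * X t + a * Y t + v t).
  move=> t1; have d1 := dI1 t t1; have d2 := dI2 t t1.
  have h := dv_mul (dexp a t) (dv_add (dv_mul (dsin t) d1) (dv_mul (dcos t) d2)).
  apply: (dv_eq h); rewrite /X /Y /G1 /G2 [in X in _ = X](_ : v t =
     (expR (a * t) * E t) * (cos (b * t) ^+ 2 + sin (b * t) ^+ 2) * v t); last first.
    by rewrite EE cos2Dsin2 !mul1r.
  ring.
pose w t := Complex (X (Num.max 0 t)) (Y (Num.max 0 t)).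
have m1 t : -1 < Num.max 0 t :> R by rewrite lt_max ltrN10.
have cmax : continuous (fun t : R => Num.max 0 t).
  by move=> t; apply: continuous_max; [exact: cvg_cst|exact: cvg_id].
have cw : ccont w.
  split=> t /=.
    exact: (continuous_comp (cmax t) (dcont _ _ _ (dX _ (m1 t)))).
  exact: (continuous_comp (cmax t) (dcont _ _ _ (dY _ (m1 t)))).
exists w; split=> // [t t0|T t /andP[t0 tT]].
  rewrite /w (max_idPl t0) /X /Y !mulr0 expR0 cos0 sin0.
  by apply: complex_eq => /=; ring.
have [cr ci] := ccontD (ccontZ l cw) cF.
have wE s : 0 <= s -> w s = Complex (X s) (Y s) by move=> s0; rewrite /w (max_idPr s0).
have s1 (s : R) : 0 <= s -> -1 < s by move=> s0; apply: lt_le_trans s0; exact: ltrN10.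
have dX' (s : R) : 0 <= s <= t -> is_derive s (1 : R) X (Re (l * w s + F s)).
  move=> /andP[s0 _]; apply: (dv_eq (dX s (s1 s s0))).
  by rewrite ReD ReM wE.
have dY' (s : R) : 0 <= s <= t -> is_derive s (1 : R) Y (Im (l * w s + F s)).
  move=> /andP[s0 _]; apply: (dv_eq (dY s (s1 s s0))).
  by rewrite ImD ImM wE//=; ring.
rewrite !wE//; apply: complex_eq; rewrite ?ReB ?ImB /=.
  by rewrite (Rintegral_derivative t0 cr dX').
by rewrite (Rintegral_derivative t0 ci dY').
Qed.

Lemma mode_eq_conj l F w T : ccont F -> ccont w -> mode_eq l F w T ->
  mode_eq ((l^*)%C) (fun t => ((F t)^*)%C) (fun t => ((w t)^*)%C) T.
Proof.
move=> cF cw h t tT; have [cr ci] := ccontD (ccontZ l cw) cF.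
have := congr1 (@conjc R) (h t tT).
rewrite conjD conjN => ->; apply: complex_eq => /=.
  by apply: eq_Rintegral => s _; rewrite -conjM -conjD; case: (_ + _).
rewrite -mulN1r -RintegralZl//; last exact: rint_continuous.
by apply: eq_Rintegral => s _; rewrite -conjM -conjD mulN1r; case: (_ + _).
Qed.

Lemma mode_eqB l F F' w w' T : ccont F -> ccont F' -> ccont w -> ccont w' ->
  mode_eq l F w T -> mode_eq l F' w' T ->
  mode_eq l (fun t => F t - F' t) (fun t => w t - w' t) T.
Proof.
move=> cF cF' cw cw' h h' t tT.
rewrite (_ : _ - _ = (w t - w 0) - (w' t - w' 0)); last by ring.
rewrite h// h'// -cintegralB//; try exact: ccont_cintegrable (ccontD (ccontZ _ _) _).
by apply: eq_cintegral => s _; ring.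
Qed.
End ModeEquation.

(** * The bilinear term *)

Section WeightedSequences.
Variable R : realType.
Implicit Types (U V : int -> R) (K L : R).
Local Notation A k := (`|(k%:~R : R)|).

Lemma norm_int0 : A 0 = 0. Proof. exact: normr0. Qed.

(** Square summability of k U k, the homogeneous Sobolev norm of order one. *)
Definition h1_le U K := 0 <= K /\ sum_le (fun k => (A k * U k) ^+ 2) (K ^+ 2).

Lemma h1_le_mono U V K : (forall k, 0 <= U k <= V k) -> h1_le V K -> h1_le U K.
Proof.
move=> UV [K0 hV]; split => //; apply: le_sum_le hV => k.
have /andP[u0 uv] := UV k.
by rewrite ler_pXn2r ?nnegrE ?mulr_ge0// ?ler_wpM2l// (le_trans u0).
Qed.

Lemma h1_leW U K L : K <= L -> h1_le U K -> h1_le U L.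
Proof.
move=> KL [K0 h]; split; first exact: le_trans KL.
by apply: sum_leW h; rewrite ler_pXn2r ?nnegrE// (le_trans K0).
Qed.

Lemma h1_leZ U K (r : R) : 0 <= r -> h1_le U K -> h1_le (fun k => r * U k) (r * K).
Proof.
move=> r0 [K0 h]; split; first exact: mulr_ge0.
rewrite exprMn; apply: le_sum_le (sum_leZ (sqr_ge0 r) h) => k.
by rewrite mulrCA exprMn.
Qed.

Lemma h1_leD U V K L : h1_le U K -> h1_le V L -> h1_le (fun k => U k + V k) (2 * (K + L)).
Proof.
move=> [K0 hU] [L0 hV]; split; first by rewrite mulr_ge0// addr_ge0.
have h2 : 0 <= 2 :> R by [].
apply: (@sum_leW _ _ (2 * K ^+ 2 + 2 * L ^+ 2)).
  by rewrite exprMn sqrrD; have := mulr_ge0 K0 L0; have := sqr_ge0 K; have := sqr_ge0 L; lra.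
apply: le_sum_le (sum_leD (sum_leZ h2 hU) (sum_leZ h2 hV)) => k.
by rewrite mulrDr; have := sqr_ge0 (A k * U k - A k * V k); rewrite sqrrB sqrrD; lra.
Qed.

Lemma h1_le_inv_sqr (r : R) : 0 <= r -> h1_le (fun k => r * (A k ^+ 2)^-1) (2 * r).
Proof.
move=> r0; rewrite mulrC; apply: h1_leZ => //; split=> //.
rewrite (_ : 2 ^+ 2 = 4); last by ring.
apply: le_sum_le (sum_le_inv_sqr R) => k.
rewrite real_normK ?num_real//; have [->|k0] := eqVneq k 0.
  by rewrite normr0 mul0r !expr0n/= invr0.
have kR : (k%:~R : R) != 0 by rewrite intr_eq0.
rewrite exprMn real_normK ?num_real// exprVn expr2 invfM mulrA mulfV ?mul1r//.
by rewrite sqrf_eq0.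
Qed.

Lemma sum_le_inv : sum_le (fun j => ((A j)^-1) ^+ 2) (2 ^+ 2).
Proof.
rewrite (_ : 2 ^+ 2 = 4); last by ring.
by apply: le_sum_le (sum_le_inv_sqr R) => k; rewrite exprVn real_normK ?num_real.
Qed.
End WeightedSequences.

Section Bilinear.
Variables (R : realType) (bil : int -> int -> R[i]) (beta C0 C1 : R).
Local Notation A k := (`|(k%:~R : R)|).
Hypotheses (beta0 : 0 <= beta) (C0_gt0 : 0 < C0) (C1_ge0 : 0 <= C1).
Hypothesis bil1 : forall k j, k != 0 -> j != 0 -> k - j != 0 ->
  nc (bil k j) <= C0 * (1 + beta / A k) * (A j * A (k - j)).
Hypothesis bil2 : forall k j, k != 0 -> j != 0 -> k - j != 0 ->
  nc (bil k j) <= C1 * (A j + A (k - j)).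
Implicit Types (x y : int -> R[i]).

(** The nonlinear terms of the equation have no mean, by antisymmetry; setting
    the mode at 0 apart spares all bounds on the symbol there. *)
Definition Bk x y k := if k == 0 then 0 else zsum (fun j => bil k j * (x j * y (k - j))).

Definition amp k := C0 * (1 + beta / A k).

Lemma amp_ge0 k : 0 <= amp k.
Proof. by rewrite mulr_ge0 ?ltW// ltr_wpDr// divr_ge0. Qed.

Lemma bil_term x y k j (u v : R) : k != 0 -> x 0 = 0 -> y 0 = 0 ->
  nc (x j) <= u -> nc (y (k - j)) <= v ->
  nc (bil k j * (x j * y (k - j))) <= amp k * ((A j * u) * (A (k - j) * v)).
Proof.
move=> k0 x0 y0 xu yv.
have u0 : 0 <= u := le_trans (nc_ge0 _) xu.
have v0 : 0 <= v := le_trans (nc_ge0 _) yv.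
have pos : 0 <= amp k * ((A j * u) * (A (k - j) * v)).
  by rewrite mulr_ge0 ?amp_ge0// mulr_ge0// mulr_ge0.
have [j0|j0] := eqVneq j 0; first by rewrite j0 x0 mul0r mulr0 nc0 -j0.
have [l0|l0] := eqVneq (k - j) 0; first by rewrite l0 y0 !mulr0 nc0 -l0.
rewrite !ncM (_ : amp k * _ = amp k * (A j * A (k - j)) * (u * v)); last by ring.
apply: ler_pM; rewrite ?nc_ge0 ?mulr_ge0 ?nc_ge0//; first exact: bil1.
by apply: ler_pM; rewrite ?nc_ge0.
Qed.

(** The symbol puts one derivative on each factor, and Cauchy-Schwarz does the
    rest. *)
Lemma Bk_sum_le x y (U V : int -> R) X Y k : k != 0 -> x 0 = 0 -> y 0 = 0 ->
  (forall j, nc (x j) <= U j) -> (forall j, nc (y j) <= V j) ->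
  h1_le U X -> h1_le V Y ->
  sum_le (fun j => amp k * ((A j * U j) * (A (k - j) * V (k - j)))) (amp k * (X * Y)).
Proof.
move=> k0 x0 y0 xU yV [X0 hU] [Y0 hV].
apply: sum_leZ; first exact: amp_ge0.
have := sum_le_cauchy_schwarz X0 Y0 hU (sum_le_refl k hV).
apply: le_sum_le => j; rewrite ler_pM// ?ler_norm//.
  by rewrite mulr_ge0// (le_trans (nc_ge0 _) (xU j)).
by rewrite mulr_ge0// (le_trans (nc_ge0 _) (yV _)).
Qed.

Lemma Bk_summ x y X Y k : k != 0 -> x 0 = 0 -> y 0 = 0 ->
  h1_le (fun k => nc (x k)) X -> h1_le (fun k => nc (y k)) Y ->
  sum_le (fun j => nc (bil k j * (x j * y (k - j)))) (amp k * (X * Y)).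
Proof.
move=> k0 x0 y0 hx hy.
have := @Bk_sum_le x y (fun k => nc (x k)) (fun k => nc (y k)) X Y k k0 x0 y0 (fun=> lexx _) (fun=> lexx _) hx hy.
by apply: le_sum_le => j; apply: bil_term.
Qed.

Lemma Bk_le x y X Y k : x 0 = 0 -> y 0 = 0 ->
  h1_le (fun k => nc (x k)) X -> h1_le (fun k => nc (y k)) Y ->
  nc (Bk x y k) <= amp k * (X * Y).
Proof.
move=> x0 y0 hx hy; rewrite /Bk; case: eqP => [_|/eqP k0].
  by rewrite nc0 mulr_ge0 ?amp_ge0// mulr_ge0//; [case: hx|case: hy].
by apply: zsum_le; exact: Bk_summ.
Qed.

Lemma Bk_diff x y x' y' X Y k : x 0 = 0 -> y 0 = 0 -> x' 0 = 0 -> y' 0 = 0 ->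
  h1_le (fun k => nc (x k)) X -> h1_le (fun k => nc (y k)) Y ->
  h1_le (fun k => nc (x' k)) X -> h1_le (fun k => nc (y' k)) Y ->
  Bk x y k - Bk x' y' k =
  Bk (fun j => x j - x' j) y k + Bk x' (fun j => y j - y' j) k.
Proof.
move=> x0 y0 x'0 y'0 hx hy hx' hy'; rewrite /Bk; case: eqP => [_|/eqP k0].
  by rewrite subrr addr0.
have s z w Z W : z 0 = 0 -> w 0 = 0 -> h1_le (fun k => nc (z k)) Z -> h1_le (fun k => nc (w k)) W ->
    summ (fun j => bil k j * (z j * w (k - j))).
  by move=> z0 w0 hz hw; exists (amp k * (Z * W)); exact: Bk_summ.
have sxy := s x y X Y x0 y0 hx hy; have sx'y := s x' y X Y x'0 y0 hx' hy.
have sx'y' := s x' y' X Y x'0 y'0 hx' hy'.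
have sN F : summ F -> summ (fun j => - F j).
  by move=> /(summZ (-1)); under eq_fun do rewrite mulN1r.
rewrite (_ : (fun j => bil k j * ((x j - x' j) * y (k - j))) =
  (fun j => bil k j * (x j * y (k - j)) - bil k j * (x' j * y (k - j)))); last first.
  by apply/funext => j; ring.
rewrite (_ : (fun j => bil k j * (x' j * (y (k - j) - y' (k - j)))) =
  (fun j => bil k j * (x' j * y (k - j)) - bil k j * (x' j * y' (k - j)))); last first.
  by apply/funext => j; ring.
by rewrite !zsumB// addrA subrK.
Qed.

Lemma Bk_conj x : (forall k j, bil (- k) (- j) = ((bil k j)^*)%C) ->
  (forall k, x (- k) = ((x k)^*)%C) -> forall k X, x 0 = 0 -> h1_le (fun k => nc (x k)) X ->
  Bk x x (- k) = ((Bk x x k)^*)%C.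
Proof.
move=> bN xN k X x0 hx; rewrite /Bk oppr_eq0; case: eqP => [_|/eqP k0].
  by rewrite [RHS](rmorph0 (@conjc R)).
rewrite -zsum_conj; last by exists (amp k * (X * X)); exact: Bk_summ.
rewrite -zsum_opp; congr zsum; apply/funext => j.
have -> : - k - - j = - (k - j) by ring.
by rewrite bN !xN -!conjM.
Qed.

(** In the norm sup |k| |x k| the bilinear term loses no power of k; this
    weaker norm is the one in which two solutions are compared. *)
Lemma Bk_weak_le x y W Y k : 0 <= W -> x 0 = 0 -> y 0 = 0 ->
  (forall j, A j * nc (x j) <= W) -> h1_le (fun k => nc (y k)) Y ->
  nc (Bk x y k) <= 4 * C1 * (W * Y) /\ nc (Bk y x k) <= 4 * C1 * (W * Y).
Proof.
move=> W0 x0 y0 hx [Y0 hy].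
have pos : 0 <= 4 * C1 * (W * Y) by rewrite !mulr_ge0.
rewrite /Bk; case: eqP => [_|/eqP k0]; first by rewrite nc0.
have two : 0 <= 2 :> R by [].
have hi := sum_le_inv R.
have s1 := sum_le_cauchy_schwarz two Y0 hi hy.
have s2 := sum_le_cauchy_schwarz two Y0 hi (sum_le_refl k hy).
have s3 := sum_le_cauchy_schwarz two Y0 (sum_le_refl k hi) hy.
have key j l : j != 0 -> l != 0 -> (A j + A l) * (nc (x j) * nc (y l)) <=
   W * ((A l)^-1 * (A l * nc (y l)) + (A j)^-1 * (A l * nc (y l))).
  move=> j0 l0; have J1 := norm_int_ge1 R j0; have L1 := norm_int_ge1 R l0.
  have J0 : A j != 0 by rewrite gt_eqF// (lt_le_trans ltr01).
  have L0 : A l != 0 by rewrite gt_eqF// (lt_le_trans ltr01).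
  rewrite (_ : _ * _ = (A j * nc (x j)) * ((A l)^-1 * (A l * nc (y l)) + (A j)^-1 * (A l * nc (y l)))); last first.
    by field; rewrite J0 L0.
  by apply: ler_wpM2r (hx j); rewrite addr_ge0// mulr_ge0 ?invr_ge0// mulr_ge0 ?nc_ge0.
have pj j l : 0 <= W * ((A l)^-1 * (A l * nc (y l)) + (A j)^-1 * (A l * nc (y l))).
  by rewrite mulr_ge0// addr_ge0// mulr_ge0 ?invr_ge0// mulr_ge0 ?nc_ge0.
have nn (z : R) (m : int) : 0 <= z -> A m * z = `|A m * z| by move=> z0; rewrite [RHS]ger0_norm// mulr_ge0.
have ni (m : int) : (A m)^-1 = `|(A m)^-1| by rewrite [RHS]ger0_norm// invr_ge0.
have bound : 4 * C1 * (W * Y) = C1 * (W * (2 * Y + 2 * Y)) by ring.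
split; apply: zsum_le.
  rewrite bound.
  apply: le_sum_le (sum_leZ C1_ge0 (sum_leZ W0 (sum_leD (sum_le_refl k s1) s2))) => j.
  rewrite -!ni -!(nn _ _ (nc_ge0 _)).
  have [j0|j0] := eqVneq j 0; first by rewrite j0 x0 mul0r mulr0 nc0 mulr_ge0.
  have [l0|l0] := eqVneq (k - j) 0; first by rewrite l0 y0 nc0 !(mulr0, addr0) nc0.
  rewrite !ncM; apply: le_trans (ler_wpM2l C1_ge0 (key _ _ j0 l0)).
  by rewrite [leRHS]mulrA; apply: ler_wpM2r; [rewrite mulr_ge0 ?nc_ge0|exact: bil2].
rewrite bound.
apply: le_sum_le (sum_leZ C1_ge0 (sum_leZ W0 (sum_leD s1 s3))) => j.
rewrite -!ni -!(nn _ _ (nc_ge0 _)).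
have [j0|j0] := eqVneq j 0; first by rewrite j0 y0 nc0 !(mul0r, mulr0, addr0) nc0.
have [l0|l0] := eqVneq (k - j) 0; first by rewrite l0 x0 !mulr0 nc0 mulr_ge0.
rewrite !ncM; apply: le_trans (ler_wpM2l C1_ge0 (key _ _ l0 j0)).
rewrite [leRHS]mulrA [nc (y j) * _]mulrC [A (k - j) + _]addrC.
by apply: ler_wpM2r; [rewrite mulr_ge0 ?nc_ge0|exact: bil2].
Qed.
End Bilinear.

(** * Global small solutions by Picard iteration *)

Section Picard.
Variables (R : realType) (lam : int -> R[i]) (bil : int -> int -> R[i]) (beta C0 c : R).
Local Notation A k := (`|(k%:~R : R)|).
Hypotheses (beta0 : 0 <= beta) (C0_gt0 : 0 < C0) (c_gt0 : 0 < c).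
Hypothesis lam_re : forall k, k != 0 -> Re (lam k) <= - (c * (A k ^+ 2 + beta * A k)).
Hypothesis lamN : forall k, lam (- k) = ((lam k)^*)%C.
Hypothesis bil1 : forall k j, k != 0 -> j != 0 -> k - j != 0 ->
  nc (bil k j) <= C0 * (1 + beta / A k) * (A j * A (k - j)).
Hypothesis bilN : forall k j, bil (- k) (- j) = ((bil k j)^*)%C.

Local Notation B := (Bk bil).
Local Notation amp := (amp beta C0).

Variable u0 : int -> R[i].
Hypothesis u00 : u0 0 = 0.
Hypothesis u0N : forall k, u0 (- k) = ((u0 k)^*)%C.

(** The size allowed to the data and to the nonlinear part of the solution;
    the numerical factor is what makes the iteration contract by one half. *)
Let eta := c / (8 * (8 * (8 * C0))).
Hypothesis u0_small : h1_le (fun k => nc (u0 k)) eta.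

Let eta0 : 0 < eta. Proof. by rewrite divr_gt0// !mulr_gt0. Qed.

(** Half of the linear decay rate: the other half pays for the forcing. *)
Definition rho (t : R) := expR (- (c / 2) * Num.max 0 t).

Lemma rho_ge0 t : 0 <= rho t. Proof. exact: expR_ge0. Qed.

Lemma rho_le1 t : rho t <= 1.
Proof. by rewrite -expR0 ler_expR mulNr oppr_le0 mulr_ge0 ?divr_ge0 ?le_max ?lexx// ltW. Qed.

(** The data, and a tail of order 1 / k ^ 2 for what the forcing produces. *)
Definition maj k := nc (u0 k) + eta * (A k ^+ 2)^-1.

Lemma maj_ge0 k : 0 <= maj k.
Proof. by rewrite addr_ge0 ?nc_ge0// mulr_ge0 ?invr_ge0 ?sqr_ge0// ltW. Qed.

Let K := 6 * eta.

Lemma maj_h1 : h1_le maj K.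
Proof.
have := h1_leD u0_small (h1_le_inv_sqr (ltW eta0)).
by rewrite (_ : 2 * (eta + 2 * eta) = K)// /K; ring.
Qed.

(** The bilinear term is of size 1 + beta / |k|, the dissipation of size
    k ^ 2 (1 + beta / |k|): the quotient 1 / k ^ 2 does not see the surface
    tension. *)
Lemma mode_damped k F w (G : R) : k != 0 -> ccont w -> ccont F ->
  (forall T, mode_eq (lam k) F w T) -> 0 <= G ->
  (forall s, 0 <= s -> nc (F s) <= amp k * G * rho s) ->
  forall t, 0 <= t -> nc (w t) <= rho t * (nc (w 0) + 2 * C0 * G / c * (A k ^+ 2)^-1).
Proof.
move=> k0 cw cF hw G0 hF t t0.
have K1 := norm_int_ge1 R k0; have lk := lam_re k0; set d := A k in K1 lk *.
have d0 : 0 < d by rewrite (lt_le_trans ltr01).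
have bd : 0 <= beta * d by rewrite mulr_ge0// ltW.
have d2 : 1 <= d ^+ 2 by rewrite expr_ge1// ltW.
have rate : c / 2 * (d ^+ 2 + beta * d) <= - (c / 2) - Re (lam k).
  have : c / 2 * 1 <= c / 2 * (d ^+ 2 + beta * d) by rewrite ler_wpM2l ?divr_ge0 ?(ltW c_gt0)//; lra.
  by move: lk; lra.
have q0 : 0 < d ^+ 2 + beta * d by lra.
have pos : 0 < - (c / 2) - Re (lam k).
  by apply: lt_le_trans rate; rewrite mulr_gt0// divr_gt0.
have hF' s : 0 <= s <= t -> nc (F s) <= amp k * G * expR (- (c / 2) * s).
  by move=> /andP[s0 _]; have := hF s s0; rewrite /rho (max_idPr s0).
have := mode_eq_bound cw cF (hw t) hF' pos (t := t); rewrite t0 lexx => /(_ isT).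
move=> /le_trans; apply; rewrite /rho (max_idPr t0) mulrDr.
set e := expR (- (c / 2) * t); have e0 : 0 <= e by exact: expR_ge0.
apply: lerD.
  apply: ler_wpM2r; first exact: nc_ge0.
  by rewrite ler_expR; apply: ler_wpM2r => //; lra.
rewrite ler_pdivrMr//.
apply: (@le_trans _ _ (e * (2 * C0 * G / c * (d ^+ 2)^-1) * (c / 2 * (d ^+ 2 + beta * d)))); last first.
  apply: ler_wpM2l => //; rewrite mulr_ge0// mulr_ge0 ?invr_ge0 ?sqr_ge0// divr_ge0 ?(ltW c_gt0)//.
  by rewrite mulr_ge0// mulr_ge0// ltW.
rewrite le_eqVlt; apply/orP; left; apply/eqP; rewrite /amp -/d.
by field; rewrite !gt_eqF.
Qed.

(** Each mode is solved for with the nonlinearity frozen at u. *)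
Definition step (u : int -> R -> R[i]) (k : int) : R -> R[i] :=
  if k == 0 then fun=> 0 else
  xget (fun=> 0) [set w | [/\ ccont w, forall t, t <= 0 -> w t = u0 k
    & forall T, mode_eq (lam k) (fun t => B (u^~ t) (u^~ t) k) w T]].

(** The class of functions that the iteration preserves; the data are
    continued to negative times to keep continuity on the whole line. *)
Definition good (u : int -> R -> R[i]) :=
  [/\ forall k, ccont (u k), forall t, u 0 t = 0,
      forall k t, t <= 0 -> u k t = u0 k,
      forall k t, u (- k) t = ((u k t)^*)%C
    & forall k t, nc (u k t) <= rho t * maj k].

Lemma good_h1 u t : good u -> h1_le (fun k => nc (u k t)) (rho t * K).
Proof.
move=> [_ _ _ _ h]; apply: h1_le_mono (h1_leZ (rho_ge0 t) maj_h1) => k.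
by rewrite nc_ge0 h.
Qed.

Lemma good_h1K u t : good u -> h1_le (fun k => nc (u k t)) K.
Proof.
move=> gu; apply: h1_leW (good_h1 t gu).
by rewrite ler_piMl ?rho_le1//; rewrite mulr_ge0// ltW.
Qed.

Lemma good_ccont u k : good u -> ccont (fun t => B (u^~ t) (u^~ t) k).
Proof.
move=> gu; have [cu u_0 _ _ hu] := gu; rewrite /Bk.
case: eqP => [_|/eqP k0]; first exact: ccont_cst.
have hm (t : R) j : nc (u j t) <= maj j.
  by apply: (le_trans (hu j t)); rewrite ler_piMl ?maj_ge0 ?rho_le1.
have m0 : maj 0 = 0 by rewrite /maj u00 nc0 norm_int0 expr0n/= invr0 mulr0 addr0.
have x0 : (fun k => (maj k)%:C%C : R[i]) 0 = 0 by rewrite /= m0.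
have nm k' : nc ((maj k')%:C%C : R[i]) <= maj k' by rewrite nc_real ger0_norm ?maj_ge0.
have := Bk_sum_le beta0 C0_gt0 k0 x0 x0 nm nm maj_h1 maj_h1.
move=> hs; apply: (ccont_zsum _ hs) => [j|t j|j].
- by rewrite mulr_ge0 ?amp_ge0// mulr_ge0// mulr_ge0 ?maj_ge0.
- exact: (@bil_term R bil beta C0 beta0 C0_gt0 bil1 (u^~ t) (u^~ t) k j (maj j) (maj (k - j)) k0 (u_0 t) (u_0 t) (hm t j) (hm t (k - j))).
- by apply: ccontZ; apply: ccontM.
Qed.

Lemma stepP u k : good u -> k != 0 -> [/\ ccont (step u k),
   forall t, t <= 0 -> step u k t = u0 k
   & forall T, mode_eq (lam k) (fun t => B (u^~ t) (u^~ t) k) (step u k) T].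
Proof.
move=> gu k0; rewrite /step (negbTE k0).
have [w hw] := mode_eq_exists (lam k) (u0 k) (good_ccont k gu).
by case: xgetP => [w' -> //|/(_ w)].
Qed.

Lemma B_diff_le u v e k t : 0 <= e -> good u -> good v ->
  (forall j, nc (u j t - v j t) <= rho t * e * maj j) ->
  nc (B (u^~ t) (u^~ t) k - B (v^~ t) (v^~ t) k) <= amp k * (2 * e * K ^+ 2) * rho t.
Proof.
move=> e0 gu gv huv; have [_ u_0 _ _ _] := gu; have [_ v_0 _ _ _] := gv.
have hd : h1_le (fun j => nc (u j t - v j t)) (rho t * e * K).
  apply: h1_le_mono (h1_leZ _ maj_h1) => [j|]; first by rewrite nc_ge0 huv.
  by rewrite mulr_ge0// rho_ge0.
have d0 : u 0 t - v 0 t = 0 by rewrite u_0 v_0 subrr.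
have hu := good_h1K t gu; have hv := good_h1K t gv.
rewrite (Bk_diff beta0 C0_gt0 bil1 k (u_0 t) (u_0 t) (v_0 t) (v_0 t) hu hu hv hv).
apply: (le_trans (ncD _ _)).
have h1 := Bk_le beta0 C0_gt0 bil1 k d0 (u_0 t) hd hu.
have h2 := Bk_le beta0 C0_gt0 bil1 k (v_0 t) d0 hv hd.
apply: (le_trans (lerD h1 h2)); rewrite le_eqVlt; apply/orP; left; apply/eqP; ring.
Qed.

Lemma step_init u k : good u -> forall t, t <= 0 -> step u k t = u0 k.
Proof.
move=> gu t t0; have [->|k0] := eqVneq k 0; first by rewrite /step eqxx u00.
by have [_ -> //] := stepP gu k0.
Qed.

Lemma K_small : 4 * C0 * K ^+ 2 / c <= eta / 2.
Proof.
(* 512 = 8 ^ 3 and 144 = 4 * 6 ^ 2. *)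
rewrite /K /eta (_ : 4 * C0 * _ / c = 144 / 512 * (c / (8 * (8 * (8 * C0))))); last first.
  by field; rewrite !gt_eqF.
by have := eta0; rewrite /eta => h; lra.
Qed.

(** The bilinear term is quadratic, so that differences of iterates carry an
    extra factor of size eta: the iteration contracts by one half. *)
Lemma step_diff_le u v e k t : 0 <= e -> good u -> good v ->
  (forall j t, nc (u j t - v j t) <= rho t * e * maj j) ->
  nc (step u k t - step v k t) <= rho t * (e / 2) * maj k.
Proof.
move=> e0 gu gv huv.
have pos : 0 <= rho t * (e / 2) * maj k.
  by rewrite mulr_ge0 ?maj_ge0// mulr_ge0 ?rho_ge0// divr_ge0.
have [k0|k0] := eqVneq k 0; first by rewrite {1 2}/step k0 eqxx subrr nc0 -k0.
have [t0|t0] := leP t 0; first by rewrite !step_init// subrr nc0.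
have [cu iu mu] := stepP gu k0; have [cv iv mv] := stepP gv k0.
have cB w : good w -> ccont (fun t => B (w^~ t) (w^~ t) k) by exact: good_ccont.
have hG : 0 <= 2 * e * K ^+ 2 by rewrite mulr_ge0 ?sqr_ge0// mulr_ge0.
have := mode_damped k0 (ccontB cu cv) (ccontB (cB u gu) (cB v gv))
  (fun T => mode_eqB (cB u gu) (cB v gv) cu cv (mu T) (mv T)) hG
  (fun s _ => B_diff_le k e0 gu gv (fun j => huv j s)) (ltW t0).
move=> /le_trans; apply; rewrite (iu 0 (lexx 0)) (iv 0 (lexx 0)) subrr nc0 add0r -[leRHS]mulrA.
apply: ler_wpM2l; first exact: rho_ge0.
have A0 : 0 <= (A k ^+ 2)^-1 by rewrite invr_ge0 sqr_ge0.
rewrite (_ : 2 * C0 * (2 * e * K ^+ 2) / c = e * (4 * C0 * K ^+ 2 / c)); last by ring.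
apply: (@le_trans _ _ (e * (eta / 2) * (A k ^+ 2)^-1)).
  by apply: ler_wpM2r => //; apply: ler_wpM2l => //; exact: K_small.
rewrite (_ : e * (eta / 2) * _ = e / 2 * (eta * (A k ^+ 2)^-1)); last by ring.
by apply: ler_wpM2l; rewrite ?divr_ge0// /maj lerDr nc_ge0.
Qed.

Lemma step_good u : good u -> good (step u).
Proof.
move=> gu; have [cu u_0 iu Nu hu] := gu.
have step0 t : step u 0 t = 0 by rewrite /step eqxx.
have cs k : ccont (step u k).
  have [->|k0] := eqVneq k 0; last by have [] := stepP gu k0.
  by rewrite /step eqxx; exact: ccont_cst.
split=> // [k t|k t|k t]; first exact: step_init.
- have [->|k0] := eqVneq k 0; first by rewrite oppr0 step0 [RHS](rmorph0 (@conjc R)).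
  have [t0|t0] := leP t 0; first by rewrite !step_init.
  have kN0 : - k != 0 by rewrite oppr_eq0.
  have [c1 i1 m1] := stepP gu kN0; have [c2 i2 m2] := stepP gu k0.
  have cB := good_ccont k gu; have cBN := good_ccont (- k) gu.
  have m3 T := mode_eq_conj cB c2 (m2 T); rewrite -lamN in m3.
  apply/eqP; rewrite -subr_eq0; apply/eqP/nc_eq0/le_anti; rewrite nc_ge0 andbT.
  have hz s : 0 <= s -> nc (B (u^~ s) (u^~ s) (- k) - ((B (u^~ s) (u^~ s) k)^*)%C) <= amp (- k) * 0 * rho s.
    move=> _; rewrite (Bk_conj beta0 C0_gt0 bil1 bilN (fun k => Nu k s) k (u_0 s) (good_h1K s gu)).
    by rewrite subrr nc0 mulr0 mul0r.
  have := mode_damped kN0 (ccontB c1 (ccont_conj c2)) (ccontB cBN (ccont_conj cB))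
    (fun T => mode_eqB cBN (ccont_conj cB) c1 (ccont_conj c2) (m1 T) (m3 T)) (lexx 0) hz (ltW t0).
  by rewrite (i1 0 (lexx 0)) (i2 0 (lexx 0)) u0N subrr nc0 add0r mulr0 !mul0r mulr0.
- have [t0|t0] := leP t 0.
    rewrite step_init// /rho (max_idPl t0) mulr0 expR0 mul1r /maj lerDl.
    by rewrite mulr_ge0 ?invr_ge0 ?sqr_ge0// ltW.
  have [->|k0] := eqVneq k 0; first by rewrite step0 nc0 mulr_ge0 ?rho_ge0 ?maj_ge0.
  have [cw iw mw] := stepP gu k0.
  have K0 : 0 <= K by rewrite mulr_ge0// ltW.
  have hF s : 0 <= s -> nc (B (u^~ s) (u^~ s) k) <= amp k * K ^+ 2 * rho s.
    move=> _; have hs := good_h1 s gu; have hsK := good_h1K s gu.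
    apply: le_trans (Bk_le beta0 C0_gt0 bil1 k (u_0 s) (u_0 s) hs hsK) _.
    rewrite le_eqVlt; apply/orP; left; apply/eqP; ring.
  have := mode_damped k0 cw (good_ccont k gu) mw (sqr_ge0 K) hF (ltW t0).
  move=> /le_trans; apply; rewrite (iw 0 (lexx 0)); apply: ler_wpM2l; first exact: rho_ge0.
  rewrite /maj lerD2l; apply: ler_wpM2r; first by rewrite invr_ge0 sqr_ge0.
  have := K_small; rewrite (_ : 4 * C0 * _ / c = 2 * (2 * C0 * K ^+ 2 / c)); last by ring.
  by have := eta0; lra.
Qed.

Lemma rho_continuous : continuous rho.
Proof.
have -> : rho = expR \o (fun t => - (c / 2) * Num.max 0 t) by [].
move=> t; apply: continuous_comp; last exact: continuous_expR.
apply: cvgM; first exact: cvg_cst.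
by apply: continuous_max; [exact: cvg_cst|exact: cvg_id].
Qed.

Lemma good_init : good (fun k t => ((rho t)%:C)%C * u0 k).
Proof.
have h k t : nc (((rho t)%:C)%C * u0 k) <= rho t * maj k.
  rewrite ncM nc_real ger0_norm ?rho_ge0// ler_wpM2l ?rho_ge0// /maj lerDl.
  by rewrite mulr_ge0 ?invr_ge0 ?sqr_ge0// ltW.
split=> // [k|t|k t t0|k t].
- apply: ccontM; last exact: ccont_cst.
  by split=> t /=; [exact: rho_continuous|exact: cvg_cst].
- by rewrite u00 mulr0.
- by rewrite /rho (max_idPl t0) mulr0 expR0 mul1r.
- by rewrite u0N conjM conjc_real.
Qed.

(** The limit u is a fixed point because step u and u are limits of the same
    iterates, by contraction; no integral has to be passed to the limit. *)
Theorem picard : exists2 u, good u &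
  forall k T, k != 0 -> mode_eq (lam k) (fun t => B (u^~ t) (u^~ t) k) (u k) T.
Proof.
pose U n := iter n step (fun k t => ((rho t)%:C)%C * u0 k).
have gU n : good (U n) by elim: n => [|n IH]; [exact: good_init|exact: step_good].
have e0 n : 0 <= 2 / 2 ^+ n :> R by rewrite divr_ge0// exprn_ge0.
have dU n : forall k t, nc (U n.+1 k t - U n k t) <= rho t * (2 / 2 ^+ n) * maj k.
  elim: n => [|n IH] k t.
    have [_ _ _ _ h1] := gU 1; have [_ _ _ _ h0] := gU 0.
    apply: (le_trans (ncB _ _)); apply: (le_trans (lerD (h1 k t) (h0 k t))).
    by rewrite expr0 divr1 le_eqVlt; apply/orP; left; apply/eqP; ring.
  have := step_diff_le k t (e0 n) (gU n.+1) (gU n) IH.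
  by rewrite (_ : 2 / 2 ^+ n.+1 = 2 / 2 ^+ n / 2)// exprS; field; rewrite expf_neq0.
have lim k t : exists l, forall n, nc (U n k t - l) <= rho t * (4 / 2 ^+ n) * maj k.
  have [n|l hl] := @ccvg_geometric R (fun n => U n k t) (2 * rho t * maj k).
    by have := dU n k t; rewrite (_ : rho t * _ * _ = 2 * rho t * maj k / 2 ^+ n); last ring.
  exists l => n; have := hl n.
  by rewrite (_ : rho t * _ * _ = 2 * (2 * rho t * maj k) / 2 ^+ n); last ring.
have /choice[u hu] k : exists w, forall t n, nc (U n k t - w t) <= rho t * (4 / 2 ^+ n) * maj k.
  by have /choice[w hw] := lim k; exists w.
have g0 := @cvg_half_pow R.
have hu' k t n : nc (U n k t - u k t) <= 4 * maj k / 2 ^+ n.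
  apply: le_trans (hu k t n) _; rewrite -mulrA; apply: (@le_trans _ _ (1 * (4 / 2 ^+ n * maj k))).
    by apply: ler_wpM2r (rho_le1 t); rewrite mulr_ge0 ?maj_ge0// divr_ge0// exprn_ge0.
  by rewrite le_eqVlt; apply/orP; left; apply/eqP; ring.
have cv k t : ccvg (fun n => U n k t) (u k t) by apply: ccvg_le (g0 (4 * maj k)) => n; exact: hu'.
have gu : good u.
  split=> [k|t|k t t0|k t|k t].
  - apply: (@ccont_uniform_limit _ (fun n => U n k) _ (fun n => 4 * maj k / 2 ^+ n)) => [n|n t|]; last exact: g0.
      by have [] := gU n.
    by rewrite ncC.
  - apply: (ccvg_unique (cv 0 t)); rewrite (_ : (fun n => _) = fun=> 0); first exact: ccvg_cst.
    by apply/funext => n; have [_ ->] := gU n.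
  - apply: (ccvg_unique (cv k t)); rewrite (_ : (fun n => _) = fun=> u0 k); first exact: ccvg_cst.
    by apply/funext => n; have [_ _ ->] := gU n.
  - apply: (ccvg_unique (cv (- k) t)).
    rewrite (_ : (fun n => _) = fun n => ((U n k t)^*)%C); first exact: ccvg_conj.
    by apply/funext => n; have [_ _ _ ->] := gU n.
  - by apply: (ccvg_nc_le (cv k t)) => n; have [_ _ _ _] := gU n; apply.
exists u => // k T k0; have [_ _ mw] := stepP gu k0.
suff -> : u k = step u k by exact: mw.
apply/funext => t; apply: (@ccvg_unique _ (fun n => U n.+1 k t)).
  by have := cv k t; rewrite /ccvg -cvg_shiftS.
apply: ccvg_le (g0 (2 * maj k)) => n.
have e4 : 0 <= 4 / 2 ^+ n :> R by rewrite divr_ge0// exprn_ge0.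
have := step_diff_le k t e4 (gU n) gu (fun j t => hu j t n).
move=> /le_trans; apply.
apply: (@le_trans _ _ (1 * (2 / 2 ^+ n * maj k))); last by rewrite le_eqVlt; apply/orP; left; apply/eqP; ring.
rewrite (_ : _ / 2 = 2 / 2 ^+ n); last by field; rewrite expf_neq0.
rewrite -mulrA; apply: ler_wpM2r (rho_le1 t).
by rewrite mulr_ge0 ?maj_ge0// divr_ge0// exprn_ge0.
Qed.
End Picard.

(** * Sums over the frequencies depending on time *)

Section IntegralOfSums.
Variable R : realType.
Implicit Types (a : int -> R) (K : R).

Lemma psum_nondecreasing a : (forall j, 0 <= a j) ->
  {homo psum a : m n / (m <= n)%N >-> m <= n}.
Proof.
move=> a0; apply/nondecreasing_seqP => n.
by rewrite psumS addrA lerDr addr_ge0.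
Qed.

Lemma psum_ge0 a n : (forall j, 0 <= a j) -> 0 <= psum a n.
Proof. by move=> a0; rewrite /psum sumr_ge0. Qed.

Lemma sum_le_lim a K : (forall j, 0 <= a j) -> sum_le a K -> sum_le a (limn (psum a)).
Proof.
move=> a0 h; apply: sum_leP => // n; apply: nondecreasing_cvgn_le.
  exact: psum_nondecreasing.
exact: sum_le_psum_cvg h.
Qed.

Lemma esum_psum a : (forall j, 0 <= a j) ->
  (psum a n)%:E @[n --> \oo] --> (\esum_(k in [set: int]) (a k)%:E)%E.
Proof.
move=> a0.
have nd : nondecreasing_seq (fun n => (psum a n)%:E).
  by move=> m n mn; rewrite lee_fin psum_nondecreasing.
have := ereal_nondecreasing_cvgn nd.
rewrite (_ : ereal_sup _ = \esum_(k in [set: int]) (a k)%:E)%E//.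
apply/eqP; rewrite eq_le; apply/andP; split.
  apply: ge_ereal_sup => _ [n _ <-]; rewrite /psum -sumEFin.
  apply: esum_ge; exists [set` zrange n]; first by split => //; exact: finite_seq.
  by rewrite fsbig_seq// uniq_zrange.
apply: ge_ereal_sup => _ [A [fA _] <-].
rewrite fsbig_finite//= sumEFin; have [n An] := sub_zrange (finmap.enum_fset (fset_set A)).
apply: (@le_trans _ _ (psum a n)%:E); last by apply: ereal_sup_ubound; exists n.
by rewrite lee_fin; apply: sum_sub_le An => //; [exact: finmap.fset_uniq|exact: uniq_zrange].
Qed.

Lemma esum_measurable (D : set R) (a : R -> int -> R) : meas D ->
  (forall t k, 0 <= a t k) -> (forall k, mfun D (a ^~ k)) ->
  mfun D (fun t => \esum_(k in [set: int]) (a t k)%:E)%E.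
Proof.
move=> mD a0 ma; apply: (@emeasurable_fun_cvg _ _ _ _ (fun n t => (psum (a t) n)%:E)) => [n|t _].
  by apply/measurable_EFinP; rewrite /psum; apply: measurable_sum => k.
exact: esum_psum.
Qed.

(** Monotone convergence along the symmetric partial sums. *)
Lemma integral_esum_le (D : set R) (a : R -> int -> R) (b : int -> R) K : meas D ->
  (forall t k, 0 <= a t k) -> (forall k, mfun D (a ^~ k)) ->
  (forall k, (\int[Leb R]_(t in D) (a t k)%:E <= (b k)%:E)%E) -> sum_le b K ->
  (\int[Leb R]_(t in D) (\esum_(k in [set: int]) (a t k)%:E) <= K%:E)%E.
Proof.
move=> mD a0 ma hb bK.
have mp n : mfun D (fun t => (psum (a t) n)%:E).
  by apply/measurable_EFinP; rewrite /psum; apply: measurable_sum => k.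
have p0 n t : (0 <= (psum (a t) n)%:E)%E by rewrite lee_fin psum_ge0.
have nd t : nondecreasing_seq (fun n => (psum (a t) n)%:E).
  by move=> m n mn; rewrite lee_fin psum_nondecreasing.
under eq_integral do rewrite -(cvg_lim _ (esum_psum (a0 _)))//.
rewrite monotone_convergence//.
apply: lime_le.
  apply: ereal_nondecreasing_is_cvgn => m n mn.
  apply: ge0_le_integral => //; last by move=> t _; exact: nd.
  - exact: mp.
  - exact: mp.
apply: nearW => n; rewrite /psum.
under eq_integral do rewrite -sumEFin.
have me k : mfun D (fun t => (a t k)%:E) by apply/measurable_EFinP.
have e0 k t : D t -> (0 <= (a t k)%:E)%E by rewrite lee_fin.
rewrite (@ge0_integral_sum _ (measurableTypeR R) R (Leb R) D mD _ (fun k t => (a t k)%:E) me e0).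
apply: (@le_trans _ _ (\sum_(k <- zrange n) (b k)%:E)%E); first by apply: lee_sum.
by rewrite sumEFin lee_fin; apply: bK; exact: uniq_zrange.
Qed.

Lemma continuous_expRM (k : R) : continuous (fun s : R => expR (k * s)).
Proof.
move=> s; apply: (@continuous_comp _ _ _ (fun s => k * s) (@expR R)); last exact: continuous_expR.
by apply: cvgM; [exact: cvg_cst|exact: cvg_id].
Qed.

Lemma integral_expR (r : R) : 0 < r ->
  integral (Leb R) `[0, +oo[ (fun t => (expR (- r * t))%:E) = (r^-1)%:E.
Proof.
move=> r0.
have dexp s : is_derive s (1 : R) (fun s => - r^-1 * expR (- r * s)) (expR (- r * s)).
  apply: (@dv_eq _ _ _ (- r^-1 * (expR (- r * s) * - r))).
    exact: (dv_scale _ (dv_comp (is_derive_expR _) (dv_linear _ _))).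
  by field; rewrite gt_eqF.
have ce := continuous_expRM.
rewrite (@ge0_continuous_FTC2y _ _ (fun s => - r^-1 * expR (- r * s)) _ 0)//.
- by rewrite mulr0 expR0 mulr1 -EFinB sub0r opprK.
- exact: continuous_subspaceT.
- rewrite -[X in _ --> X](mulr0 (- r^-1)); apply: cvgM; first exact: cvg_cst.
  rewrite (_ : (fun x => expR (- r * x)) = (fun z => expR (- z)) \o (fun z => r * z)); last first.
    by apply: eq_fun => x; rewrite mulNr.
  apply: (@cvg_comp _ _ _ _ _ _ (pinfty_nbhs R)); last exact: cvgr_expR.
  exact: gt0_cvgMry.
- apply/cvg_at_right_filter; apply: cvgM; first exact: cvg_cst.
  exact: ce.
- by move=> x _; rewrite derive1E; have [_ d] := dexp x.
Qed.
End IntegralOfSums.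

(** * Gain of one derivative *)

Section BilinearSquareSummable.
Variables (R : realType) (bil : int -> int -> R[i]) (C1 : R).
Local Notation A k := (`|(k%:~R : R)|).
Hypothesis C1_ge0 : 0 <= C1.
Hypothesis bil2 : forall k j, k != 0 -> j != 0 -> k - j != 0 ->
  nc (bil k j) <= C1 * (A j + A (k - j)).

(** The convolution of summable families is summable; its terms are limits of
    partial sums. *)
Lemma sum_le_convolution (p q : int -> R) (P Q : R) : (forall j, 0 <= p j) -> (forall j, 0 <= q j) ->
  sum_le p P -> sum_le q Q ->
  (forall k, sum_le (fun j => p j * q (k - j)) (P * Q)) /\
  sum_le (fun k => limn (psum (fun j => p j * q (k - j)))) (P * Q).
Proof.
move=> p0 q0 hp hq.
have Q0 := sum_le_ge0 hq.
have row k : sum_le (fun j => p j * q (k - j)) (P * Q).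
  move=> s us; apply: (@le_trans _ _ (\sum_(j <- s) Q * p j)).
    by apply: ler_sum => j _; rewrite mulrC; apply: ler_wpM2r => //; exact: sum_le_term hq.
  by rewrite -mulr_sumr mulrC; apply: ler_wpM2r => //; exact: hp.
split=> // s us.
have cv k : cvgn (psum (fun j => p j * q (k - j))).
  by apply: sum_le_psum_cvg (row k) => j; exact: mulr_ge0.
have : (fun n => \sum_(k <- s) psum (fun j => p j * q (k - j)) n) @ \oo -->
    \sum_(k <- s) limn (psum (fun j => p j * q (k - j))).
  elim: (s) => [|k t IH].
    under eq_fun do rewrite big_nil.
    by rewrite big_nil; exact: cvg_cst.
  under eq_fun do rewrite big_cons.
  by rewrite big_cons; apply: cvgD => //; exact: cv.
move=> h; rewrite -(cvg_lim _ h)//; apply: limr_le; first by apply/cvg_ex; eexists; exact: h.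
apply: nearW => n; rewrite /psum exchange_big/=.
apply: (@le_trans _ _ (\sum_(j <- zrange n) p j * Q)).
  apply: ler_sum => j _; rewrite -mulr_sumr; apply: ler_wpM2l => //.
  exact: (sum_le_shift j hq us).
by rewrite -mulr_suml; apply: ler_wpM2r => //; apply: hp; exact: uniq_zrange.
Qed.

(** The second bound on the symbol leaves the weights 1 / |j| + 1 / |k - j|,
    which are square summable; by Cauchy-Schwarz the bilinear term is then
    bounded by the square root of a convolution of summable families. *)
Lemma Bk_l2 (maj : int -> R) K : (forall k, 0 <= maj k) -> h1_le maj K ->
  exists G : int -> R, [/\ forall k, 0 <= G k, sum_le (fun k => G k ^+ 2) ((4 * C1 * K ^+ 2) ^+ 2) &
   forall (x : int -> R[i]) r, x 0 = 0 -> 0 <= r -> (forall k, nc (x k) <= r * maj k) ->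
     forall k, nc (Bk bil x x k) <= r ^+ 2 * G k].
Proof.
move=> m0 [K0 hm].
pose P j := (A j * maj j) ^+ 2.
have P0 j : 0 <= P j by exact: sqr_ge0.
have [row col] := sum_le_convolution P0 P0 hm hm.
pose H k := limn (psum (fun j => P j * P (k - j))).
have PP0 k j : 0 <= P j * P (k - j) by exact: mulr_ge0.
have hH k : sum_le (fun j => P j * P (k - j)) (H k) by exact: sum_le_lim (PP0 k) (row k).
have H0 k : 0 <= H k := sum_le_ge0 (hH k).
exists (fun k => C1 * (4 * Num.sqrt (H k))); split=> [k||x r x0 r0 hx k].
- by rewrite mulr_ge0// mulr_ge0// sqrtr_ge0.
- rewrite (_ : (4 * C1 * K ^+ 2) ^+ 2 = (4 * C1) ^+ 2 * (K ^+ 2 * K ^+ 2)); last by ring.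
  apply: le_sum_le (sum_leZ (sqr_ge0 (4 * C1)) col) => k.
  by rewrite -/(H k) mulrCA mulrA !exprMn sqr_sqrtr.
have pos : 0 <= r ^+ 2 * (C1 * (4 * Num.sqrt (H k))).
  by rewrite mulr_ge0 ?sqr_ge0// mulr_ge0// mulr_ge0// sqrtr_ge0.
rewrite /Bk; case: eqP => [_|/eqP k0]; first by rewrite nc0.
pose p j := (A j)^-1 + (A (k - j))^-1.
have hp : sum_le (fun j => p j ^+ 2) (4 ^+ 2).
  have hi := sum_le_inv R.
  have two : 0 <= 2 :> R by [].
  rewrite (_ : 4 ^+ 2 = 2 * 2 ^+ 2 + 2 * 2 ^+ 2 :> R); last by ring.
  apply: le_sum_le (sum_leD (sum_leZ two hi) (sum_leZ two (sum_le_refl k hi))) => j.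
  by have := sqr_ge0 ((A j)^-1 - (A (k - j))^-1); rewrite /p sqrrB sqrrD; lra.
pose q j := (A j * maj j) * (A (k - j) * maj (k - j)).
have hq : sum_le (fun j => q j ^+ 2) (Num.sqrt (H k) ^+ 2).
  by rewrite sqr_sqrtr//; apply: le_sum_le (hH k) => j; rewrite /q exprMn.
have four : 0 <= 4 :> R by [].
have hpq := sum_le_cauchy_schwarz four (sqrtr_ge0 _) hp hq.
apply: zsum_le; apply: le_sum_le (sum_leZ (sqr_ge0 r) (sum_leZ C1_ge0 hpq)) => j.
have p0 : 0 <= p j by rewrite addr_ge0// invr_ge0.
have q0 : 0 <= q j by rewrite mulr_ge0// mulr_ge0.
rewrite (ger0_norm p0) (ger0_norm q0).
have pos' : 0 <= r ^+ 2 * (C1 * (p j * q j)) by rewrite mulr_ge0 ?sqr_ge0// mulr_ge0// mulr_ge0.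
have [j0|j0] := eqVneq j 0; first by rewrite j0 x0 mul0r mulr0 nc0 -j0.
have [l0|l0] := eqVneq (k - j) 0; first by rewrite l0 x0 !mulr0 nc0.
have J1 := norm_int_ge1 R j0; have L1 := norm_int_ge1 R l0.
have J0 : A j != 0 by rewrite gt_eqF// (lt_le_trans ltr01).
have L0 : A (k - j) != 0 by rewrite gt_eqF// (lt_le_trans ltr01).
rewrite !ncM (_ : r ^+ 2 * _ = C1 * (A j + A (k - j)) * ((r * maj j) * (r * maj (k - j)))); last first.
  by rewrite /p /q; field; rewrite J0 L0.
apply: ler_pM; [exact: nc_ge0|by rewrite mulr_ge0 ?nc_ge0|exact: bil2|].
by apply: ler_pM; rewrite ?nc_ge0.
Qed.
End BilinearSquareSummable.

Section Smoothing.
Variables (R : realType) (lam : int -> R[i]) (bil : int -> int -> R[i]) (beta C1 c : R).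
Local Notation A k := (`|(k%:~R : R)|).
Hypotheses (beta0 : 0 <= beta) (C1_ge0 : 0 <= C1) (c_gt0 : 0 < c).
Hypothesis lam_re : forall k, k != 0 -> Re (lam k) <= - (c * (A k ^+ 2 + beta * A k)).
Hypothesis bil2 : forall k j, k != 0 -> j != 0 -> k - j != 0 ->
  nc (bil k j) <= C1 * (A j + A (k - j)).
Variables (maj : int -> R) (K : R) (u : int -> R -> R[i]).
Hypotheses (maj0 : forall k, 0 <= maj k) (maj_h1 : h1_le maj K).
Hypothesis cu : forall k, ccont (u k).
Hypothesis cB : forall k, ccont (fun t => Bk bil (u^~ t) (u^~ t) k).
Hypothesis u_0 : forall t, u 0 t = 0.
Hypothesis u_maj : forall k t, nc (u k t) <= rho c t * maj k.
Hypothesis u_eq : forall k T, k != 0 -> mode_eq (lam k) (fun t => Bk bil (u^~ t) (u^~ t) k) (u k) T.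

Lemma rhoE t : 0 <= t -> rho c t = expR (- (c / 2) * t).
Proof. by move=> t0; rewrite /rho (max_idPr t0). Qed.

(** In Duhamel's formula the forcing is divided by the dissipation rate, which
    is of size k ^ 2: two derivatives are gained on the nonlinear part. *)
Lemma parabolic_gain : exists Y : int -> R, exists2 M : R, sum_le (fun k => Y k ^+ 2) M &
  forall k t, 0 <= t ->
    A k ^+ 2 * nc (u k t) <= A k ^+ 2 * expR (- (c * A k ^+ 2) * t) * maj k + rho c t * Y k.
Proof.
have [G [G0 hG hB]] := Bk_l2 C1_ge0 bil2 maj0 maj_h1.
have c2 : 0 <= 2 / c by rewrite divr_ge0// ltW.
exists (fun k => 2 / c * G k), ((2 / c) ^+ 2 * ((4 * C1 * K ^+ 2) ^+ 2)).
  by apply: le_sum_le (sum_leZ (sqr_ge0 (2 / c)) hG) => k; rewrite exprMn.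
move=> k t t0; have [->|k0] := eqVneq k 0.
  by rewrite norm_int0 expr0n/= !mul0r add0r mulr_ge0 ?rho_ge0// mulr_ge0.
have K1 := norm_int_ge1 R k0; have lk := lam_re k0; set d := A k in K1 lk *.
have d0 : 0 < d by rewrite (lt_le_trans ltr01).
have bd : 0 <= c * (beta * d) by rewrite mulr_ge0 ?(ltW c_gt0)// mulr_ge0// ltW.
have d2 : 1 <= d ^+ 2 by rewrite expr_ge1// ltW.
have cd : c <= c * d ^+ 2 by rewrite ler_peMr// ltW.
have lk' : Re (lam k) <= - (c * d ^+ 2) by move: lk; rewrite mulrDr; lra.
have rate : c / 2 * d ^+ 2 <= - (c / 2) - Re (lam k) by lra.
have pos : 0 < - (c / 2) - Re (lam k).
  by apply: lt_le_trans rate; rewrite mulr_gt0 ?divr_gt0// exprn_gt0.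
have hF s : 0 <= s <= t -> nc (Bk bil (u^~ s) (u^~ s) k) <= G k * expR (- (c / 2) * s).
  move=> /andP[s0 _]; rewrite -rhoE// mulrC.
  apply: (@le_trans _ _ (rho c s ^+ 2 * G k)); first exact: hB (u_0 s) (rho_ge0 c s) _ _.
  by apply: ler_wpM2r => //; rewrite expr2 ler_piMr ?rho_ge0// rho_le1.
have := mode_eq_bound (cu k) (cB k) (@u_eq k t k0) hF pos (t := t); rewrite t0 lexx => /(_ isT) h.
have h0 : nc (u k 0) <= maj k.
  by have := u_maj k 0; rewrite rhoE// mulr0 expR0 mul1r.
have d20 : 0 <= d ^+ 2 by exact: sqr_ge0.
apply: (le_trans (ler_wpM2l d20 h)); rewrite mulrDr; apply: lerD.
  rewrite mulrA; apply: ler_pM; [|exact: nc_ge0| |exact: h0].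
    by apply: mulr_ge0 => //; exact: expR_ge0.
  by apply: ler_wpM2l => //; rewrite ler_expR; apply: ler_wpM2r.
rewrite -rhoE// mulrA ler_pdivrMr//.
apply: (@le_trans _ _ (rho c t * (2 / c * G k) * (c / 2 * d ^+ 2))).
  by rewrite le_eqVlt; apply/orP; left; apply/eqP; field; rewrite gt_eqF.
by apply: ler_wpM2l rate; rewrite mulr_ge0 ?rho_ge0// mulr_ge0.
Qed.

Lemma h2_weight (x y z : R) (k : int) : k != 0 -> 0 <= x -> 0 <= y -> A k ^+ 2 * x <= y + z ->
  (1 + k%:~R ^+ 2) ^+ 2 * x ^+ 2 <= 8 * y ^+ 2 + 8 * z ^+ 2.
Proof.
move=> k0 x0 y0 h; rewrite -[k%:~R ^+ 2]real_normK ?num_real//.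
have K1 := norm_int_ge1 R k0.
have d2 : 1 <= A k ^+ 2 by rewrite expr_ge1.
set d := A k ^+ 2 in h d2 *.
have dx : 0 <= d * x by rewrite mulr_ge0// (le_trans ler01).
apply: (@le_trans _ _ (4 * (d * x) ^+ 2)).
  rewrite [(d * x) ^+ 2]exprMn [leRHS]mulrA; apply: ler_wpM2r; first exact: sqr_ge0.
  rewrite (_ : 4 * d ^+ 2 = (2 * d) ^+ 2); last by ring.
  by rewrite -subr_ge0 (_ : _ - _ = (d - 1) * (3 * d + 1)); [apply: mulr_ge0; lra|ring].
apply: (@le_trans _ _ (4 * (y + z) ^+ 2)).
  by apply: ler_wpM2l => //; rewrite ler_pXn2r ?nnegrE// (le_trans dx).
by have := sqr_ge0 (y - z); rewrite sqrrB sqrrD; lra.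
Qed.

(** The inequality x <= e ^ x trades the derivative that the data lack for a
    factor 1 / t. *)
Lemma h2_positive_time t : 0 < t ->
  exists M, sum_le (fun k => (1 + k%:~R ^+ 2) ^+ 2 * nc (u k t) ^+ 2) M.
Proof.
move=> t0; have [Y [M hY h]] := parabolic_gain.
have ct0 : 0 < 2 * c * t by rewrite mulr_gt0// mulr_gt0.
have hm := maj_h1.2.
have e8 : 0 <= 8 :> R by [].
have w8 : 0 <= 8 / (2 * c * t) by rewrite divr_ge0// ltW.
exists (8 / (2 * c * t) * K ^+ 2 + 8 * M).
apply: le_sum_le (sum_leD (sum_leZ w8 hm) (sum_leZ e8 hY)) => k.
have [->|k0] := eqVneq k 0.
  by rewrite u_0 nc0 expr0n/= mulr0 addr_ge0// mulr_ge0// sqr_ge0.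
have y0 : 0 <= A k ^+ 2 * expR (- (c * A k ^+ 2) * t) * maj k.
  by rewrite mulr_ge0// mulr_ge0 ?sqr_ge0 ?expR_ge0.
apply: (le_trans (h2_weight k0 (nc_ge0 _) y0 (h k t (ltW t0)))); apply: lerD; last first.
  apply: ler_wpM2l => //; rewrite exprMn ler_piMl ?sqr_ge0// expr_le1 ?rho_ge0// rho_le1//.
rewrite -[leRHS]mulrA; apply: ler_wpM2l => //; rewrite [leRHS]mulrC ler_pdivlMr//.
set d := A k ^+ 2.
rewrite (_ : _ * (2 * c * t) = (d * maj k ^+ 2) * ((2 * c * t * d) * expR (- (c * d) * t) ^+ 2)); last by ring.
rewrite exprMn -/d ler_piMr//; first by rewrite mulr_ge0 ?sqr_ge0.
rewrite -expRM_natl; set x := 2 * c * t * d.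
rewrite (_ : 2%:R * _ = - x); last by rewrite /x; ring.
rewrite expRN -ler_pdivlMr ?invr_gt0 ?expR_gt0// invrK mul1r.
by apply: le_trans (expR_ge1Dx x); rewrite lerDr.
Qed.

(** The time integral of e ^ (- 2 c k ^ 2 t) is 1 / (2 c k ^ 2), which makes up
    for the derivative that the data lack. *)
Lemma h2_integrable : exists M : R,
  (integral (Leb R) `[0, +oo[ (fun t =>
    \esum_(k in [set: int]) ((1 + (k%:~R : R) ^+ 2) ^+ 2 * nc (u k t) ^+ 2)%:E)%E <= M%:E)%O.
Proof.
have [Y [M hY h]] := parabolic_gain.
have ci0 : 0 <= c^-1 by rewrite invr_ge0 ltW.
have w4 : 0 <= 4 / c by rewrite mulr_ge0.
have w8 : 0 <= 8 / c by rewrite mulr_ge0.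
exists (4 / c * K ^+ 2 + 8 / c * M).
pose b k := 4 / c * (A k * maj k) ^+ 2 + 8 / c * Y k ^+ 2.
pose I : set R := [set` `[0, +oo[%R].
have mI : meas I by exact: measurable_itv.
have mw k : mfun I (fun t : R => (1 + (k%:~R : R) ^+ 2) ^+ 2 * nc (u k t) ^+ 2).
  apply: (measurable_funS measurableT) => //.
  apply: measurable_funM; first exact: measurable_cst.
  exact: continuous_measurable_fun (ccont_nc_sqr (cu k)).
apply: (@integral_esum_le _ I _ b) => //; first by move=> t k; rewrite mulr_ge0 ?sqr_ge0.
  move=> k; have [->|k0] := eqVneq k 0.
    under eq_integral do rewrite u_0 nc0 expr0n mulr0.
    by rewrite integral0 lee_fin addr_ge0// mulr_ge0// sqr_ge0.
  set d := A k ^+ 2.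
  have K1 := norm_int_ge1 R k0.
  have d0 : 0 < d by rewrite exprn_gt0// (lt_le_trans ltr01).
  have cd : 0 < 2 * c * d by rewrite mulr_gt0// mulr_gt0.
  have me r : mfun I (fun t : R => (expR (- r * t))%:E).
    apply/measurable_EFinP; apply: (measurable_funS measurableT) => //.
    by apply: continuous_measurable_fun; apply: continuous_expRM.
  have me' (q r : R) : mfun I (fun t : R => q%:E * (expR (- r * t))%:E)%E.
    by apply: emeasurable_funM (me r); exact: measurable_cst.
  have a8 : 0 <= 8 * (d * maj k) ^+ 2 by rewrite mulr_ge0// sqr_ge0.
  have b8 : 0 <= 8 * Y k ^+ 2 by rewrite mulr_ge0// sqr_ge0.
  apply: (@le_trans _ _ (integral (Leb R) I (fun t =>
     (8 * (d * maj k) ^+ 2)%:E * (expR (- (2 * c * d) * t))%:E + (8 * Y k ^+ 2)%:E * (expR (- c * t))%:E)%E)).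
    apply: ge0_le_integral => //.
    - by move=> t _; rewrite lee_fin mulr_ge0 ?sqr_ge0.
    - by apply/measurable_EFinP; exact: mw.
    - exact: emeasurable_funD (me' _ _) (me' _ _).
    - move=> t; rewrite /I/= in_itv/= andbT => t0; rewrite lee_fin.
      have y0 : 0 <= A k ^+ 2 * expR (- (c * A k ^+ 2) * t) * maj k.
        by rewrite mulr_ge0// mulr_ge0 ?sqr_ge0 ?expR_ge0.
      apply: (le_trans (h2_weight k0 (nc_ge0 _) y0 (h k t t0))).
      rewrite -/d rhoE// !exprMn -!expRM_natl.
      rewrite (_ : 2%:R * (- (c * d) * t) = - (2 * c * d) * t); last by ring.
      rewrite (_ : 2%:R * (- (c / 2) * t) = - c * t); last by field.
      by rewrite le_eqVlt; apply/orP; left; apply/eqP; ring.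
  rewrite ge0_integralD//; last first.
  - exact: me'.
  - by move=> t _; rewrite mule_ge0 ?lee_fin ?expR_ge0.
  - exact: me'.
  - by move=> t _; rewrite mule_ge0 ?lee_fin ?expR_ge0.
  rewrite !ge0_integralZl_EFin//; last 2 first.
  - exact: me.
  - exact: me.
  rewrite !integral_expR// -!EFinM -EFinD lee_fin /b le_eqVlt; apply/orP; left; apply/eqP.
  by rewrite !exprMn -/d; field; rewrite !gt_eqF.
exact: sum_leD (sum_leZ w4 maj_h1.2) (sum_leZ w8 hY).
Qed.
End Smoothing.

(** * The equation on the Fourier side *)

Section WeightedSummability.
Variable R : realType.
Implicit Types (U : int -> R) (f : int -> R[i]).
Local Notation A k := (`|(k%:~R : R)|).

(** Cauchy-Schwarz against 1 / |k|. *)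
Lemma h1_sum_le U K : (forall k, 0 <= U k) -> U 0 = 0 -> h1_le U K -> sum_le U (2 * K).
Proof.
move=> U0 U_0 [K0 h]; have two : 0 <= 2 :> R by [].
apply: le_sum_le (sum_le_cauchy_schwarz two K0 (sum_le_inv R) h) => j.
have [->|j0] := eqVneq j 0; first by rewrite U_0 mulr0 normr0 mulr0.
have J1 := norm_int_ge1 R j0; have J0 : 0 < A j by rewrite (lt_le_trans ltr01).
by rewrite -normrM mulrA mulVf ?mul1r ?gt_eqF// ger0_norm.
Qed.

Definition h2_le f M := sum_le (fun k => (1 + (k%:~R : R) ^+ 2) ^+ 2 * nc (f k) ^+ 2) M.

Lemma h2_le_mult f M (m : int -> R[i]) : h2_le f M ->
  (forall k, nc (m k) <= 1 + (k%:~R : R) ^+ 2) -> sum_le (fun k => nc (m k * f k) ^+ 2) M.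
Proof.
move=> h hm; apply: le_sum_le h => k; rewrite ncM exprMn.
by apply: ler_wpM2r; [exact: sqr_ge0|rewrite ler_pXn2r ?nnegrE ?nc_ge0// addr_ge0// sqr_ge0].
Qed.

Lemma h2_le_h1 f M : h2_le f M -> h1_le (fun k => nc (f k)) (Num.sqrt M).
Proof.
move=> h; split; first exact: sqrtr_ge0.
rewrite sqr_sqrtr; last exact: sum_le_ge0 h.
apply: le_sum_le h => k; rewrite exprMn; apply: ler_wpM2r; first exact: sqr_ge0.
rewrite real_normK ?num_real//; set x := k%:~R ^+ 2.
have x0 : 0 <= x by exact: sqr_ge0.
by rewrite sqrrD expr1n mul1r; have := sqr_ge0 x; lra.
Qed.

Lemma h2_le_summ f M : f 0 = 0 -> h2_le f M -> summ f.
Proof.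
move=> f0 h; exists (2 * Num.sqrt M); apply: h1_sum_le (h2_le_h1 h); last by rewrite f0 nc0.
by move=> k; exact: nc_ge0.
Qed.

Lemma summ_l1_l2 f g M k : summ f -> sum_le (fun j => nc (g j) ^+ 2) M ->
  summ (fun j => f j * g (k - j)).
Proof.
move=> [K hf] hg; exists (K * Num.sqrt M) => s us.
apply: (@le_trans _ _ (\sum_(j <- s) Num.sqrt M * nc (f j))).
  apply: ler_sum => j _; rewrite ncM mulrC; apply: ler_wpM2r; first exact: nc_ge0.
  rewrite -[leLHS]ger0_norm ?nc_ge0// -sqrtr_sqr ler_wsqrtr//; exact: sum_le_term hg.
by rewrite -mulr_sumr mulrC; apply: ler_wpM2r; [exact: sqrtr_ge0|exact: hf].
Qed.
End WeightedSummability.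

Lemma zsum_lin (R : realType) (c : R[i]) (t F : int -> R[i]) : summ t -> summ F ->
  summ (fun j => F j + c * t j) /\ zsum (fun j => F j + c * t j) = zsum F + c * zsum t.
Proof.
move=> st sF; have sc := summZ c st; split; first exact: summD.
by rewrite zsumD// zsumZ.
Qed.

(** The terms of the equation involve seven distinct products. *)
Lemma regroup_products (K : comRingType) (b a1 a2 l h x D1 D2 D3 D4 D5 D6 D7 : K) :
  2 * D1 + l * (h * D2 - D3) + b * (l * (h * D4 - D5)) - a2 * (l * (h * D1 - D6))
    + a2 * (x * D1) + a1 * (l * (x * (x * D2) - D7)) =
  (2 - a2 * (l * h) + a2 * x) * D1 + (l * h + a1 * (l * x ^+ 2)) * D2 + - l * D3
    + b * (l * h) * D4 + - (b * l) * D5 + a2 * l * D6 + - (a1 * l) * D7.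
Proof. by ring. Qed.

Section EquationInModes.
Variables (R : realType) (eps beta a1 a2 : R).
Hypotheses (eps0 : 0 < eps).
Variables (f : pdist R) (M : R).
Hypotheses (f_sym : conj_sym f) (f0 : f 0 = 0) (f_h2 : h2_le f M).

(** The form of all products in the equation: p is 1 or the inverse of Lambda,
    and q has order at most two. *)
Lemma dprod_mult (p q : int -> R[i]) k :
  conj_sym p -> conj_sym q -> (forall j, nc (p j) <= 1) ->
  (forall j, nc (q j) <= 1 + (j%:~R : R) ^+ 2) ->
  let t j := p j * f j * (q (k - j) * f (k - j)) in
  summ t /\ dprod (fmult p f) (fmult q f) k = zsum t.
Proof.
move=> ps qs hp hq t.
have symM m : conj_sym m -> conj_sym (fmult m f) by move=> ms j; rewrite /fmult ms f_sym conjM.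
have sf : summ (fmult p f).
  have [K hK] := h2_le_summ f0 f_h2; exists K; apply: le_sum_le hK => j.
  by rewrite /fmult ncM ler_piMl ?nc_ge0.
have hg := h2_le_mult f_h2 hq.
split; first exact: summ_l1_l2 sf hg.
exact: (dprodE k (symM _ ps) sf (symM _ qs) hg).
Qed.

(** By linearity the seven convolutions add up to a single one with symbol
    msym. At k = 0 only the part 2 f f_x is left, and its sum changes sign
    under the reflection of j. *)
Lemma rhs_modes k : rhs eps beta a1 a2 f k =
  2 * (eps%:C)%C * (lam eps beta a1 a2 k * f k + Bk (bil beta a1 a2) f f k).
Proof.
pose one : int -> R[i] := fun=> 1.
pose li (j : int) : R[i] := (`|j|%:~R)^-1.
pose la (j : int) : R[i] := `|j|%:~R.
have c1 : conj_sym one by move=> j; rewrite conj_1.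
have cla : conj_sym la by move=> j; rewrite /la normrN conj_int.
have cli : conj_sym li by move=> j; rewrite /li normrN conjV conj_int.
have cik : conj_sym (ik R) := @ikN R.
have ch : conj_sym (hsym R) := @hsymN R.
have cM p q : conj_sym p -> conj_sym q -> conj_sym (fun j => p j * q j : R[i]).
  by move=> hp hq j; rewrite hp hq conjM.
have b1 j : nc (one j) <= 1 by rewrite nc1.
have hA (j : int) : `|(j%:~R : R)| <= 1 + (j%:~R : R) ^+ 2 /\ `|(j%:~R : R)| ^+ 2 <= 1 + (j%:~R : R) ^+ 2.
  have := @real_normK R (j%:~R) (num_real _); set x := `|_| => <-.
  by have := sqr_ge0 (x - 1); have := sqr_ge0 x; rewrite sqrrB expr1n mulr1; split; lra.
have nla j : nc (la j) = `|(j%:~R : R)| by rewrite /la nc_int intr_norm normr_id.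
have bli j : nc (li j) <= 1.
  rewrite /li ncV -/(la j) nla; have [->|j0] := eqVneq j 0; first by rewrite normr0 invr0.
  by rewrite invf_le1 ?norm_int_ge1// (lt_le_trans ltr01)// norm_int_ge1.
have nh j : nc (hsym R j) <= 1.
  rewrite /hsym ncM ncN nc_i mul1r nc_int.
  by case: (sgzP j); rewrite ?normr0 ?mulrN1z ?normrN ?normr1.
have w1 (j : int) : (1 : R) <= 1 + (j%:~R : R) ^+ 2 by rewrite lerDl sqr_ge0.
have bone j : nc (one j) <= 1 + (j%:~R : R) ^+ 2 by exact: le_trans (b1 j) (w1 j).
have bik j : nc (ik R j) <= 1 + (j%:~R : R) ^+ 2 by rewrite nc_ik; have [] := hA j.
have bh j : nc (hsym R j) <= 1 + (j%:~R : R) ^+ 2 by exact: le_trans (nh j) (w1 j).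
have bla j : nc (la j * la j) <= 1 + (j%:~R : R) ^+ 2.
  by rewrite ncM nla -expr2; have [] := hA j.
have bhm q j : nc (q j) <= 1 + (j%:~R : R) ^+ 2 -> nc (hsym R j * q j) <= 1 + (j%:~R : R) ^+ 2.
  by move=> hq; rewrite ncM; apply: le_trans hq; rewrite ler_piMl ?nc_ge0.
have bik2 j : nc (ik R j * ik R j) <= 1 + (j%:~R : R) ^+ 2.
  by rewrite ncM nc_ik -expr2; have [] := hA j.
have [s1 d1] := dprod_mult k c1 cik b1 bik.
have [s2 d2] := dprod_mult k cli c1 bli bone.
have [s3 d3] := dprod_mult k cli ch bli bh.
have [s4 d4] := dprod_mult k cli (cM _ _ cla cla) bli bla.
have [s5 d5] := dprod_mult k cli (cM _ _ ch (cM _ _ cla cla)) bli (fun j => bhm (fun j => la j * la j) j (bla j)).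
have [s6 d6] := dprod_mult k c1 (cM _ _ ch cik) b1 (fun j => bhm (ik R) j (bik j)).
have [s7 d7] := dprod_mult k cli (cM _ _ cik cik) bli bik2.
have e1 : fmult one f = f by apply/funext => j; rewrite /fmult mul1r.
have e2 : fmult (fun j => la j * la j) f = Lam (Lam f) by apply/funext => j; rewrite /Lam /fmult mulrA.
have e3 : fmult (fun j => hsym R j * (la j * la j)) f = hilbert (Lam (Lam f)).
  by apply/funext => j; rewrite /hilbert /Lam /fmult !mulrA.
have e4 : fmult (fun j => hsym R j * ik R j) f = hilbert (dx f).
  by apply/funext => j; rewrite /hilbert /dx /fmult !mulrA.
have e5 : fmult (fun j => ik R j * ik R j) f = dx (dx f).
  by apply/funext => j; rewrite /dx /fmult !mulrA.
rewrite ?e1 ?e2 ?e3 ?e4 ?e5 in d1 d2 d3 d4 d5 d6 d7.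
rewrite -/(dx f) in d1; rewrite -/(Laminv f) in d2 d3 d4 d5 d7; rewrite -/(hilbert f) in d3.
set h := hsym R k; set x := ik R k; set l := la k.
set ns := nsym a1 a2 k.
(* The definition, unfolded at the frequency k. *)
have rE : rhs eps beta a1 a2 f k =
    ns * (x * f k) + ((a1 + a2)%:C)%C * (ns * (x * (x * f k))) + ns * (h * f k)
    - (beta%:C)%C * (ns * (h * (x * (x * f k))))
    + ((a1 * a2)%:C)%C * (ns * (x * (x * (x * f k))))
    - (eps%:C)%C * (ns * (
      2 * dprod f (dx f) k + l * (h * dprod (Laminv f) f k - dprod (Laminv f) (hilbert f) k)
      + (beta%:C)%C * (l * (h * dprod (Laminv f) (Lam (Lam f)) k - dprod (Laminv f) (hilbert (Lam (Lam f))) k))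
      - (a2%:C)%C * (l * (h * dprod f (dx f) k - dprod f (hilbert (dx f)) k))
      + (a2%:C)%C * (x * dprod f (dx f) k)
      + (a1%:C)%C * (l * (x * (x * dprod (Laminv f) f k) - dprod (Laminv f) (dx (dx f)) k)))) by [].
rewrite rE regroup_products {rE}.
have [SM key] : summ (fun j => msym beta a1 a2 k j * (f j * f (k - j))) /\
  zsum (fun j => msym beta a1 a2 k j * (f j * f (k - j))) =
  (2 - (a2%:C)%C * (l * h) + (a2%:C)%C * x) * dprod f (dx f) k
  + (l * h + (a1%:C)%C * (l * x ^+ 2)) * dprod (Laminv f) f k
  + - l * dprod (Laminv f) (hilbert f) k
  + (beta%:C)%C * (l * h) * dprod (Laminv f) (Lam (Lam f)) k
  + - ((beta%:C)%C * l) * dprod (Laminv f) (hilbert (Lam (Lam f))) k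
  + (a2%:C)%C * l * dprod f (hilbert (dx f)) k
  + - ((a1%:C)%C * l) * dprod (Laminv f) (dx (dx f)) k.
  have S1 := summZ (2 - (a2%:C)%C * (l * h) + (a2%:C)%C * x) s1.
  have E1 := zsumZ (2 - (a2%:C)%C * (l * h) + (a2%:C)%C * x) s1.
  have [S2 E2] := zsum_lin (l * h + (a1%:C)%C * (l * x ^+ 2)) s2 S1.
  have [S3 E3] := zsum_lin (- l) s3 S2.
  have [S4 E4] := zsum_lin ((beta%:C)%C * (l * h)) s4 S3.
  have [S5 E5] := zsum_lin (- ((beta%:C)%C * l)) s5 S4.
  have [S6 E6] := zsum_lin ((a2%:C)%C * l) s6 S5.
  have [S7 E7] := zsum_lin (- ((a1%:C)%C * l)) s7 S6.
  rewrite d1 d2 d3 d4 d5 d6 d7 -E1 -E2 -E3 -E4 -E5 -E6 -E7.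
  set G := (X in _ = zsum X).
  suff -> : (fun j => msym beta a1 a2 k j * (f j * f (k - j))) = G by split; first exact: S7.
  apply/funext => j; rewrite /G /msym -/h -/x /one /li -/l -/(la k) -/l /la.
  ring.
rewrite -key.
have bz : Bk (bil beta a1 a2) f f k = - (2^-1%:C)%C * (ns * zsum (fun j => msym beta a1 a2 k j * (f j * f (k - j)))).
  rewrite /Bk; case: eqP => [k0|_]; last first.
    rewrite mulrA -zsumZ//; congr zsum; apply/funext => j.
    by rewrite /bil -/ns !mulrA.
  rewrite (_ : (fun j => _) = fun j => 2 * (one j * f j * (ik R (k - j) * f (k - j)))); last first.
    apply/funext => j; rewrite k0 /msym ik0 /hsym sgz0 normr0 /one; ring.
  rewrite zsumZ//; set T := zsum _; suff -> : T = 0 by rewrite !mulr0.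
  have TN : T = - T.
    rewrite /T -{1}zsum_opp -zsumN//; congr zsum; apply/funext => j.
    by rewrite k0 !sub0r opprK /one /ik mulrNz; ring.
  have : T *+ 2 = 0 by rewrite mulr2n {1}TN addNr.
  by move/eqP; rewrite mulrn_eq0/= => /eqP.
rewrite bz; set Z := zsum _.
rewrite /lam /lsym -/ns -/x -/h.
have e0 : (eps%:C)%C != 0 :> R[i] by rewrite fmorph_eq0 gt_eqF.
have -> : ((2 * eps)^-1%:C)%C = (2 * (eps%:C)%C)^-1 :> R[i] by rewrite fmorphV rmorphM/= rmorph_nat.
have -> : (2^-1%:C)%C = 2^-1 :> R[i] by rewrite fmorphV rmorph_nat.
move: (eps%:C)%C e0 => e e0.
by field.
Qed.
End EquationInModes.

(** * Sobolev norms in terms of the Fourier coefficients *)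

Section SobolevNorms.
Variable R : realType.
Implicit Types (u : R -> R) (a : int -> R) (e : R).
Local Notation A k := (`|(k%:~R : R)|).
Local Open Scope ereal_scope.

Lemma poweR_le_sqr (x : \bar R) e : 0 <= x -> (0 <= e)%R ->
  (x `^ 2^-1 <= e%:E) = (x <= (e ^+ 2)%:E).
Proof.
move=> x0 e0; case: x x0 => [r||]// r0.
  have e2 : (0 <= e ^+ 2)%R by exact: sqr_ge0.
  by rewrite poweR12_sqrt// /= !lee_fin -[X in (_ <= X)%R = _](ger0_norm e0) -sqrtr_sqr ler_sqrt.
by rewrite poweRyr ?invr_eq0 ?pnatr_eq0// !leye_eq.
Qed.

Lemma sobolev_norm2_ge0 s u : 0 <= sobolev_norm2 s u.
Proof.
apply: esum_ge0 => k _; rewrite lee_fin; apply: mulr_ge0; last exact: sqr_ge0.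
by apply: exprn_ge0; rewrite addr_ge0 ?sqr_ge0.
Qed.

Lemma sobolev_norm2_leP s u e :
  sobolev_norm2 s u <= e%:E <->
  sum_le (fun k => (1 + (k%:~R : R) ^+ 2) ^+ s * nc (fourier u k) ^+ 2)%R e.
Proof.
apply: esum_leP => k; apply: mulr_ge0; last exact: sqr_ge0.
by apply: exprn_ge0; rewrite addr_ge0 ?sqr_ge0.
Qed.

Lemma sobolev_norm_leP s u e : (0 <= e)%R -> sobolev_norm s u <= e%:E <->
  sum_le (fun k => (1 + (k%:~R : R) ^+ 2) ^+ s * nc (fourier u k) ^+ 2)%R (e ^+ 2).
Proof. by move=> e0; rewrite /sobolev_norm poweR_le_sqr ?sobolev_norm2_ge0// sobolev_norm2_leP. Qed.

Lemma sobolev_norm2_ltyP s u : sobolev_norm2 s u < +oo <-> exists e,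
  sum_le (fun k => (1 + (k%:~R : R) ^+ 2) ^+ s * nc (fourier u k) ^+ 2)%R e.
Proof.
split=> [h|[e /sobolev_norm2_leP h]]; last exact: le_lt_trans h (ltry _).
exists (fine (sobolev_norm2 s u)); apply/sobolev_norm2_leP.
by rewrite fineK// ge0_fin_numE// sobolev_norm2_ge0.
Qed.

Lemma cvge0_ge0 (T : Type) (F : set_system T) (FF : Filter F) (v : T -> \bar R) :
  (forall x, 0 <= v x) ->
  v @ F --> 0 <-> (forall e, (0 < e)%R -> \forall x \near F, v x <= e%:E).
Proof.
move=> v0; split=> [/fine_cvgP[hf /cvgrPdist_le h] e e0|h].
  apply: filterS2 hf (h e e0) => x fx; rewrite sub0r normrN => hx.
  by rewrite -(fineK fx) lee_fin (le_trans _ hx)// ler_norm.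
have fin x e : v x <= e%:E -> v x \is a fin_num.
  by move=> hx; rewrite ge0_fin_numE// (le_lt_trans hx) ?ltry.
apply/fine_cvgP; split; first by apply: filterS (h 1%R ltr01) => x /fin.
apply/cvgrPdist_le => e e0; apply: filterS (h e e0) => x hx.
rewrite sub0r normrN ger0_norm ?fine_ge0//.
by rewrite -lee_fin fineK// (fin _ _ hx).
Qed.
End SobolevNorms.

Section SobolevContinuity.
Variable R : realType.
Implicit Types (a : R -> int -> R) (b : int -> R).
Local Notation A k := (`|(k%:~R : R)|).

(** The majorant b makes the sum a uniform limit of continuous functions, and
    it vanishes at t0. *)
Lemma sum_le_small a b (K t0 : R) : (forall t k, 0 <= a t k <= b k) -> sum_le b K ->
  (forall k, continuous (a ^~ k)) -> (forall k, a t0 k = 0) ->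
  forall e, 0 < e -> \forall t \near t0, sum_le (a t) e.
Proof.
move=> hab hb ca a0 e e0.
have a_ge0 t k : 0 <= a t k by have /andP[] := hab t k.
have b_ge0 k : 0 <= b k by have /andP[] := hab t0 k; exact: le_trans.
pose F t k : R[i] := (a t k)%:C%C.
have nF t k : nc (F t k) = a t k by rewrite nc_real ger0_norm.
have cF : ccont (fun t => zsum (F t)).
  apply: (ccont_zsum b_ge0 hb) => [t j|j]; first by rewrite nF; have /andP[] := hab t j.
  by split=> t /=; [exact: ca|exact: cvg_cst].
have F0 : zsum (F t0) = 0.
  by rewrite (_ : F t0 = fun=> 0) ?zsum0//; apply/funext => k; rewrite /F a0.
move/ccontP: cF => /(_ t0 e e0); apply: filterS => t; rewrite F0 subr0 => ht.
have sF : summ (F t) by exists K; apply: le_sum_le hb => j; rewrite nF; have /andP[] := hab t j.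
apply: sum_leP => // n; apply: le_trans ht; apply: le_trans (Re_le_nc _).
apply: le_trans (ler_norm _).
have /ccvg_components[hr _] := zsum_ccvg sF.
have e1 m : Re (psum (F t) m) = psum (a t) m by rewrite /psum Re_sum.
have {}hr : psum (a t) m @[m --> \oo] --> Re (zsum (F t)) by under eq_fun do rewrite -e1.
rewrite -(cvg_lim _ hr)//; apply: nondecreasing_cvgn_le; first exact: psum_nondecreasing.
by apply/cvg_ex; eexists; exact: hr.
Qed.

Lemma h1_sobolev_sum (z : int -> R[i]) (x : R) : z 0 = 0 -> h1_le (fun k => nc (z k)) x ->
  sum_le (fun k => (1 + (k%:~R : R) ^+ 2) ^+ 1 * nc (z k) ^+ 2) (2 * x ^+ 2).
Proof.
move=> z0 [x0 h]; have two : 0 <= 2 :> R by [].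
apply: le_sum_le (sum_leZ two h) => k; rewrite expr1 -[k%:~R ^+ 2]real_normK ?num_real//.
have [->|k0] := eqVneq k 0; first by rewrite z0 nc0 !(mulr0, expr0n).
have d2 : 1 <= A k ^+ 2 by rewrite expr_ge1// norm_int_ge1.
rewrite exprMn [leRHS]mulrA; apply: ler_wpM2r; first exact: sqr_ge0.
lra.
Qed.

Lemma sobolev_sum_h1 (z : int -> R[i]) (x : R) : 0 <= x ->
  sum_le (fun k => (1 + (k%:~R : R) ^+ 2) ^+ 1 * nc (z k) ^+ 2) (x ^+ 2) ->
  h1_le (fun k => nc (z k)) x.
Proof.
move=> x0 h; split=> //; apply: le_sum_le h => k.
rewrite expr1 exprMn real_normK ?num_real//.
by apply: ler_wpM2r; [exact: sqr_ge0|rewrite lerDr].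
Qed.

(** Data in H^1 give no control of the right-hand side of the equation at time
    0 itself. *)
Lemma rint_change_left (t : R) (g h : R -> R) : 0 <= t -> (forall s, 0 < s <= t -> g s = h s) ->
  rint `[0, t] h -> rint `[0, t] g /\ \int[Leb R]_(s in `[0, t]) g s = \int[Leb R]_(s in `[0, t]) h s.
Proof.
move=> t0 gh ih.
pose I : set R := [set` `]0, t]%R].
have eqI s : I s -> g s = h s by rewrite /I/= in_itv/=; exact: gh.
have mh : mfun I h.
  exact: (@measurable_fun_itv_obnd_cbndP R 0 (BRight t) h).2 (rint_measurable ih).
have mgI : mfun I g.
  by apply: eq_measurable_fun mh => s /set_mem/eqI.
have mg : mfun `[0, t] g :=  (@measurable_fun_itv_obnd_cbndP R 0 (BRight t) g).1 mgI.
have mI : meas I by exact: measurable_itv.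
have iI (f : R -> \bar R) : mfun I f -> integral (Leb R) `[0, t] f = integral (Leb R) I f.
  by move=> mf; rewrite -integral_itv_obnd_cbnd.
split; last first.
  rewrite /Rintegral (iI (fun s => (g s)%:E)); last exact/measurable_EFinP.
  rewrite (iI (fun s => (h s)%:E)); last exact/measurable_EFinP.
  by congr fine; apply: eq_integral => s /set_mem/eqI ->.
apply/integrableP; split; first exact/measurable_EFinP.
have /integrableP[_] := ih.
rewrite (iI (fun s => `|(h s)%:E|)%E); last by apply: measurableT_comp => //; exact/measurable_EFinP.
rewrite (iI (fun s => `|(EFin \o g) s|)%E); last by apply: measurableT_comp => //; exact/measurable_EFinP.
by congr (_ < _)%E; apply: eq_integral => s /set_mem/eqI /= ->.
Qed.

Lemma cintegral_change_left (t : R) (g h : R -> R[i]) : 0 <= t ->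
  (forall s, 0 < s <= t -> g s = h s) -> cintegrable `[0, t] h ->
  cintegrable `[0, t] g /\ cintegral `[0, t] g = cintegral `[0, t] h.
Proof.
move=> t0 gh [hr hi].
have [gr er] := rint_change_left t0 (fun s hs => congr1 (@complex.Re R) (gh s hs)) hr.
have [gi ei] := rint_change_left t0 (fun s hs => congr1 (@complex.Im R) (gh s hs)) hi.
by split; [split|rewrite /cintegral er ei].
Qed.
End SobolevContinuity.

(** * Existence *)

Section Existence.
Variables (R : realType) (eps beta a1 a2 : R).
Hypotheses (eps0 : 0 < eps) (beta0 : 0 <= beta) (a1_gt0 : 0 < a1) (a2_gt0 : 0 < a2).
Local Notation A k := (`|(k%:~R : R)|).

(** The threshold of the iteration for the dissipation rate and the bilinear
    constant of the equation, neither of which involves the surface tension. *)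
Definition small : R := diss eps a1 a2 / (8 * (8 * (8 * bilC a1 a2))).

Lemma small_gt0 : 0 < small.
Proof. by rewrite divr_gt0 ?diss_gt0// !mulr_gt0 ?bilC_gt0. Qed.

Let C1 := bilC a1 a2 * (1 + beta).
Let C1_ge0 : 0 <= C1. Proof. by apply: mulr_ge0; [exact: ltW (bilC_gt0 _ _)|rewrite addr_ge0]. Qed.

Lemma bil_le1 k j : k != 0 -> j != 0 -> k - j != 0 ->
  nc (bil beta a1 a2 k j) <= bilC a1 a2 * (1 + beta / A k) * (A j * A (k - j)).
Proof. by move=> k0 j0 l0; have [] := bil_le beta0 a1_gt0 a2_gt0 k0 j0 l0. Qed.

Lemma bil_le2 k j : k != 0 -> j != 0 -> k - j != 0 ->
  nc (bil beta a1 a2 k j) <= C1 * (A j + A (k - j)).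
Proof. by move=> k0 j0 l0; have [] := bil_le beta0 a1_gt0 a2_gt0 k0 j0 l0. Qed.

Lemma fourier_zero_mean (v : R -> R) : L2T v -> zero_mean v -> fourier v 0 = 0.
Proof.
move=> Lv hv; have iv := L2T_rint Lv; apply: complex_eq.
  by rewrite Re_fourier0// hv mulr0.
have := fourier_sym 0 iv; rewrite oppr0 => /(congr1 (@complex.Im R)).
by case: (fourier v 0) => a b /= h; lra.
Qed.

Lemma zero_mean_fourier (v : R -> R) : L2T v -> fourier v 0 = 0 -> zero_mean v.
Proof.
move=> Lv hv; have := Re_fourier0 (L2T_rint Lv); rewrite hv => /esym/eqP.
by rewrite mulf_eq0 invr_eq0 mulrn_eq0/= gt_eqF ?pi_gt0//= => /eqP.
Qed.

(** The modes found by iteration are the Fourier coefficients of a solution: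
    it is in H^2 at every positive time, where the right-hand side is then an
    explicit continuous function of time. *)
Theorem small_data_solution (f0 : R -> R) :
  sobolev 1 f0 -> zero_mean f0 -> (sobolev_norm 1 f0 <= small%:E)%E ->
  exists f, [/\ is_solution eps beta a1 a2 f0 +oo%E f,
    continuous_in_sobolev `[0, +oo[ 1 f,
    square_integrable_in_sobolev `[0, +oo[ 2 f
    & (fun t => sobolev_norm 1 (f t)) @ +oo --> 0%E].
Proof.
move=> [L0 _] z0 hs.
have c0 := diss_gt0 eps0 a1_gt0 a2_gt0; have C0 := bilC_gt0 a1_gt0 a2_gt0.
set c := diss eps a1 a2 in c0.
have sm0 := small_gt0.
pose u0 := fourier f0.
have u0_0 : u0 0 = 0 by exact: fourier_zero_mean.
have u0N k : u0 (- k) = ((u0 k)^*)%C by apply: fourier_sym; exact: L2T_rint.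
have u0h : h1_le (fun k => nc (u0 k)) small.
  by apply: (sobolev_sum_h1 (ltW sm0)); apply/(sobolev_norm_leP 1 f0 (ltW sm0)).
have lre k (k0 : k != 0) := lam_re_le eps0 beta0 a1_gt0 a2_gt0 k0.
have [u gu u_eq] := picard beta0 C0 c0 lre (lamN eps beta a1 a2) bil_le1 (bilN beta a1 a2) u0_0 u0N u0h.
have cB k := good_ccont beta0 C0 c0 bil_le1 u0_0 u0h k gu.
have h1K t := good_h1 C0 c0 u0h t gu.
have m_h1 := maj_h1 C0 c0 u0h.
have [cu u_0 u_init uN u_maj] := gu.
have m0 := maj_ge0 C0 c0 u0.
set K := 6 * _ in h1K m_h1.
have h2t (t : R) := h2_positive_time beta0 C1_ge0 c0 lre bil_le2 m0 m_h1 cu cB u_0 u_maj u_eq (t := t).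
have [M hM] := h2_integrable beta0 C1_ge0 c0 lre bil_le2 m0 m_h1 cu cB u_0 u_maj u_eq.
have us t : conj_sym (u^~ t) by move=> k; exact: uN.
have su t : summ (u^~ t).
  exists (2 * (rho c t * K)); apply: h1_sum_le (h1K t); last by rewrite u_0 nc0.
  by move=> k; exact: nc_ge0.
pose f t := fser (u^~ t).
have Lf t : L2T (f t) by exact: L2T_fser.
have Ff t k : fourier (f t) k = u k t by exact: fourier_fser.
have FfE t : fourier (f t) = u^~ t by apply/funext => k.
have cont I : continuous_in_sobolev I 1 f.
  split=> [t _|t It].
    split=> //; apply/sobolev_norm2_ltyP; exists (2 * (rho c t * K) ^+ 2).
    by rewrite FfE; apply: h1_sobolev_sum (h1K t); exact: u_0.
  apply/cvge0_ge0 => [t'|e e0]; first exact: poweR_ge0.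
  pose a t' k := (1 + (k%:~R : R) ^+ 2) ^+ 1 * nc (u k t' - u k t) ^+ 2.
  have small_a : \forall t' \near t, sum_le (a t') (e ^+ 2).
    have four : 0 <= 4 :> R by [].
    have nm k : nc ((maj (bilC a1 a2) c u0 k)%:C%C : R[i]) = maj (bilC a1 a2) c u0 k.
      by rewrite nc_real ger0_norm.
    have m_0 : maj (bilC a1 a2) c u0 0 = 0.
      by rewrite /maj u0_0 nc0 norm_int0 expr0n/= invr0 mulr0 addr0.
    have hm : h1_le (fun k => nc ((maj (bilC a1 a2) c u0 k)%:C%C : R[i])) K.
      by apply: h1_le_mono m_h1 => k; rewrite nm m0 lexx.
    have hz : (fun k => (maj (bilC a1 a2) c u0 k)%:C%C : R[i]) 0 = 0 by rewrite /= m_0.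
    have hb := sum_leZ four (h1_sobolev_sum hz hm).
    apply: (sum_le_small _ hb) => [t' k|k|k|]; last exact: exprn_gt0.
    - have w0 : 0 <= (1 + (k%:~R : R) ^+ 2) ^+ 1 by rewrite expr1 addr_ge0 ?sqr_ge0.
      apply/andP; split; first by rewrite mulr_ge0 ?sqr_ge0.
      rewrite [leRHS]mulrCA; apply: ler_wpM2l => //; rewrite nm.
      rewrite (_ : 4 * _ = (2 * maj (bilC a1 a2) c u0 k) ^+ 2); last by ring.
      rewrite ler_pXn2r ?nnegrE ?nc_ge0 ?mulr_ge0//; apply: (le_trans (ncB _ _)).
      have um s : nc (u k s) <= maj (bilC a1 a2) c u0 k.
        by apply: (le_trans (u_maj k s)); rewrite ler_piMl// rho_le1.
      by have := lerD (um t') (um t); rewrite mulr_natl mulr2n.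
    - have cd := ccont_nc_sqr (ccontB (cu k) (ccont_cst (u k t))).
      by move=> t'; apply: cvgM; [exact: cvg_cst|exact: cd].
    - by rewrite /a subrr nc0 expr0n mulr0.
  rewrite /within/=; apply: filterS small_a => t' h _.
  apply/(sobolev_norm_leP 1 _ (ltW e0)); apply: le_sum_le h => k.
  by rewrite fourierB ?Ff//; exact: L2T_rint.
have sq : square_integrable_in_sobolev `[0, +oo[ 2 f.
  rewrite /square_integrable_in_sobolev; apply: le_lt_trans (ltry M).
  by under eq_integral do rewrite /sobolev_norm2 FfE.
exists f; split=> //; last first.
  apply/cvge0_ge0 => [t|e e0]; first exact: poweR_ge0.
  have K0 : 0 <= K by have [] := m_h1.
  pose q := e / (2 * K + 1).
  have q0 : 0 < q by rewrite divr_gt0// ltr_wpDl// mulr_ge0.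
  have cq : 0 < c / 2 by rewrite divr_gt0.
  apply: filterS (nbhs_pinfty_ge (num_real (Num.max 0 (q^-1 / (c / 2))))) => t.
  rewrite ge_max => /andP[t0]; rewrite ler_pdivrMr// => qt.
  have hr : rho c t <= q.
    rewrite rhoE// mulNr expRN -[leRHS]invrK lef_pV2 ?posrE ?expR_gt0 ?invr_gt0//.
    by apply: le_trans (expR_ge1Dx _); rewrite [_ * t]mulrC (le_trans qt)// lerDr.
  apply/(sobolev_norm_leP 1 _ (ltW e0)); rewrite FfE.
  apply: sum_leW (h1_sobolev_sum (u_0 t) (h1K t)).
  have r0 := rho_ge0 c t.
  have rK : 0 <= rho c t * K by rewrite mulr_ge0.
  apply: (@le_trans _ _ ((2 * (rho c t * K)) ^+ 2)).
    by rewrite [leRHS]exprMn; apply: ler_wpM2r; [exact: sqr_ge0|rewrite (expr2 2); lra].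
  have r2K : 0 <= 2 * (rho c t * K) by rewrite mulr_ge0.
  rewrite ler_pXn2r ?nnegrE ?(ltW e0)//.
  apply: (@le_trans _ _ (q * (2 * K + 1))); last by rewrite divfK// gt_eqF// ltr_wpDl// mulr_ge0.
  rewrite mulrCA; apply: ler_pM => //; first by rewrite mulr_ge0.
  by rewrite lerDl.
split=> //.
- move=> t [t0 _]; split; first by apply: zero_mean_fourier; rewrite ?Ff.
  apply: le_lt_trans sq; apply: ge0_subset_integral => //.
  - rewrite /sobolev_norm2.
    pose w s k := (1 + (k%:~R : R) ^+ 2) ^+ 2 * nc (fourier (f s) k) ^+ 2.
    apply: (esum_measurable (a := w)) => [|s k|k]; first exact: measurable_itv.
      by rewrite mulr_ge0 ?sqr_ge0.
    apply: (measurable_funS measurableT) => //.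
    apply: measurable_funM; first exact: measurable_cst.
    under eq_fun do rewrite Ff.
    exact: continuous_measurable_fun (ccont_nc_sqr (cu k)).
  - by move=> s _; exact: sobolev_norm2_ge0.
  - by move=> s /=; rewrite !in_itv/= andbT => /andP[].
- by apply: fourier_inj_ae => // k; rewrite Ff u_init.
move=> t k [t0 _] g.
pose h s := 2 * (eps%:C)%C * (lam eps beta a1 a2 k * u k s + Bk (bil beta a1 a2) (u^~ s) (u^~ s) k).
have gh s : 0 < s <= t -> g s = h s.
  move=> /andP[s0 _]; have [N hN] := h2t s s0.
  rewrite /g FfE; exact: (rhs_modes beta a1 a2 eps0 (us s) (u_0 s) hN).
have ch : ccont (fun s => lam eps beta a1 a2 k * u k s + Bk (bil beta a1 a2) (u^~ s) (u^~ s) k).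
  by apply: ccontD; [exact: ccontZ|exact: cB].
have ih : cintegrable `[0, t] h by apply: ccont_cintegrable; exact: ccontZ.
have [ig eg] := cintegral_change_left t0 gh ih.
split=> //; rewrite eg cintegralZ//; last exact: ccont_cintegrable.
rewrite !Ff; congr (_ * _).
have [k0|k0] := eqVneq k 0; last by apply: (u_eq k t k0); rewrite t0 lexx.
rewrite k0 !u_0 subrr -[LHS](cintegral0 `[0, t]); apply: eq_cintegral => s _.
by rewrite lam0 mul0r /Bk eqxx addr0.
Qed.
End Existence.

(** * Uniqueness *)

(** What uniqueness uses of a solution on [0, t]: its Fourier coefficients,
    with a uniform bound in H^1. *)
Definition mode_solution (R : realType) (lam : int -> R[i]) (bil : int -> int -> R[i])
    (u : int -> R -> R[i]) (Y t : R) :=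
  [/\ forall k, ccont (u k), forall s, u 0 s = 0,
      forall s, h1_le (fun k => nc (u k s)) Y,
      forall k, ccont (fun s => Bk bil (u^~ s) (u^~ s) k)
    & forall k, k != 0 -> mode_eq (lam k) (fun s => Bk bil (u^~ s) (u^~ s) k) (u k) t].

Lemma h1_le_term (R : realType) (U : int -> R) (Y : R) k : 0 <= U k -> h1_le U Y ->
  `|k%:~R| * U k <= Y.
Proof.
move=> U0 [Y0 h]; have := sum_le_term k h; rewrite ler_pXn2r ?nnegrE//.
by rewrite mulr_ge0.
Qed.

Section ModesUnique.
Variables (R : realType) (lam : int -> R[i]) (bil : int -> int -> R[i]) (beta C0 C1 c : R).
Local Notation A k := (`|(k%:~R : R)|).
Hypotheses (beta0 : 0 <= beta) (C0_gt0 : 0 < C0) (C1_ge0 : 0 <= C1) (c_gt0 : 0 < c).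
Hypothesis lam_re : forall k, k != 0 -> Re (lam k) <= - (c * (A k ^+ 2 + beta * A k)).
Hypothesis bil1 : forall k j, k != 0 -> j != 0 -> k - j != 0 ->
  nc (bil k j) <= C0 * (1 + beta / A k) * (A j * A (k - j)).
Hypothesis bil2 : forall k j, k != 0 -> j != 0 -> k - j != 0 ->
  nc (bil k j) <= C1 * (A j + A (k - j)).

(** Let w be the difference of two solutions. The bilinear term loses no
    derivative in the norm sup |k| |w k|, while mu + c k ^ 2 exceeds any given
    multiple of |k| for mu large; hence a bound on |k| |w k| of order
    e ^ (mu s) can be halved, again and again. *)
Lemma modes_unique u v Y t : mode_solution lam bil u Y t -> mode_solution lam bil v Y t ->
  (forall k, u k 0 = v k 0) -> forall k s, 0 <= s <= t -> u k s = v k s.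
Proof.
move=> [cu u0 hu cBu eu] [cv v0 hv cBv ev] e0.
have Y0 : 0 <= Y by have [] := hu 0.
(* With this mu, c d ^ 2 - q d + mu is positive for all d. *)
pose q := 16 * C1 * Y; pose mu := q ^+ 2 / c.
have q0 : 0 <= q by rewrite mulr_ge0// mulr_ge0.
have half W : 0 <= W ->
    (forall k s, 0 <= s <= t -> A k * nc (u k s - v k s) <= W * expR (mu * s)) ->
    forall k s, 0 <= s <= t -> A k * nc (u k s - v k s) <= W / 2 * expR (mu * s).
  move=> W0 hW k s st; have [->|k0] := eqVneq k 0.
    by rewrite norm_int0 mul0r mulr_ge0 ?expR_ge0// divr_ge0.
  have lk := lam_re k0; have K1 := norm_int_ge1 R k0; set d := A k in lk K1 *.
  have d0 : 0 < d by rewrite (lt_le_trans ltr01).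
  have rate : q * d <= mu - Re (lam k).
    have bd : 0 <= c * (beta * d) by rewrite mulr_ge0 ?(ltW c_gt0)// mulr_ge0// ltW.
    apply: (@le_trans _ _ (mu + c * d ^+ 2)); last by move: lk; rewrite mulrDr; lra.
    rewrite -subr_ge0 (_ : _ - _ = c * (d - q / (2 * c)) ^+ 2 + 3 * q ^+ 2 / (4 * c)).
      apply: addr_ge0; first by rewrite mulr_ge0 ?sqr_ge0// ltW.
      by rewrite divr_ge0// mulr_ge0 ?sqr_ge0// ltW.
    by rewrite /mu; field; rewrite gt_eqF.
  have pos : 0 < mu - Re (lam k).
    have mu0 : 0 <= mu by rewrite divr_ge0 ?sqr_ge0// ltW.
    have : 0 < c * (d ^+ 2 + beta * d).
      by rewrite mulr_gt0// ltr_pwDl ?exprn_gt0// mulr_ge0// ltW.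
    by move: lk; lra.
  have hF r : 0 <= r <= t -> nc (Bk bil (u^~ r) (u^~ r) k - Bk bil (v^~ r) (v^~ r) k) <=
      8 * C1 * Y * W * expR (mu * r).
    move=> rt.
    rewrite (Bk_diff beta0 C0_gt0 bil1 k (u0 r) (u0 r) (v0 r) (v0 r) (hu r) (hu r) (hv r) (hv r)).
    have w0 : u 0 r - v 0 r = 0 by rewrite u0 v0 subrr.
    have We : 0 <= W * expR (mu * r) by rewrite mulr_ge0 ?expR_ge0.
    have hw j := hW j r rt.
    have [b1 _] := Bk_weak_le C1_ge0 bil2 k We w0 (u0 r) hw (hu r).
    have [_ b2] := Bk_weak_le C1_ge0 bil2 k We w0 (v0 r) hw (hv r).
    apply: (le_trans (ncD _ _)); apply: (le_trans (lerD b1 b2)).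
    by rewrite le_eqVlt; apply/orP; left; apply/eqP; ring.
  have := mode_eq_bound (ccontB (cu k) (cv k)) (ccontB (cBu k) (cBv k))
    (mode_eqB (cBu k) (cBv k) (cu k) (cv k) (eu k k0) (ev k k0)) hF pos st.
  rewrite e0 subrr nc0 mulr0 add0r => h.
  apply: (le_trans (ler_wpM2l (ltW d0) h)).
  rewrite mulrA ler_pdivrMr//.
  apply: (@le_trans _ _ (W / 2 * expR (mu * s) * (q * d))).
    by rewrite /q le_eqVlt; apply/orP; left; apply/eqP; field.
  by apply: ler_wpM2l => //; rewrite mulr_ge0 ?expR_ge0// divr_ge0.
have all n : forall k s, 0 <= s <= t ->
    A k * nc (u k s - v k s) <= (2 * Y) / 2 ^+ n * expR (mu * s).
  elim: n => [|n IH] k s st.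
    rewrite expr0 divr1.
    apply: (@le_trans _ _ (2 * Y)).
      apply: (@le_trans _ _ (A k * nc (u k s) + A k * nc (v k s))).
        by rewrite -mulrDr; apply: ler_wpM2l => //; exact: ncB.
      have := lerD (h1_le_term (nc_ge0 (u k s)) (hu s)) (h1_le_term (nc_ge0 (v k s)) (hv s)).
      by rewrite mulr_natl mulr2n.
    rewrite ler_peMr ?mulr_ge0// -expR0 ler_expR mulr_ge0//; last by case/andP: st.
    by rewrite divr_ge0 ?sqr_ge0// ltW.
  have W0 : 0 <= 2 * Y / 2 ^+ n by rewrite divr_ge0 ?mulr_ge0// exprn_ge0.
  rewrite (_ : 2 * Y / 2 ^+ n.+1 = 2 * Y / 2 ^+ n / 2); first exact: half.
  by rewrite exprS; field; rewrite expf_neq0.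
move=> k s st; have [->|k0] := eqVneq k 0; first by rewrite u0 v0.
have K1 := norm_int_ge1 R k0.
apply/eqP; rewrite -subr_eq0; apply/eqP/nc_eq0/le_anti; rewrite nc_ge0 andbT.
have lim : (fun n => 2 * Y / 2 ^+ n * expR (mu * s)) @ \oo --> (0 : R).
  rewrite -[X in _ --> X](mul0r (expR (mu * s))); apply: cvgM; last exact: cvg_cst.
  exact: cvg_half_pow.
apply: (@le_trans _ _ (A k * nc (u k s - v k s))); first by rewrite ler_peMl ?nc_ge0.
rewrite -(cvg_lim _ lim)//; apply: limr_ge; first by apply/cvg_ex; eexists; exact: lim.
by apply: nearW => n; exact: all.
Qed.
End ModesUnique.

Section SolutionModes.
Variables (R : realType) (eps beta a1 a2 : R).
Hypotheses (eps0 : 0 < eps) (beta0 : 0 <= beta) (a1_gt0 : 0 < a1) (a2_gt0 : 0 < a2).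
Local Notation A k := (`|(k%:~R : R)|).

(** Freezing a function of time outside [0, t] extends it continuously to the
    whole line. *)
Definition clamp (t s : R) := Num.max 0 (Num.min t s).

Lemma clamp_in t s : 0 <= t -> 0 <= clamp t s <= t.
Proof. by move=> t0; rewrite /clamp le_max lexx/= ge_max t0 ge_min lexx. Qed.

Lemma clamp_id t s : 0 <= s <= t -> clamp t s = s.
Proof. by move=> /andP[s0 st]; rewrite /clamp (min_idPr st) (max_idPr s0). Qed.

Lemma continuous_clamp t : continuous (clamp t).
Proof.
move=> s; apply: continuous_max; first exact: cvg_cst.
by apply: continuous_min; [exact: cvg_cst|exact: cvg_id].
Qed.

Section FromContinuity.
Variables (u : int -> R -> R[i]).
Hypothesis u_0 : forall s, u 0 s = 0.
Hypothesis u_h1 : forall s, exists Y, h1_le (fun k => nc (u k s)) Y.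
Hypothesis u_cont : forall s (e : R), 0 < e ->
  \forall r \near s, h1_le (fun k => nc (u k r - u k s)) e.

Lemma h1_continuous_mode k : ccont (u k).
Proof.
have [->|k0] := eqVneq k 0.
  by rewrite (_ : u 0 = fun=> 0); [exact: ccont_cst|apply/funext].
apply/ccontP => s e e0; apply: filterS (u_cont s e0) => r h.
apply: le_trans (h1_le_term (k := k) (nc_ge0 _) h).
by rewrite ler_peMl ?nc_ge0// norm_int_ge1.
Qed.

(** Compactness of [0, t]. *)
Lemma h1_continuous_bounded t : exists Y,
  forall s, 0 <= s <= t -> h1_le (fun k => nc (u k s)) Y.
Proof.
have := (compact_near_coveringP (`[0, t]%classic : set R)).1 (@segment_compact _ 0 t).
move=> /(_ R (pinfty_nbhs R) (fun Y s => h1_le (fun k => nc (u k s)) Y) _)[|M [_ hM]].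
  move=> s _; have [Y hY] := u_h1 s.
  exists ([set r | h1_le (fun k => nc (u k r - u k s)) 1], [set Z | 2 * (1 + Y) <= Z]).
    split=> /=; first exact: u_cont.
    exact: nbhs_pinfty_ge (num_real _).
  move=> [r Z] /= [hr hZ]; apply: h1_leW hZ _.
  apply: h1_le_mono (h1_leD hr hY) => k; rewrite nc_ge0/=.
  by apply: le_trans (ncD _ _); rewrite subrK.
exists (M + 1) => s st; apply: (hM (M + 1)); first by rewrite ltrDl.
by rewrite /= in_itv/=.
Qed.

Lemma h1_continuous_bilinear Y k : (forall s, h1_le (fun k => nc (u k s)) Y) ->
  ccont (fun s => Bk (bil beta a1 a2) (u^~ s) (u^~ s) k).
Proof.
move=> hY; have C0 := bilC_gt0 a1_gt0 a2_gt0.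
have Y0 : 0 <= Y by have [] := hY 0.
have b1 := bil_le1 beta0 a1_gt0 a2_gt0.
have am0 := amp_ge0 beta0 C0 k.
(* The summand 1 only keeps L positive. *)
pose L := 2 * amp beta (bilC a1 a2) k * Y + 1.
have L0 : 0 < L by rewrite ltr_wpDl// mulr_ge0// mulr_ge0.
apply/ccontP => s e e0; have eL : 0 < e / L by rewrite divr_gt0.
apply: filterS (u_cont s eL) => r h.
have d0 : u 0 r - u 0 s = 0 by rewrite !u_0 subrr.
rewrite (Bk_diff beta0 C0 b1 k (u_0 r) (u_0 r) (u_0 s) (u_0 s) (hY r) (hY r) (hY s) (hY s)).
have h1 := Bk_le beta0 C0 b1 k d0 (u_0 r) h (hY r).
have h2 := Bk_le beta0 C0 b1 k (u_0 s) d0 (hY s) h.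
apply: (le_trans (ncD _ _)); apply: (le_trans (lerD h1 h2)).
apply: (@le_trans _ _ (e / L * L)); last by rewrite divfK// gt_eqF.
rewrite (_ : _ + _ = e / L * (2 * amp beta (bilC a1 a2) k * Y)); last by ring.
by apply: ler_wpM2l; [exact: ltW|rewrite /L lerDl].
Qed.
End FromContinuity.

Lemma rint_change_ae (t : R) (g h : R -> R) : rint `[0, t] g -> rint `[0, t] h ->
  {ae Leb R, forall s, 0 <= s <= t -> g s = h s} ->
  \int[Leb R]_(s in `[0, t]) g s = \int[Leb R]_(s in `[0, t]) h s.
Proof.
move=> ig ih gh; rewrite /Rintegral; congr fine; apply: ae_eq_integral => //.
- exact: measurable_int ig.
- exact: measurable_int ih.
- by apply: ae_imp gh => s gh; rewrite /= in_itv/= => /gh ->.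
Qed.

Lemma cintegral_change_ae (t : R) (g h : R -> R[i]) :
  cintegrable `[0, t] g -> cintegrable `[0, t] h ->
  {ae Leb R, forall s, 0 <= s <= t -> g s = h s} ->
  cintegral `[0, t] g = cintegral `[0, t] h.
Proof.
move=> [gr gi] [hr hi] gh; rewrite /cintegral; congr Complex.
  by apply: rint_change_ae => //; apply: ae_imp gh => s gh /gh ->.
by apply: rint_change_ae => //; apply: ae_imp gh => s gh /gh ->.
Qed.

(** The H^2 norm is integrable in time, hence finite almost everywhere; the
    right-hand side is almost everywhere equal to the continuous expression in
    the modes, which may replace it under the integral. *)
Lemma solution_modes f0 T g t : is_solution eps beta a1 a2 f0 T g -> time_interval T t ->
  exists u Y, [/\ mode_solution (lam eps beta a1 a2) (bil beta a1 a2) u Y t,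
    forall k s, 0 <= s <= t -> u k s = fourier (g s) k
    & L2T (g 0) /\ L2T (g t)].
Proof.
move=> [[gS gC] gZ gI gE] It; have [t0 tT] := It.
have IT s : 0 <= s <= t -> time_interval T s.
  by move=> /andP[s0 st]; split=> //; apply: le_lt_trans tT; rewrite lee_fin.
have It' s : time_interval T (clamp t s) by apply: IT; exact: clamp_in.
have Lg s : time_interval T s -> L2T (g s) by move=> /gS[].
have [u uD] : exists u : int -> R -> R[i], forall k s, u k s = fourier (g (clamp t s)) k.
  by exists (fun k s => fourier (g (clamp t s)) k).
have u_0 s : u 0 s = 0.
  by rewrite uD; apply: fourier_zero_mean; [exact: Lg|have [] := gZ _ (It' s)].
have u_h1 s : exists Y, h1_le (fun k => nc (u k s)) Y.
  have [_ /sobolev_norm2_ltyP[e he]] := gS _ (It' s).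
  exists (Num.sqrt e); apply: sobolev_sum_h1; first exact: sqrtr_ge0.
  rewrite sqr_sqrtr; last exact: sum_le_ge0 he.
  by apply: le_sum_le he => k; rewrite uD.
have u_cont s (e : R) : 0 < e -> \forall r \near s, h1_le (fun k => nc (u k r - u k s)) e.
  move=> e0.
  have hn : nbhs (clamp t s) [set r | time_interval T r ->
      (sobolev_norm 1 (g r \- g (clamp t s))%R <= e%:E)%E].
    exact: (cvge0_ge0 _ (fun r => poweR_ge0 _ _)).1 (gC _ (It' s)) e e0.
  have hs : \forall r \near s, time_interval T (clamp t r) ->
      (sobolev_norm 1 (g (clamp t r) \- g (clamp t s))%R <= e%:E)%E.
    exact: (continuous_clamp (t := t) (x := s)) _ hn.
  apply: filterS hs => r /(_ (It' r)).
  move=> /(sobolev_norm_leP 1 _ (ltW e0)) h; apply: (sobolev_sum_h1 (ltW e0)).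
  apply: le_sum_le h => k; rewrite !uD fourierB//; exact: L2T_rint (Lg _ (It' _)).
have cu k : ccont (u k) := h1_continuous_mode u_0 u_cont k.
have [Y hY] := h1_continuous_bounded u_h1 u_cont t.
have ucl k s : u k s = u k (clamp t s) by rewrite !uD (clamp_id (clamp_in s t0)).
have hY' s : h1_le (fun k => nc (u k s)) Y.
  by apply: h1_le_mono (hY _ (clamp_in s t0)) => k; rewrite nc_ge0 (ucl k s) lexx.
have cB k := h1_continuous_bilinear u_0 u_cont k hY'.
exists u, Y; split; last 2 first.
- by move=> k s st; rewrite uD clamp_id.
- by split; apply: Lg => //; apply: IT; rewrite lexx.
split=> // k k0 s /andP[s0 st].
have ts : time_interval T s by apply: IT; rewrite s0.
have [ig eg] := gE s k ts.
have uE r k' : 0 <= r <= t -> fourier (g r) k' = u k' r by move=> rt; rewrite uD clamp_id.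
pose h r := 2 * (eps%:C)%C * (lam eps beta a1 a2 k * u k r + Bk (bil beta a1 a2) (u^~ r) (u^~ r) k).
have ch : ccont (fun r => lam eps beta a1 a2 k * u k r + Bk (bil beta a1 a2) (u^~ r) (u^~ r) k).
  by apply: ccontD; [exact: ccontZ|exact: cB].
have ih : cintegrable `[0, s] h by apply: ccont_cintegrable; exact: ccontZ.
have fin : {ae Leb R, forall r, 0 <= r <= s -> (sobolev_norm2 2 (g r) < +oo)%E}.
  have [_ sq] := gZ s ts.
  have : (Leb R).-integrable `[0, s] (fun r => sobolev_norm2 2 (g r)).
    apply/integrableP; split; last first.
      by under eq_integral do rewrite gee0_abs ?sobolev_norm2_ge0//.
    pose w r k := (1 + (k%:~R : R) ^+ 2) ^+ 2 * nc (fourier (g r) k) ^+ 2.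
    apply: (esum_measurable (a := w)) => [|r k'|k']; first exact: measurable_itv.
      by rewrite mulr_ge0 ?sqr_ge0.
    apply: (@eq_measurable_fun _ _ _ _ _ (fun r => (1 + (k'%:~R : R) ^+ 2) ^+ 2 * nc (u k' r) ^+ 2)).
      move=> r /set_mem/=; rewrite in_itv/= => /andP[r0 rs].
      by rewrite /w uE// r0 (le_trans rs).
    apply: (measurable_funS measurableT) => //.
    apply: measurable_funM; first exact: measurable_cst.
    exact: continuous_measurable_fun (ccont_nc_sqr (cu k')).
  move=> hint; have mI : meas `[0, s] by exact: measurable_itv.
  have := integrable_ae mI hint; apply: ae_imp => r hr rs.
  by have := hr; rewrite /= in_itv/= => /(_ rs); rewrite ge0_fin_numE ?sobolev_norm2_ge0.
have gh : {ae Leb R, forall r, 0 <= r <= s ->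
    rhs eps beta a1 a2 (fourier (g r)) k = h r}.
  apply: ae_imp fin => r hr rs; have /sobolev_norm2_ltyP[N hN] := hr rs.
  have rt : 0 <= r <= t by case/andP: rs => -> /le_trans; apply.
  have Lr := Lg r (IT r rt).
  rewrite (rhs_modes beta a1 a2 eps0 _ _ hN); last 2 first.
  - by move=> j; apply: fourier_sym; exact: L2T_rint.
  - by rewrite uE.
  by rewrite /h uE// (_ : fourier (g r) = u^~ r)//; apply/funext => j; exact: uE.
have := eg; rewrite (cintegral_change_ae ig ih gh) cintegralZ//; last exact: ccont_cintegrable.
rewrite !uE ?lexx ?s0//; apply: mulfI.
by rewrite mulf_eq0 pnatr_eq0/= fmorph_eq0 gt_eqF.
Qed.

Theorem solution_unique f0 T S f g t :
  is_solution eps beta a1 a2 f0 S f -> is_solution eps beta a1 a2 f0 T g ->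
  time_interval S t -> time_interval T t -> ae_eqT (g t) (f t).
Proof.
move=> hf hg tS tT; have [t0 _] := tS.
have [u [Y [mu uE [Lf0 Lft]]]] := solution_modes hf tS.
have [v [Z [mv vE [Lg0 Lgt]]]] := solution_modes hg tT.
have [_ _ f00 _] := hf; have [_ _ g00 _] := hg.
apply: fourier_inj_ae => // k.
have tt : 0 <= t <= t by rewrite t0 lexx.
have t00 : (0 : R) <= 0 <= t by rewrite lexx.
rewrite -uE// -vE//.
have mode_le X w : X <= Num.max Y Z -> mode_solution (lam eps beta a1 a2) (bil beta a1 a2) w X t ->
    mode_solution (lam eps beta a1 a2) (bil beta a1 a2) w (Num.max Y Z) t.
  by move=> hX [? ? hw ? ?]; split=> // s; apply: h1_leW (hw s).
apply: (modes_unique beta0 (bilC_gt0 a1_gt0 a2_gt0) _ (diss_gt0 eps0 a1_gt0 a2_gt0)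
  (fun k k0 => lam_re_le eps0 beta0 a1_gt0 a2_gt0 k0) (bil_le1 beta0 a1_gt0 a2_gt0)
  (bil_le2 beta0 a1_gt0 a2_gt0) (mode_le Z v _ mv) (mode_le Y u _ mu)) => //.
- by apply: mulr_ge0; [exact: ltW (bilC_gt0 _ _)|rewrite addr_ge0].
- by rewrite le_max lexx orbT.
- by rewrite le_max lexx.
move=> j; rewrite uE// vE//; apply: fourier_ae; try exact: L2T_rint.
apply: negligibleS (negligibleU g00 f00) => x ngf; apply: contrapT => /not_orP[/contrapT e1 /contrapT e2].
by apply: ngf; rewrite /= e1 e2.
Qed.
End SolutionModes.

(** * Global solutions for small data *)

Theorem theorem6p1 (R : realType) (eps alpha1 alpha2 : R) :
  0 < eps -> 0 < alpha1 -> 0 < alpha2 ->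
  exists2 C : R, 0 < C &
  forall (beta : R) (f0 : R -> R),
    0 <= beta ->
    sobolev 1 f0 -> zero_mean f0 -> (sobolev_norm 1 f0 <= C%:E)%E ->
    exists f : R -> R -> R,
      [/\ is_solution eps beta alpha1 alpha2 f0 +oo%E f,
          forall (T : \bar R) (g : R -> R -> R),
            is_solution eps beta alpha1 alpha2 f0 T g ->
            forall t, time_interval T t -> ae_eqT (g t) (f t),
          continuous_in_sobolev `[0, +oo[ 1 f,
          square_integrable_in_sobolev `[0, +oo[ 2 f
        & (fun t => sobolev_norm 1 (f t)) @ +oo --> 0%E].
Proof.
move=> eps0 a1_gt0 a2_gt0; exists (small eps alpha1 alpha2); first exact: small_gt0.
move=> beta f0 beta0 Hf0 zf0 small_f0.
have [f [sf cf qf df]] := small_data_solution eps0 beta0 a1_gt0 a2_gt0 Hf0 zf0 small_f0.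
exists f; split=> // T g sg t It.
apply: (solution_unique eps0 beta0 a1_gt0 a2_gt0 sf sg _ It).
by split; [have [] := It|exact: ltry].
Qed.
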